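(* Let $K$ be a local field with discrete valuation ring $\mathcal{O}_K$, uniformizer $\pi$, and residue field $k$ of characteristic $p$. Let $d\ge 3$ be an integer with $p\nmid 2d$. Let $g\in\mathcal{O}_K[x]$ be monic of degree $d$, and let $h\in\mathcal{O}_K[x]$ be a polynomial of degree $e\le 2d$. Suppose that $(\pi,g,g')$ and $(\pi,g,h)$ are both the unit ideal in $\mathcal{O}_K[x]$. Let $C$ be the nonsingular projective curve over $K$ with affine piece $y^2=g(x)^2+\pi h(x)$. Write $\bar g,\bar h\in k[x]$ for the reductions of $g,h$ modulo $\pi$. \begin{enumerate} \item Suppose $d$ is odd and $\bar g$ factors over $k$ as $\bar g(x)=(x-\alpha_0)g_1(x)\cdots g_s(x)$, where $\alpha_0\in k$ and each $g_i$ is irreducible over $k$. Let $\alpha_i\in\bar k$ be a root of $g_i(x)$. Then $C$ has a rational theta characteristic if and only if $\mathrm{Nm}_{k(\alpha_i)/k}\big(\bar h(\alpha_0)\bar h(\alpha_i)\big)\in k^{\times 2}$ for all $i=1,\dots,s$; here $\bar h(\alpha_i)\ne 0$ for all $i$. \item If $d$ is even or $\bar g$ is irreducible over $k$, then $C$ has a rational theta characteristic. \end{enumerate}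
   Context: A local field here is a finite extension of $\mathbb{Q}_p$ or $\mathbb{F}_q((T))$ with $q$ a power of $p$. A theta characteristic on $C$ is an invertible sheaf $L$ with $L^{\otimes 2}$ isomorphic to the canonical sheaf; it is rational if it is a class in $\mathrm{Pic}\,C$ (defined over $K$). $k^{\times 2}$ is the group of nonzero squares of $k$. *)

(* Defs.v *)
From HB Require Import structures.
From mathcomp Require Import all_boot all_order all_algebra all_field.
From mathcomp Require Import classical_sets cardinality.

Set Implicit Arguments.
Unset Strict Implicit.
Unset Printing Implicit Defensive.

Import Order.TTheory GRing.Theory Num.Theory.
Local Open Scope ring_scope.

(* Normalized discrete valuations. The value at 0, which should be +oo, is set
   to the dummy 0: thus the valuation ring is exactly [0 <= v a], and two
   discrete valuations are equal iff they agree on nonzero elements. *)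
Record dvaluation (F : fieldType) := DValuation {
  dv :> F -> int;
  dv0 : dv 0 = 0;
  dvM : forall a b, a != 0 -> b != 0 -> dv (a * b) = dv a + dv b;
  dvD : forall a b, a != 0 -> b != 0 -> a + b != 0 ->
    Num.min (dv a) (dv b) <= dv (a + b);
  dv_unif : exists2 t, t != 0 & dv t = 1
}.

(* v(a) >= n, where v(0) = +oo. *)
Definition vge (F : fieldType) (v : dvaluation F) (n : int) (a : F) : bool :=
  (a == 0) || (n <= v a).

Section ValuationRing.
Context {F : fieldType} (v : dvaluation F).

Definition vint_pred : {pred F} := fun a => 0 <= v a.

Lemma dv1 : v 1 = 0.
Proof.
have := @dvM _ v 1 1 (oner_neq0 _) (oner_neq0 _).
by rewrite mulr1 => /eqP; rewrite -[X in X == _]addr0 (inj_eq (addrI _)) => /eqP.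
Qed.

Lemma dvN a : v (- a) = v a.
Proof.
have n0 : (- 1 : F) != 0 by rewrite oppr_eq0 oner_eq0.
have vN1 : v (- 1) = 0.
  have := @dvM _ v (-1) (-1) n0 n0; rewrite mulrNN mulr1 dv1 -mulr2n => /esym/eqP.
  by rewrite mulrn_eq0 => /eqP.
have [->|a0] := eqVneq a 0; first by rewrite oppr0.
by rewrite -mulN1r dvM // vN1 add0r.
Qed.

Lemma vint_subring : subring_closed vint_pred.
Proof.
split; rewrite /vint_pred ?unfold_in /=.
- by rewrite dv1.
- move=> a b; rewrite !unfold_in => va vb.
  have [->|a0] := eqVneq a 0; first by rewrite sub0r dvN.
  have [->|b0] := eqVneq b 0; first by rewrite subr0.
  have [->|ab0] := eqVneq (a - b) 0; first by rewrite dv0.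
  have b0' : - b != 0 by rewrite oppr_eq0.
  apply: le_trans (dvD v a0 b0' ab0).
  by rewrite le_min dvN; apply/andP.
- move=> a b; rewrite !unfold_in => va vb.
  have [->|a0] := eqVneq a 0; first by rewrite mul0r dv0.
  have [->|b0] := eqVneq b 0; first by rewrite mulr0 dv0.
  by rewrite dvM // addr_ge0.
Qed.

HB.instance Definition _ := GRing.isSubringClosed.Build F vint_pred vint_subring.

Record vring := VRing { vval : F; _ : vval \in vint_pred }.
HB.instance Definition _ := [isSub for vval].
HB.instance Definition _ := [Choice of vring by <:].
HB.instance Definition _ := [SubChoice_isSubComNzRing of vring by <:].

End ValuationRing.

Section LocalFields.
Variables (F : fieldType) (v : dvaluation F).

Definition cauchy_seq (u : nat -> F) : Prop :=
  forall N : int, exists M : nat, forall m n : nat,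
    (M <= m)%N -> (M <= n)%N -> vge v N (u m - u n).

Definition converges_to (u : nat -> F) (l : F) : Prop :=
  forall N : int, exists M : nat, forall n : nat,
    (M <= n)%N -> vge v N (u n - l).

(* (F, v) is Q_p: a completion of rat with respect to the p-adic valuation. *)
Definition padic_numbers (p : nat) : Prop :=
  [/\ [pchar F] =i pred0,
      forall n : nat, (0 < n)%N -> v n%:R = (logn p n)%:Z,
      forall (a : F) (N : int), exists q : rat, vge v N (a - ratr q)
    & forall u : nat -> F, cauchy_seq u -> exists l : F, converges_to u l].

(* (F, v) is k0((T)) with its T-adic valuation: [coef a i] is the coefficient
   of T^i in a, and the coefficient families are exactly those vanishing in all
   sufficiently negative degrees. Injectivity of [coef] follows from the first
   and third clauses. *)
Definition laurent_series (k0 : fieldType) : Prop :=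
  exists coef : F -> int -> k0,
  [/\ forall a : F, a != 0 ->
        coef a (v a) != 0 /\ (forall i : int, i < v a -> coef a i = 0),
      forall c : int -> k0,
        (exists N : int, forall i : int, i < N -> c i = 0) ->
        exists a : F, forall i : int, coef a i = c i,
      forall (a b : F) (i : int), coef (a + b) i = coef a i + coef b i
    & forall (a b : F) (m n : int),
        (forall i : int, i < m -> coef a i = 0) ->
        (forall i : int, i < n -> coef b i = 0) ->
        forall r : nat, coef (a * b) (m + n + r%:Z) =
          \sum_(i < r.+1) coef a (m + i%:Z) * coef b (n + (r - i)%N%:Z)].

End LocalFields.

Definition finite_extension (K0 K : fieldType) (j : {rmorphism K0 -> K}) : Prop :=
  exists (n : nat) (b : 'I_n -> K),
    forall z : K, exists c : 'I_n -> K0, z = \sum_(i < n) j (c i) * b i.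

(* K is a finite extension of Q_p or F_q((T)), q a power of p, and v is the
   normalized valuation extending (up to scaling) that of the base field. *)
Definition local_field (p : nat) (K : fieldType) (v : dvaluation K) : Prop :=
  prime p /\
  exists (K0 : fieldType) (v0 : dvaluation K0) (j : {rmorphism K0 -> K}),
  [/\ padic_numbers v0 p \/
        (exists2 k0 : finFieldType, p \in [pchar k0] & laurent_series v0 k0),
      finite_extension j
    & exists2 e : nat, (0 < e)%N & forall a : K0, v (j a) = v0 a *+ e].

(* red exhibits k as the quotient of O_K by its ideal (pi). *)
Definition residue_map (K : fieldType) (v : dvaluation K) (pi : vring v)
    (k : fieldType) (red : {rmorphism vring v -> k}) : Prop :=
  (forall c : k, exists a : vring v, red a = c) /\
  (forall a : vring v, red a = 0 <-> exists b : vring v, a = pi * b).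

Definition unit_ideal3 (R : comNzRingType) (a b c : R) : Prop :=
  exists r s t : R, r * a + s * b + t * c = 1.

Section Curves.
Variables (K F : fieldType) (iota : {rmorphism K -> F}).

(* The value in F of the element a(X) + b(X) Y of K[X,Y]/(Y^2 - f(X)). *)
Definition coord_val (x y : F) (a b : {poly K}) : F :=
  (map_poly iota a).[x] + (map_poly iota b).[x] * y.

(* F is the fraction field of the coordinate ring K[X,Y]/(Y^2 - f(X)), with
   x and y the classes of X and Y. *)
Definition hyperelliptic_function_field (f : {poly K}) (x y : F) : Prop :=
  [/\ y ^+ 2 = (map_poly iota f).[x],
      forall a b : {poly K}, coord_val x y a b = 0 -> a = 0 /\ b = 0
    & forall z : F, exists a b a' b' : {poly K},
        coord_val x y a' b' != 0 /\
        z = coord_val x y a b / coord_val x y a' b'].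

(* The closed points of the nonsingular projective curve with function field
   F/K: the discrete valuations of F that are trivial on K. *)
Record closed_point := ClosedPoint {
  pt_val :> dvaluation F;
  pt_triv : forall c : K, pt_val (iota c) = 0
}.

Record divisor := Divisor {
  div_mult :> closed_point -> int;
  div_fin : finite_set [set P | div_mult P != 0]
}.

Definition linearly_equivalent (D E : closed_point -> int) : Prop :=
  exists2 z : F, z != 0 & forall P : closed_point, D P - E P = P z.

Definition derivation (M : lmodType F) (d : F -> M) : Prop :=
  [/\ forall a b : F, d (a + b) = d a + d b,
      forall a b : F, d (a * b) = a *: d b + b *: d a
    & forall c : K, d (iota c) = 0].

(* (Omega, d) is the module of Kaehler differentials of F/K. *)
Definition kaehler_differentials (Omega : lmodType F) (d : F -> Omega) : Prop :=
  derivation d /\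
  forall (M : lmodType F) (D : F -> M), derivation D ->
    exists phi : {linear Omega -> M},
      (forall a : F, phi (d a) = D a) /\
      (forall psi : {linear Omega -> M},
         (forall a : F, psi (d a) = D a) -> psi =1 phi).

Section Canonical.
Variables (Omega : lmodType F) (d : F -> Omega).

(* The stalk at P of the canonical sheaf Omega^1_{C/K}, as a submodule of its
   generic stalk Omega: the O_P-span of the differentials of elements of O_P. *)
Definition canonical_stalk (P : closed_point) (eta : Omega) : Prop :=
  exists (n : nat) (b a : 'I_n -> F),
    [/\ forall i, vge P 0 (b i), forall i, vge P 0 (a i)
      & eta = \sum_(i < n) b i *: d (a i)].

(* W = div(omega) for a nonzero rational differential omega, i.e.
   multiplication by omega identifies O_C(W) with the canonical sheaf. *)
Definition canonical_divisor (W : divisor) : Prop :=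
  exists2 omega : Omega, omega != 0 &
    forall (P : closed_point) (eta : Omega),
      canonical_stalk P eta <->
      exists2 z : F, vge P (- W P) z & eta = z *: omega.

(* Classes in Pic C are represented by divisors D on C over K, via O_C(D). *)
Definition theta_characteristic (D : divisor) : Prop :=
  exists2 W : divisor, canonical_divisor W &
    linearly_equivalent (fun P => D P *+ 2) W.

Definition has_rational_theta_characteristic : Prop :=
  exists D : divisor, theta_characteristic D.

End Canonical.
End Curves.

(* Main.v *)
(* On [y^2 = f(x)] with [deg f = 2d], the divisor of [dx/y] is [d - 2] times the
   polar divisor of [x], which is even when [d] is. For odd [d], a rational theta
   characteristic gives a function [z] with even order at finite points and odd
   order at infinity. Its norm to [K(x)] is [c r^2] with [c] in [K]; [c] is not a
   square, because every factor of [f = g^2 + pi h] over [K] has even degree, and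
   so [f] is a value of the form [X^2 - c Y^2], over [K[x]] by Cassels-Pfister.
   Conversely [f = A^2 - c B^2] makes [div (y - A) + div (dx/y)] twice a divisor.
   When [gbar] has a root [alpha0] in [k], reducing such an identity modulo [pi]
   forces [c] to be [pi] times a unit up to squares, and [eta * hbar] to be a square
   modulo [gbar] for some nonzero [eta] in [k], i.e. [hbar(alpha0) hbar(alpha_i)] to
   be a square in [k(alpha_i)] for all [i]; over a finite field, an element of an
   extension is a square iff its norm is. Hensel's lemma recovers the identity from
   such an [eta], which always exists when [gbar] is irreducible of odd degree. *)
Require Import Defs.
From HB Require Import structures.
From mathcomp Require Import all_boot all_order all_algebra.
From mathcomp Require Import all_fingroup all_solvable all_field.
From mathcomp Require Import boolp classical_sets cardinality.
From mathcomp Require Import ring zify.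

Set Implicit Arguments.
Unset Strict Implicit.
Unset Printing Implicit Defensive.

Import Order.TTheory GRing.Theory Num.Theory.
Local Open Scope ring_scope.

(** * Factorization of polynomials *)

(** Closed points are given only as abstract valuations, so the geometry becomes local algebra:
    above an irreducible [q] of [K[x]], every nonzero function is a power of an explicit uniformizer
    times a unit, and this both determines the valuations and constructs them. The points at
    infinity are finite points of the same field in the coordinates [1/x] and [y / x^d]. The
    arithmetic rests on one obstruction. Modulo [pi] the polynomial [f] is [gbar^2], yet because
    [hbar] is prime to [gbar], [f] lies in the square of no ideal [(pi, L)] with [L] lifting an
    irreducible factor of [gbar]. A factor of [f] of odd degree would put it there. So would an
    integral identity [f = A^2 - c B^2] with [c] a nonsquare unit, because [A] and [B] would both
    vanish at [alpha0] modulo [pi]; this is where a root of [gbar] in [k] is needed. *)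

Section PolyFactor.
Variable K : fieldType.
Implicit Types (a b f q r N : {poly K}).

Lemma dvdp_mulE q a : q %| a -> exists b : {poly K}, a = b * q.
Proof. by move=> /dvdpP[b ->]; exists b. Qed.

Lemma irredp_size q : irreducible_poly q -> (1 < size q)%N.
Proof. by case. Qed.

Lemma size_mulp a b : a != 0 -> b != 0 -> size (a * b) = (size a + size b).-1.
Proof. exact: size_mul. Qed.

Lemma irredp_dvdp_exists a : (1 < size a)%N ->
  exists2 q, irreducible_poly q & q %| a.
Proof.
elim: (size a) {-2}a (leqnn (size a)) => [|m IHm] {}a le_am a_gt1.
  by move: (leq_trans a_gt1 le_am).
have [irr_a|] := pselect (irreducible_poly a); first by exists a.
move=> nirr; have a0 : a != 0 by rewrite -size_poly_gt0 ltnW.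
have [q [q1 qa nqa]] : exists q, [/\ size q != 1%N, q %| a & ~~ (q %= a)].
  apply: contrapT => nex; apply: nirr; split=> // q q1 qa.
  by apply: contrapT => /negP nqa; apply: nex; exists q.
have lt_qa : (size q < size a)%N.
  by rewrite ltn_neqAle dvdp_leq // andbT dvdp_size_eqp.
have q0 : q != 0 by apply: contraTneq qa => ->; rewrite dvd0p.
have q_gt1 : (1 < size q)%N by move: q0 q1; rewrite -size_poly_gt0; lia.
have [|r irr_r rq] := IHm q _ q_gt1; first by rewrite -ltnS (leq_trans lt_qa).
by exists r => //; apply: dvdp_trans qa.
Qed.

Lemma irredp_dvdp_mul q a b : irreducible_poly q ->
  (q %| a * b) = (q %| a) || (q %| b).
Proof.
move=> irr_q; have [qa|nqa] /= := boolP (q %| a); first by rewrite dvdp_mulr.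
by rewrite Gauss_dvdpr // irreducible_poly_coprime.
Qed.

Lemma irredp_dvdp_exp q a n : irreducible_poly q -> q %| a ^+ n -> q %| a.
Proof.
move=> irr_q; elim: n => [|n IHn].
  by rewrite expr0 dvdp1 => /eqP q1; case: irr_q; rewrite q1.
by rewrite exprS irredp_dvdp_mul // => /orP[].
Qed.

Lemma irredp_dvdp_polyC q (c : K) : irreducible_poly q -> (q %| c%:P) = (c == 0).
Proof.
move=> [q1 _]; have [->|c0] := eqVneq c 0; first by rewrite dvdp0.
by apply: gtNdvdp; rewrite ?polyC_eq0 // size_polyC c0.
Qed.

Lemma irredp_val_exists q a : irreducible_poly q -> a != 0 ->
  exists (n : nat) (b : {poly K}), a = q ^+ n * b /\ ~~ (q %| b).
Proof.
move=> irr_q; elim: (size a) {-2}a (leqnn (size a)) => [|m IHm] {}a le_am a0.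
  by move: le_am; rewrite leqn0 size_poly_eq0 (negPf a0).
have [|nqa] := boolP (q %| a); last by exists 0%N, a; rewrite expr0 mul1r.
move=> /dvdp_mulE[b Da].
have b0 : b != 0 by apply: contra_neq a0 => b0; rewrite Da b0 mul0r.
have q1 := irredp_size irr_q; have q0 := irredp_neq0 irr_q.
have [|n [c [Db nqc]]] := IHm b _ b0.
  move: le_am; rewrite Da size_mulp //. lia.
by exists n.+1, c; split=> //; rewrite Da Db exprSr -!mulrA [c * q]mulrC.
Qed.

Lemma irredp_val_unique q n m a b : irreducible_poly q ->
  ~~ (q %| a) -> ~~ (q %| b) -> q ^+ n * a = q ^+ m * b -> n = m.
Proof.
move=> irr_q nqa nqb; wlog le_nm : n m a b nqa nqb / (n <= m)%N => [hwlog|] E.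
  have [|/ltnW] := leqP n m => le; first exact: (hwlog n m a b).
  by apply/esym/(hwlog m n b a).
have q0 : q ^+ n != 0 by rewrite expf_neq0 // irredp_neq0.
move: E; rewrite -(subnKC le_nm) exprD -mulrA => /(mulfI q0) Ea.
case: (m - n)%N Ea => [|i Ea]; first by rewrite addn0.
by move: nqa; rewrite Ea exprS -mulrA dvdp_mulr.
Qed.

(** Used on the coordinates of [a + b y]: once the common power of [q] is removed, an element and
    its conjugate can be told apart above [q]. *)
Lemma primitive_pair_exists q a b : irreducible_poly q -> (a != 0) || (b != 0) ->
  exists (i : nat) (a1 b1 : {poly K}),
    [/\ a = q ^+ i * a1, b = q ^+ i * b1 & ~~ ((q %| a1) && (q %| b1))].
Proof.
move=> irr_q; have [->|a0] /= := eqVneq a 0.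
  move=> b0; have [k [b' [Db nqb]]] := irredp_val_exists irr_q b0.
  by exists k, 0, b'; rewrite mulr0 (negPf nqb) andbF.
have [n [a' [Da nqa]]] := irredp_val_exists irr_q a0.
have [->|b0] := eqVneq b 0.
  by exists n, a', 0; rewrite mulr0 (negPf nqa).
have [k [b' [Db nqb]]] := irredp_val_exists irr_q b0.
have [le_nk|lt_kn] := leqP n k.
  exists n, a', (q ^+ (k - n) * b'); split=> //; last by rewrite (negPf nqa).
  by rewrite Db mulrA -exprD subnKC.
exists k, (q ^+ (n - k) * a'), b'; split=> //; last by rewrite (negPf nqb) andbF.
by rewrite Da mulrA -exprD subnKC // ltnW.
Qed.

(** Squares [q ^+ 2] are stripped off one at a time; this preserves the parity of every valuation,
    so the process ends at a constant. *)
Lemma even_vals_square N : N != 0 ->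
  (forall q n b, irreducible_poly q -> N = q ^+ n * b -> ~~ (q %| b) -> ~~ odd n) ->
  exists (c : K) (r : {poly K}), N = c *: r ^+ 2.
Proof.
elim: (size N) {-2}N (leqnn (size N)) => [|m IHm] {}N le_Nm N0 evN.
  by move: le_Nm; rewrite leqn0 size_poly_eq0 (negPf N0).
have [N1|N_le1] := ltnP 1%N (size N); last first.
  by exists N`_0, 1; rewrite expr1n -mul_polyC mulr1 [LHS]size1_polyC.
have [q irr_q qN] := irredp_dvdp_exists N1.
have [n [b [DN nqb]]] := irredp_val_exists irr_q N0.
have q1 := irredp_size irr_q; have q0 := irredp_neq0 irr_q.
case: n DN => [|[|n]] DN.
- by rewrite DN expr0 mul1r (negPf nqb) in qN.
- by have := evN _ _ _ irr_q DN nqb.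
have [M DM] : exists M : {poly K}, N = q ^+ 2 * M.
  by exists (q ^+ n * b); rewrite DN mulrA -exprD.
have M0 : M != 0 by apply: contra_neq N0 => M0; rewrite DM M0 mulr0.
have [|||c [r DMr]] := IHm M.
- move: le_Nm; rewrite DM expr2 !size_mulp ?mulf_neq0 //.
  have := q1; lia.
- exact: M0.
- move=> l i e irr_l DMl nle.
  have [j [f [Dq nlf]]] := irredp_val_exists irr_l q0.
  suff : ~~ odd (j.*2 + i) by rewrite oddD odd_double.
  apply: (evN l _ (f ^+ 2 * e) irr_l).
    by rewrite DM DMl Dq exprMn exprD -muln2 exprM mulrACA.
  by rewrite irredp_dvdp_mul // negb_or nle andbT; apply: contra nlf;
    exact: irredp_dvdp_exp.
by exists c, (q * r); rewrite DM DMr exprMn -scalerAr.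
Qed.

(** The degree, one less than [size N], is odd and is the sum over the irreducible factors of
    multiplicity times degree, so in some term both are odd. *)
Lemma odd_degree_factor N : N != 0 -> ~~ odd (size N) ->
  exists (q : {poly K}) (n : nat) (b : {poly K}), [/\ irreducible_poly q,
    ~~ odd (size q), N = q ^+ n * b,
    ~~ (q %| b) & odd n].
Proof.
elim: (size N) {-2}N (leqnn (size N)) => [|m IHm] {}N le_Nm N0 evN.
  by move: le_Nm; rewrite leqn0 size_poly_eq0 (negPf N0).
have [N1|N_le1] := ltnP 1%N (size N); last first.
  by move: N_le1 N0 evN; rewrite -size_poly_gt0; case: (size N) => [|[]].
have [q irr_q qN] := irredp_dvdp_exists N1.
have [n [b [DN nqb]]] := irredp_val_exists irr_q N0.
have q1 := irredp_size irr_q; have q0 := irredp_neq0 irr_q.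
have n_gt0 : (0 < n)%N.
  by case: n DN => // DN; rewrite DN expr0 mul1r (negPf nqb) in qN.
have [/andP[eq_ on]|ne] := boolP (~~ odd (size q) && odd n).
  by exists q, n, b.
have b0 : b != 0 by apply: contraNneq nqb => ->; rewrite dvdp0.
have sN : size N = ((size q).-1 * n + size b)%N.
  have qn0 : q ^+ n != 0 by rewrite expf_neq0.
  rewrite DN size_mulp // -{1}[size (q ^+ n)]prednK ?size_poly_gt0 //.
  by rewrite size_exp addSn.
have [| | |l [i [c [irr_l el Db nlc oi]]]] := IHm b.
- move: le_Nm; rewrite sN; have : (0 < (size q).-1 * n)%N.
    by rewrite muln_gt0 n_gt0 andbT -subn1 subn_gt0.
  lia.
- exact: b0.
- have oq : odd (size q) = ~~ odd (size q).-1 by rewrite -oddS prednK // (ltnW q1).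
  move: ne evN; rewrite sN oddD oddM oq.
  by case: (odd (size q).-1); case: (odd n); case: (odd (size b)).
have nlq : ~~ (l %| q).
  apply: contra nqb => lq; have lql := irr_q l.
  have /lql /(_ lq)/eqp_dvdl<- : size l != 1%N by case: irr_l => /gtn_eqF->.
  case: i Db oi => // i -> _.
  by rewrite exprS -mulrA dvdp_mulr.
exists l, i, (q ^+ n * c); split=> //; first by rewrite DN Db mulrCA.
rewrite irredp_dvdp_mul // negb_or nlc andbT; apply: contra nlq.
exact: irredp_dvdp_exp.
Qed.

Lemma size_sqr_leq a n : (size a <= n)%N -> (size (a ^+ 2) <= (n + n).-1)%N.
Proof.
move=> an; rewrite expr2; apply: leq_trans (size_polyMleq _ _) _.
by rewrite -!subn1 leq_sub2r // leq_add.
Qed.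

(** Leading coefficients decide: if [b] were nonzero, [c] would be the square of their quotient. *)
Lemma sum_squares_anisotropic (c : K) a b : (forall e, c != e ^+ 2) ->
  a ^+ 2 = c *: b ^+ 2 -> a = 0 /\ b = 0.
Proof.
move=> nsq E; have [b0|b0] := eqVneq b 0.
  by move: E; rewrite b0 expr0n scaler0 => /eqP; rewrite expf_eq0 => /eqP.
have := congr1 lead_coef E; rewrite lead_coefZ !lead_coef_exp => /eqP.
have l0 : lead_coef b != 0 by rewrite lead_coef_eq0.
rewrite -(inj_eq (mulIf (invr_neq0 (expf_neq0 2 l0)))) mulfK ?expf_neq0 //.
by rewrite -expr_div_n eq_sym (negPf (nsq _)).
Qed.

(* Cassels-Pfister descent for the binary form [X^2 - c Y^2]: the second
   intersection with the quadric of the line joining [(a, b) / r] to its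
   polynomial part [(a0, b0)] has a denominator of smaller degree. *)
Lemma cassels_pfister (c : K) f a b r : (forall e, c != e ^+ 2) -> r != 0 ->
  r ^+ 2 * f = a ^+ 2 - c *: b ^+ 2 -> exists A B : {poly K}, f = A ^+ 2 - c *: B ^+ 2.
Proof.
move=> nsq; elim: (size r) {-2}r (leqnn (size r)) a b => [|m IHm] {}r le_rm a b r0 E.
  by move: le_rm; rewrite leqn0 size_poly_eq0 (negPf r0).
set a0 := a %/ r; set b0 := b %/ r; set a1 := a %% r; set b1 := b %% r.
have Da : a = a0 * r + a1 by exact: divp_eq.
have Db : b = b0 * r + b1 by exact: divp_eq.
rewrite -!mul_polyC in E *.
set k := c%:P in E *.
pose n := a0 ^+ 2 - k * b0 ^+ 2.
pose r1 := r * (f - n) - 2 * (a1 * a0 - k * (b1 * b0)).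
(* [r1] is the new denominator. The form at the remainders [(a1, b1)] has degree at most
   [2 (deg r - 1)], so [deg r1 < deg r]; by anisotropy it vanishes only when both remainders do. *)
have Er1 : r * r1 = a1 ^+ 2 - k * b1 ^+ 2.
  by move: E; rewrite Da Db /r1 /n => E; ring: E.
have [r10|r10] := eqVneq r1 0.
  have [a10 b10] : a1 = 0 /\ b1 = 0.
    apply: (sum_squares_anisotropic nsq); rewrite -mul_polyC.
    by apply/eqP; rewrite -subr_eq0 -Er1 r10 mulr0.
  exists a0, b0; rewrite -!mul_polyC; apply: (mulfI (expf_neq0 2 r0)).
  by rewrite E Da Db a10 b10 -/k; ring.
apply: (IHm r1 _ (a1 * (f - n) - r1 * a0) (b1 * (f - n) - r1 * b0) r10); last first.
  rewrite -!mul_polyC -/k.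
  have ET : 2 * (a1 * a0 - k * (b1 * b0)) = r * (f - n) - r1 by rewrite /r1; ring.
  transitivity ((a1 ^+ 2 - k * b1 ^+ 2) * (f - n) ^+ 2
    - r1 * (f - n) * (2 * (a1 * a0 - k * (b1 * b0))) + r1 ^+ 2 * n).
    by rewrite -Er1 ET; ring.
  by rewrite /n; ring.
have sz_a1 : (size a1 <= (size r).-1)%N by rewrite -ltnS prednK ?size_poly_gt0 ?ltn_modp.
have sz_b1 : (size b1 <= (size r).-1)%N by rewrite -ltnS prednK ?size_poly_gt0 ?ltn_modp.
have : (size (r * r1)%R <= ((size r).-1 + (size r).-1).-1)%N.
  rewrite Er1; apply: leq_trans (size_polyD _ _) _; rewrite size_polyN geq_max.
  rewrite size_sqr_leq //= mul_polyC.
  by apply: leq_trans (size_scale_leq _ _) _; rewrite size_sqr_leq.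
rewrite size_mulp //; move: r0 le_rm; rewrite -size_poly_gt0.
have : (0 < size r1)%N by rewrite size_poly_gt0.
lia.
Qed.

End PolyFactor.

(** * Finite fields *)

Section FiniteFieldOfSeq.
Variables (k : fieldType) (l : seq k).
Hypothesis lP : forall c, c \in l.

Let unpick n := if (n < size l)%N then Some (nth 0 l n) else None.
Let pickK : pcancel (index^~ l) unpick.
Proof. by move=> c; rewrite /unpick index_mem lP nth_index. Qed.

Let enumP : forall c, count_mem c (undup l) = 1%N.
Proof. by move=> c; rewrite count_uniq_mem ?undup_uniq // mem_undup lP. Qed.

Definition seq_finFieldType : finFieldType :=
  let cnt := isCountable.Build k pickK in
  let kc : countType := HB.pack k cnt in
  let fin := isFinite.Build kc enumP in
  HB.pack k cnt fin.

End FiniteFieldOfSeq.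

(** The residue field of the theorem is a bare [fieldType]. An equality of field types, rather than
    an isomorphism, lets results on finite fields be transported to it by elimination. *)
Lemma finFieldType_of_seq (k : fieldType) (l : seq k) : (forall c, c \in l) ->
  exists kf : finFieldType, (kf : fieldType) = k.
Proof.
move=> lP; exists (seq_finFieldType lP).
by case: k l lP => T cl l lP; case: cl l lP.
Qed.

(** Euler's criterion: the unit group is cyclic of order [2 m], and [u = g^j] with [u^m = 1] forces
    [2 m] to divide [j m], so [j] is even. *)
Lemma finField_euler (M : finFieldType) (u : M) (m : nat) : u != 0 ->
  #|M| = (m.*2).+1 -> u ^+ m = 1 -> exists w, u = w ^+ 2.
Proof.
move=> u0 cM um.
have /cyclicP[g Hg] : cyclic [set: {unit M}] by apply: field_unit_group_cyclic.
have og : #[g]%g = m.*2.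
  by rewrite /order -Hg card_finField_unit cM.
have uU : u \is a GRing.unit by rewrite unitfE.
have /cycleP[j Hj] : FinRing.unit M uU \in <[g]>%g by rewrite -Hg inE.
have Du : u = val g ^+ j by rewrite -FinRing.val_unitX -Hj.
have m0 : (0 < m)%N.
  rewrite lt0n; apply: contra_eqN cM => /eqP->.
  by rewrite gtn_eqF // finRing_gt1.
have : (#[g]%g %| j * m)%N.
  by rewrite order_dvdn -val_eqE /= FinRing.val_unitX exprM -Du um.
rewrite og -mul2n dvdn_pmul2r // => /dvdnP[i Di].
by exists (val g ^+ i); rewrite Du Di exprM.
Qed.

Lemma geom_sum_expn (q n : nat) : (0 < q)%N ->
  ((\sum_(i < n) q ^ i) * q.-1).+1 = (q ^ n)%N.
Proof.
case: q => // q _; elim: n => [|n IHn]; first by rewrite big_ord0.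
by rewrite big_ord_recr mulnDl -addSn IHn expnS mulSn [in RHS]mulnC.
Qed.

Lemma odd_geom_sum (q n : nat) : odd q -> odd (\sum_(i < n) q ^ i) = odd n.
Proof.
move=> oq; elim: n => [|n IHn]; first by rewrite big_ord0.
by rewrite big_ord_recr oddD IHn oddX oq orbT addbT.
Qed.

Lemma irredp_root_dvd (k : fieldType) (L : fieldExtType k) (q a : {poly k}) (z : L) :
  irreducible_poly q -> root (map_poly (in_alg L) q) z ->
  root (map_poly (in_alg L) a) z -> q %| a.
Proof.
move=> irr_q qz az; apply: contraT; rewrite -irreducible_poly_coprime //.
move=> /Bezout_eq1_coprimepP[[u w] /= E].
have /(congr1 (fun b => (map_poly (in_alg L) b).[z])) := E.
rewrite rmorphD !rmorphM rmorph1 /= hornerD !hornerM hornerC.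
by rewrite (rootP qz) (rootP az) !mulr0 addr0 => /esym/eqP; rewrite oner_eq0.
Qed.

Lemma card_finvect (k : finFieldType) (vT : vectType k) :
  #|{: finvect_type vT}| = (#|k| ^ dim vT)%N.
Proof.
have bij : bijective (@VectorInternalTheory.v2r k vT : finvect_type vT -> _).
  exists (@VectorInternalTheory.r2v k vT); first exact: VectorInternalTheory.v2rK.
  exact: VectorInternalTheory.r2vK.
by rewrite (bij_eq_card bij) card_mx mul1n.
Qed.

Section FiniteNorm.
Variable k : finFieldType.
Hypothesis k2 : 2 != 0 :> k.

(** Raising to the power [#|k|] fixes [-1]; an even exponent would give [-1 = 1]. *)
Lemma odd_card_finField : odd #|k|.
Proof.
apply: contraT => ev; have := expf_card (-1 : k); rewrite -signr_odd (negPf ev) expr0.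
by move/eqP; rewrite -addr_eq0 (negPf k2).
Qed.

Let q_gt0 : (0 < #|k|)%N. Proof. by rewrite ltnW // finRing_gt1. Qed.

Section Extension.
Variables (L : splittingFieldType k) (E : {subfield L}).

(** The Galois group is generated by the Frobenius map, so the conjugates of [u] are its powers with
    exponents [#|k| ^ i]. *)
Lemma galNorm_finField (u : L) : u \in E ->
  galNorm 1%VS E u = u ^+ (\sum_(i < \dim E) #|k| ^ i).
Proof.
move=> Eu; have s1E : (1 <= E)%VS by exact: sub1v.
have [x /eqP DgalE Dx] := finField_galois_generator s1E.
rewrite dimv1 expn1 in Dx.
have dimE : \dim E = #[x]%g.
  by rewrite /order -DgalE -(galois_dim (finField_galois s1E)) dimv1 divn1.
have xX i : (x ^+ i)%g u = u ^+ (#|k| ^ i).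
  elim: i => [|i IHi]; first by rewrite expg0 gal_id expn0 expr1.
  by rewrite expgSr galM // Dx ?memv_gal // IHi expnSr exprM.
(* The index type ['Z_n] has two elements when [n = 1], so the trivial group is treated apart. *)
rewrite dimE -prodrXr; have [x1|ntx] := eqVneq x 1%g.
  by rewrite /galNorm DgalE x1 cycle1 big_set1 gal_id order1 big_ord1 expn0 expr1.
rewrite /galNorm DgalE -im_Zpm morphimEdom big_imset /=; last exact/injmP/injm_Zpm.
have gt1 : (1 < #[x]%g)%N by rewrite order_gt1.
transitivity (\prod_(i < (Zp_trunc #[x]%g).+2) (x ^+ i)%g u).
  by apply: eq_bigl => j /=; rewrite mem_Zp.
rewrite Zp_cast //.
by apply: eq_bigr => i _; rewrite xX.
Qed.

(** With [q = #|k|] and the norm equal to [u^S], the exponent in Euler's criterion for [E] is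
    [S (q - 1) / 2]; hence the criterion for [u] in [E] is the criterion for its norm in [k]. *)
Lemma galNorm_square (u : L) : u \in E -> u != 0 ->
  (exists2 c : k, c != 0 & galNorm 1%VS E u = (c ^+ 2)%:A) <->
  (exists2 w, w \in E & u = w ^+ 2).
Proof.
move=> Eu u0; have s1E : (1 <= E)%VS by exact: sub1v.
split=> [[c c0 Nu]|[w Ew Du]]; last first.
  have /vlineP[c Dc] := mem_galNorm (finField_galois s1E) Ew.
  exists c; last by rewrite Du galNormX Dc exprZn expr1n.
  apply: contra_neq u0 => c0; apply/eqP; rewrite Du expf_eq0 /=.
  by rewrite -(galNorm_eq0 1%VS E) Dc c0 scale0r.
have Dq : #|k| = (#|k|./2.*2).+1 by rewrite -[LHS]odd_double_half odd_card_finField.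
pose S := (\sum_(i < \dim E) #|k| ^ i)%N.
pose M : finFieldType := finvect_type (subvs_of E).
have cM : #|M| = ((S * #|k|./2).*2).+1.
  have -> : #|M| = (#|k| ^ \dim E)%N.
    exact: (card_finvect (subvs_of E)).
  rewrite -geom_sum_expn // -/S -muln2 -mulnA muln2.
  by rewrite [in LHS]Dq.
pose U : M := vsproj E u.
have U0 : U != 0.
  apply: contra_neq u0 => U0; have := vsprojK Eu; rewrite -/U.
  by move: U0; rewrite /U => ->; rewrite linear0.
have UX (j : nat) : vsval (U ^+ j : subvs_of E) = u ^+ j.
  by rewrite rmorphXn /= vsprojK.
have [|w Dw] := @finField_euler M U (S * #|k|./2) U0 cM.
  apply: (subvs_inj (U := E)); rewrite UX exprM -galNorm_finField // Nu.
  rewrite exprZn expr1n -exprM mul2n rmorph1 (_ : c ^+ _ = 1) ?scale1r //.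
  by apply: (mulfI c0); rewrite -exprS -Dq expf_card mulr1.
exists (vsval (w : subvs_of E)); first exact: subvsP.
by rewrite -(vsprojK Eu) -/U Dw rmorphXn.
Qed.

End Extension.

(* In [k[x]/(q)], with [N a] in [k] the norm of [a], the product [a * N a] is an
   even power of [a] since the degree of [q] is odd. *)
Lemma irredp_odd_sqrt_mod (q a : {poly k}) : irreducible_poly q -> ~~ odd (size q) ->
  ~~ (q %| a) -> exists (eta : k) (b : {poly k}), eta != 0 /\ q %| b ^+ 2 - eta *: a.
Proof.
move=> irr_q eq_ nqa; have [L dimL [z qz _]] := irredp_FAdjoin irr_q.
pose D := (size q).-1; pose S := (\sum_(i < D) #|k| ^ i)%N.
have oS : odd S.
  rewrite odd_geom_sum ?odd_card_finField // /D.
  by move: eq_; case: (size q) (irredp_size irr_q) => //= n _; rewrite negbK.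
set u := (map_poly (in_alg L) a).[z].
have u0 : u != 0.
  by apply: contra nqa => /eqP u0; apply: (irredp_root_dvd irr_q qz); apply/rootP.
have uQ : u ^+ (#|k| ^ D) = u.
  have := Fermat's_little_theorem {:L}%AS u; rewrite memvf dimL -/D => /esym/eqP.
  by [].
(* [u ^+ S] is the norm of [u]. It is fixed by Frobenius because [S q + 1 = S + q^D] and [u] is
   fixed by the power [q^D]. *)
have : u ^+ S \in 1%VS.
  rewrite Fermat's_little_theorem dimv1 expn1 -exprM.
  apply/eqP/(mulIf u0); rewrite -exprSr.
  have -> : (S * #|k|).+1 = (S + #|k| ^ D)%N.
    by rewrite -geom_sum_expn // -/S addnS -mulnS prednK.
  by rewrite exprD uQ.
move=> /vlineP[eta Deta].
exists eta, (a ^+ (S.+1)./2); split.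
  apply: contra_neq u0 => e0; apply/eqP; move/eqP: Deta.
  by rewrite e0 scale0r expf_eq0 => /andP[].
apply: (irredp_root_dvd irr_q qz); apply/rootP.
rewrite -exprM muln2 even_halfK /= ?oS // -mul_polyC rmorphB rmorphM rmorphXn /=.
rewrite map_polyC /= hornerD hornerN hornerM hornerC horner_exp -/u exprSr Deta.
by rewrite subrr.
Qed.

End FiniteNorm.

Section FiniteAsSeq.
Variables (k : fieldType) (l : seq k).
Hypotheses (lP : forall c, c \in l) (k2 : 2 != 0 :> k).

Lemma galNorm_square_seq (L : splittingFieldType k) (E : {subfield L}) (u : L) :
  u \in E -> u != 0 ->
  (exists2 c : k, c != 0 & galNorm 1%VS E u = (c ^+ 2)%:A) <->
  (exists2 w, w \in E & u = w ^+ 2).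
Proof.
have [kf Dk] := finFieldType_of_seq lP.
by case: k / Dk k2 L E u => k2' L E u; exact: galNorm_square.
Qed.

Lemma irredp_odd_sqrt_mod_seq (q a : {poly k}) : irreducible_poly q -> ~~ odd (size q) ->
  ~~ (q %| a) -> exists (eta : k) (b : {poly k}), eta != 0 /\ q %| b ^+ 2 - eta *: a.
Proof.
have [kf Dk] := finFieldType_of_seq lP.
by case: k / Dk k2 q a => k2' q a; exact: irredp_odd_sqrt_mod.
Qed.

End FiniteAsSeq.

(** * Discrete valuations *)

Section Valuation.
Variables (F : fieldType) (v : dvaluation F).
Implicit Types (a b : F) (n m : int).

Lemma vge0 n : vge v n 0. Proof. by rewrite /vge eqxx. Qed.

Lemma vgeE n a : a != 0 -> vge v n a = (n <= v a).
Proof. by rewrite /vge => /negPf->. Qed.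

Lemma vge_neg n a : ~~ vge v n a -> a != 0 /\ v a < n.
Proof. by rewrite /vge negb_or -ltNge => /andP[]. Qed.

Lemma vgeN n a : vge v n (- a) = vge v n a.
Proof. by rewrite /vge oppr_eq0 dvN. Qed.

Lemma vge_le n m a : n <= m -> vge v m a -> vge v n a.
Proof.
by move=> nm; rewrite /vge; case: eqP => //= _; apply: le_trans.
Qed.

Lemma vgeD n a b : vge v n a -> vge v n b -> vge v n (a + b).
Proof.
have [->|a0] := eqVneq a 0; first by rewrite add0r.
have [->|b0] := eqVneq b 0; first by rewrite addr0.
have [->|ab0] := eqVneq (a + b) 0; first by rewrite vge0.
rewrite !vgeE // => va vb; apply: le_trans (dvD v a0 b0 ab0).
by rewrite le_min va.
Qed.

Lemma vgeB n a b : vge v n a -> vge v n b -> vge v n (a - b).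
Proof. by move=> va vb; rewrite vgeD ?vgeN. Qed.

Lemma vge_addr n a b : vge v n b -> vge v n (a + b) = vge v n a.
Proof.
move=> vb; apply/idP/idP => [vab|va]; last exact: vgeD.
by rewrite -(addrK b a) vgeB.
Qed.

Lemma vgeM n m a b : vge v n a -> vge v m b -> vge v (n + m) (a * b).
Proof.
have [->|a0] := eqVneq a 0; first by rewrite mul0r !vge0.
have [->|b0] := eqVneq b 0; first by rewrite mulr0 !vge0.
by rewrite !vgeE ?mulf_neq0 // dvM // => va vb; apply: lerD.
Qed.

Lemma vge_sum n (I : Type) (r : seq I) (P : pred I) (G : I -> F) :
  (forall i, P i -> vge v n (G i)) -> vge v n (\sum_(i <- r | P i) G i).
Proof.
move=> vG; elim/big_ind: _ => //; [exact: vge0 | exact: vgeD].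
Qed.

Lemma vge1 : vge v 0 1. Proof. by rewrite vgeE ?oner_neq0 // dv1. Qed.

Lemma dvV a : v a^-1 = - v a.
Proof.
have [->|a0] := eqVneq a 0; first by rewrite invr0 dv0 oppr0.
have : v (a * a^-1) = 0 by rewrite divff // dv1.
by rewrite dvM ?invr_neq0 // => /eqP; rewrite addr_eq0 => /eqP->; rewrite opprK.
Qed.

Lemma dvX a (k : nat) : v (a ^+ k) = v a *+ k.
Proof.
have [->|a0] := eqVneq a 0.
  by case: k => [|k]; rewrite ?expr0 ?dv1 ?mulr0n // expr0n dv0 mul0rn.
elim: k => [|k IHk]; first by rewrite expr0 dv1 mulr0n.
by rewrite exprS dvM ?expf_neq0 // IHk mulrS.
Qed.

Lemma dv_div a b : a != 0 -> b != 0 -> v (a / b) = v a - v b.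
Proof. by move=> a0 b0; rewrite dvM ?invr_neq0 // dvV. Qed.

Lemma vge_dvM n a b : b != 0 -> vge v (n + v b) (a * b) = vge v n a.
Proof.
move=> b0; have [->|a0] := eqVneq a 0; first by rewrite mul0r !vge0.
by rewrite !vgeE ?mulf_neq0 // dvM // lerD2r.
Qed.

Lemma vunitE a : vge v 0 a -> ~~ vge v 1 a -> a != 0 /\ v a = 0.
Proof.
move=> va /vge_neg[a0 lt]; split=> //; move: va; rewrite vgeE // => va.
by apply/eqP; rewrite eq_le va andbT -ltzD1 add0r.
Qed.

Lemma vge1_mul a b : vge v 0 a -> vge v 0 b ->
  vge v 1 (a * b) -> vge v 1 a \/ vge v 1 b.
Proof.
move=> va vb vab; have [|na] := boolP (vge v 1 a); first by left.
have [|nb] := boolP (vge v 1 b); first by right.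
have [a0 {}va] := vunitE va na; have [b0 {}vb] := vunitE vb nb.
by move: vab; rewrite vgeE ?mulf_neq0 // dvM // va vb.
Qed.

Lemma vgeMl n a b : vge v 0 a -> vge v n b -> vge v n (a * b).
Proof. by move=> va vb; rewrite -[n]add0r vgeM. Qed.

Lemma not_vge1_1 : ~~ vge v 1 1.
Proof. by rewrite vgeE ?oner_neq0 // dv1. Qed.

Lemma vge_half a : vge v 0 (a ^+ 2) -> vge v 0 a.
Proof.
have [->|a0] := eqVneq a 0; first by rewrite vge0.
by rewrite !vgeE ?expf_neq0 // dvX pmulrn_lge0.
Qed.

Lemma dv_exists (n : int) : exists2 a, a != 0 & v a = n.
Proof.
have [t t0 vt] := dv_unif v.
case: n => n.
  by exists (t ^+ n); [rewrite expf_neq0 | rewrite dvX vt natz].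
exists (t ^- n.+1); first by rewrite invr_neq0 ?expf_neq0.
by rewrite dvV dvX vt natz NegzE.
Qed.

End Valuation.

Lemma closed_point_eq (K F : fieldType) (iota : {rmorphism K -> F})
  (P Q : closed_point iota) : (forall z, P z = Q z) -> P = Q.
Proof.
case: P Q => [[v v0 vM vD vu] vt] [[w w0 wM wD wu] wt] /= vw.
have {}vw : v = w by apply/funext.
subst w; have E0 : v0 = w0 by exact: Prop_irrelevance.
have EM : vM = wM by exact: Prop_irrelevance.
have ED : vD = wD by exact: Prop_irrelevance.
have Eu : vu = wu by exact: Prop_irrelevance.
subst; congr ClosedPoint; exact: Prop_irrelevance.
Qed.

Lemma finite_set_subsingleton (T : Type) (S : set T) :
  (forall a b, S a -> S b -> a = b) -> finite_set S.
Proof.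
move=> S1; have [[a Sa]|nS] := pselect (exists a, S a).
  apply: (@sub_finite_set _ _ [set a]%classic) (finite_set1 a).
  by move=> b Sb /=; apply: S1.
suff -> : S = set0 by exact: finite_set0.
by apply/seteqP; split=> // a Sa; case: nS; exists a.
Qed.

(** * Closed points of a hyperelliptic curve *)

Section CoordinateRing.
Variables (K F : fieldType) (iota : {rmorphism K -> F}) (f : {poly K}) (x y : F).
Hypothesis hF : hyperelliptic_function_field iota f x y.
Hypothesis two_neq0 : 2 != 0 :> K.
Implicit Types (a b q r : {poly K}) (z : F).

Definition xeval a : F := (map_poly iota a).[x].
Notation ev := xeval.
Notation cv := (coord_val iota x y).
Definition in_coord z := exists a b, z = cv a b.

Notation inA := in_coord.

Lemma evD a b : ev (a + b) = ev a + ev b.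
Proof. by rewrite /xeval rmorphD hornerD. Qed.
Lemma evN a : ev (- a) = - ev a.
Proof. by rewrite /xeval rmorphN hornerN. Qed.
Lemma evB a b : ev (a - b) = ev a - ev b.
Proof. by rewrite evD evN. Qed.
Lemma evM a b : ev (a * b) = ev a * ev b.
Proof. by rewrite /xeval rmorphM hornerM. Qed.
Lemma evC c : ev c%:P = iota c.
Proof. by rewrite /xeval map_polyC hornerC. Qed.
Lemma ev0 : ev 0 = 0.
Proof. by rewrite /xeval rmorph0 horner0. Qed.
Lemma ev1 : ev 1 = 1.
Proof. by rewrite evC rmorph1. Qed.
Lemma evXn a n : ev (a ^+ n) = ev a ^+ n.
Proof. by rewrite /xeval rmorphXn horner_exp. Qed.
Lemma evX : ev 'X = x.
Proof. by rewrite /xeval map_polyX hornerX. Qed.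

Lemma cvE a b : cv a b = ev a + ev b * y. Proof. by []. Qed.

Lemma ysqr : y ^+ 2 = ev f. Proof. by case: hF. Qed.

Lemma cv_eq0 a b : cv a b = 0 -> a = 0 /\ b = 0. Proof. by case: hF => _ + _; apply. Qed.

Lemma ev_eq0 a : (ev a == 0) = (a == 0).
Proof.
apply/eqP/eqP => [a0|->]; last exact: ev0.
by have [] := @cv_eq0 a 0; rewrite ?cvE ?ev0 ?mul0r ?addr0.
Qed.

Lemma cvM a b a' b' : cv a b * cv a' b' = cv (a * a' + b * b' * f) (a * b' + a' * b).
Proof. by rewrite !cvE !evD !evM -ysqr; ring. Qed.

Lemma cv_norm a b : cv a b * cv a (- b) = ev (a ^+ 2 - b ^+ 2 * f).
Proof. by rewrite !cvE evB evN evXn evM evXn -ysqr; ring. Qed.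

Lemma norm_neq0 a b : cv a b != 0 -> a ^+ 2 - b ^+ 2 * f != 0.
Proof.
move=> ab0; rewrite -ev_eq0 -cv_norm mulf_neq0 //.
apply: contraNneq ab0 => /cv_eq0[-> /eqP]; rewrite oppr_eq0 => /eqP->.
by rewrite cvE ev0 mul0r addr0.
Qed.

Lemma inA_cv a b : inA (cv a b). Proof. by exists a, b. Qed.
Lemma inA_ev a : inA (ev a).
Proof. by exists a, 0; rewrite cvE ev0 mul0r addr0. Qed.
Lemma inA1 : inA 1. Proof. by rewrite -ev1; apply: inA_ev. Qed.
Lemma inA_y : inA y.
Proof. by exists 0, 1; rewrite cvE ev0 add0r ev1 mul1r. Qed.
Lemma inA_D z w : inA z -> inA w -> inA (z + w).
Proof.
by move=> [a [b ->]] [a' [b' ->]]; exists (a + a'), (b + b'); rewrite !cvE !evD; ring.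
Qed.
Lemma inA_M z w : inA z -> inA w -> inA (z * w).
Proof. by move=> [a [b ->]] [a' [b' ->]]; rewrite cvM; exact: inA_cv. Qed.
Lemma inA_X z n : inA z -> inA (z ^+ n).
Proof.
by move=> Az; elim: n => [|n IHn]; rewrite ?expr0 ?exprS; [exact: inA1 | exact: inA_M].
Qed.
Lemma inA_N z : inA z -> inA (- z).
Proof. by move=> Az; rewrite -mulN1r -ev1 -evN; apply: inA_M => //; exact: inA_ev. Qed.
Lemma inA_frac z : exists u w, [/\ inA u, inA w, w != 0 & z = u / w].
Proof.
case: hF => _ _ /(_ z) [a [b [a' [b' [n0 ->]]]]].
by exists (cv a b), (cv a' b'); split=> //; exact: inA_cv.
Qed.

(* The trace on [F] of a maximal ideal of [K[x, y]] lying above [(q)]. *)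
Record prime_above q (m : F -> Prop) : Prop := PrimeOver {
  primeD : forall z w, m z -> m w -> m (z + w);
  primeM : forall z w, inA z -> m w -> m (z * w);
  primeP : forall z w, inA z -> inA w -> m (z * w) -> m z \/ m w;
  prime1 : ~ m 1;
  prime_ev : m (ev q)
}.

Notation prime_over := prime_above.

Section Local.
Variables (q : {poly K}) (m : F -> Prop).
Hypotheses (irr_q : irreducible_poly q) (hm : prime_over q m).

Lemma prime_dvd a : q %| a -> m (ev a).
Proof.
by move=> /dvdp_mulE[b ->]; rewrite evM; apply: (primeM hm);
  [exact: inA_ev | exact: prime_ev].
Qed.

Lemma prime_evE a : m (ev a) <-> q %| a.
Proof.
split=> [ma|]; last exact: prime_dvd.
apply: contrapT => /negP; rewrite -irreducible_poly_coprime // => /Bezout_eq1_coprimepP.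
move=> [[u w] /= E]; apply: (prime1 hm); rewrite -ev1 -E evD !evM.
by apply: (primeD hm); apply: (primeM hm) => //;
  [exact: inA_ev | exact: prime_ev | exact: inA_ev].
Qed.

Lemma primeN z : m z -> m (- z).
Proof.
move=> mz; rewrite -mulN1r -ev1 -evN; apply: (primeM hm) => //; exact: inA_ev.
Qed.

Lemma prime0 : m 0.
Proof. by have := primeM hm (inA_ev 0) (prime_ev hm); rewrite ev0 mul0r. Qed.

Lemma prime_X z n : inA z -> m (z ^+ n) -> m z.
Proof.
move=> Az; elim: n => [|n IHn]; first by rewrite expr0 => /(prime1 hm).
by rewrite exprS => /(primeP hm Az (inA_X _ Az))[].
Qed.

Lemma prime_y : m y <-> q %| f.
Proof.
rewrite -prime_evE -ysqr; split=> [my|]; last exact: (prime_X inA_y).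
by rewrite expr2; apply: (primeM hm) => //; exact: inA_y.
Qed.

Hypothesis q2f : ~~ (q ^+ 2 %| f).
(** Above a factor [q] of [f] the double cover ramifies, and the square of [y] is [q] times a unit
    since [q ^+ 2] does not divide [f]; above any other [q] there is no ramification. *)
Definition uniformizer : F := if q %| f then y else ev q.
Notation unif := uniformizer.

Lemma inA_unif : inA unif.
Proof. by rewrite /uniformizer; case: ifP => _; [exact: inA_y | exact: inA_ev]. Qed.

Lemma prime_unif : m unif.
Proof.
rewrite /uniformizer; case: ifP => qf; first exact/prime_y.
exact: prime_ev.
Qed.

Lemma squarefree_neq0 : f != 0.
Proof. by apply: contraNneq q2f => ->; rewrite dvdp0. Qed.

Lemma y_neq0 : y != 0.
Proof.
by apply: contra_neq squarefree_neq0 => y0; apply/eqP; rewrite -ev_eq0 -ysqr y0 expr0n.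
Qed.

Lemma unif_neq0 : unif != 0.
Proof.
rewrite /uniformizer; case: ifP => _; first exact: y_neq0.
by rewrite ev_eq0 irredp_neq0.
Qed.

Lemma not_prime_mul z w : inA z -> inA w -> ~ m z -> ~ m w -> ~ m (z * w).
Proof. by move=> Az Aw nz nw /(primeP hm Az Aw)[]. Qed.

(* At a ramified prime write [q f1 = y^2]; otherwise pull out the powers of [q]
   and note that a primitive element and its conjugate are not both in [m]. *)
Lemma prime_factor z : inA z -> z != 0 ->
  exists n s w, [/\ inA s /\ ~ m s, inA w /\ ~ m w & s * z = unif ^+ n * w].
Proof.
move=> [a [b ->]] ab0.
have np1 : ~ m 1 by exact: (prime1 hm).
have [/eqP a0|a0] := boolP (a == 0).
  have b0 : b != 0 by apply: contra_neq ab0 => b0; rewrite a0 b0 cvE ev0 mul0r addr0.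
  have [n [b' [Db nqb]]] := irredp_val_exists irr_q b0.
  have nb : ~ m (ev b') by move=> /prime_evE; apply/negP.
  rewrite a0 cvE ev0 add0r Db evM evXn.
  rewrite /uniformizer; case: ifP => qf; last first.
    exists n, 1, (ev b' * y); rewrite mul1r mulrA; split=> //; first by split;
      first exact: inA1.
    split; first by apply: inA_M; [exact: inA_ev | exact: inA_y].
    apply: not_prime_mul => //; [exact: inA_ev | exact: inA_y |].
    by move=> /prime_y; rewrite qf.
  have [f1 Df] := dvdp_mulE qf.
  have nf1 : ~ m (ev f1).
    move=> /prime_evE qf1; move: q2f; rewrite Df expr2 dvdp_mul2r ?qf1 //.
    exact: irredp_neq0.
  exists n.*2.+1, (ev f1 ^+ n), (ev b'); split.
  - by split; [apply: inA_X; exact: inA_ev | move=> /(prime_X (inA_ev _))].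
  - by split; first exact: inA_ev.
  rewrite exprS -muln2 mulnC exprM ysqr Df evM exprMn; ring.
have [n [a' [Da nqa]]] := irredp_val_exists irr_q a0.
have na : ~ m (ev a') by move=> /prime_evE; apply/negP.
have [qf|nqf] := boolP (q %| f).
  have Du : unif = y by rewrite /uniformizer qf.
  have [f1 Df] := dvdp_mulE qf.
  have nf1 : ~ m (ev f1).
    move=> /prime_evE qf1; move: q2f; rewrite Df expr2 dvdp_mul2r ?qf1 //.
    exact: irredp_neq0.
  have my : m y by apply/prime_y.
  have Ey k : y ^+ k.*2 = ev f1 ^+ k * ev q ^+ k.
    by rewrite -muln2 mulnC exprM ysqr Df evM exprMn.
  have nf1X k : ~ m (ev f1 ^+ k) by move=> /(prime_X (inA_ev _)).
  have Af1X k : inA (ev f1 ^+ k) by apply: inA_X; exact: inA_ev.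
  have [/eqP b0|b0] := boolP (b == 0).
    exists n.*2, (ev f1 ^+ n), (ev a'); split=> //; first by split; first exact: inA_ev.
    by rewrite Du Ey b0 Da cvE ev0 mul0r addr0 evM evXn mulrA.
  have [k [b' [Db nqb]]] := irredp_val_exists irr_q b0.
  have nb : ~ m (ev b') by move=> /prime_evE; apply/negP.
  (* The two terms have orders [2 n] and [2 k + 1], of different parity, so they cannot cancel and
     the smaller order decides. *)
  have E : ev f1 ^+ (n + k) * cv a b
           = y ^+ n.*2 * (ev f1 ^+ k * ev a') + y ^+ k.*2.+1 * (ev f1 ^+ n * ev b').
    by rewrite exprSr !Ey cvE Da Db !evM !evXn exprD; ring.
  have [le_nk|lt_kn] := leqP n k.
    exists n.*2, (ev f1 ^+ (n + k)),
      (ev f1 ^+ k * ev a' + y ^+ (k - n).*2 * y * (ev f1 ^+ n * ev b')).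
    split=> //; last first.
      rewrite E Du.
      have -> : y ^+ k.*2.+1 = y ^+ n.*2 * (y ^+ (k - n).*2 * y).
        by rewrite -exprSr -exprD; congr (y ^+ _); lia.
      by rewrite mulrDr !mulrA.
    have Aw1 : inA (ev f1 ^+ k * ev a') by apply: inA_M => //; exact: inA_ev.
    have Aw2 : inA (y ^+ (k - n).*2 * y * (ev f1 ^+ n * ev b')).
      apply: inA_M; first by apply: inA_M; [apply: inA_X|]; exact: inA_y.
      by apply: inA_M => //; exact: inA_ev.
    split; first exact: inA_D.
    move=> mw; apply: (@not_prime_mul (ev f1 ^+ k) (ev a')) => //; first exact: inA_ev.
    rewrite -[X in m X](addrK (y ^+ (k - n).*2 * y * (ev f1 ^+ n * ev b'))).
    apply: (primeD hm) => //; apply: primeN; rewrite mulrC.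
    apply: (primeM hm); first by apply: inA_M => //; exact: inA_ev.
    by apply: (primeM hm) => //; apply: inA_X; exact: inA_y.
  exists k.*2.+1, (ev f1 ^+ (n + k)),
    (ev f1 ^+ n * ev b' + y ^+ (n - k).*2.-1 * (ev f1 ^+ k * ev a')).
  split=> //; last first.
    have Ek : y ^+ n.*2 = y ^+ k.*2.+1 * y ^+ (n - k).*2.-1.
      by rewrite -exprD; congr (y ^+ _); lia.
    by rewrite E Du Ek mulrDr addrC !mulrA.
  have Aw1 : inA (ev f1 ^+ n * ev b') by apply: inA_M => //; exact: inA_ev.
  have Aw2 : inA (y ^+ (n - k).*2.-1 * (ev f1 ^+ k * ev a')).
    apply: inA_M; first by apply: inA_X; exact: inA_y.
    by apply: inA_M => //; exact: inA_ev.
  split; first exact: inA_D.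
  move=> mw; apply: (@not_prime_mul (ev f1 ^+ n) (ev b')) => //; first exact: inA_ev.
  rewrite -[X in m X](addrK (y ^+ (n - k).*2.-1 * (ev f1 ^+ k * ev a'))).
  apply: (primeD hm) => //; apply: primeN; rewrite mulrC.
  apply: (primeM hm); first by apply: inA_M => //; exact: inA_ev.
  have -> : (n - k).*2.-1 = (n - k).-1.*2.+1 by lia.
  by rewrite exprSr; apply: (primeM hm) => //; apply: inA_X; exact: inA_y.
have Du : unif = ev q by rewrite /uniformizer (negPf nqf).
have [|i [a1 [b1 [Da1 Db1 nq]]]] := @primitive_pair_exists _ q a b irr_q;
  first by rewrite a0.
have Dz : cv a b = ev q ^+ i * cv a1 b1 by rewrite !cvE Da1 Db1 !evM !evXn; ring.
have ab10 : cv a1 b1 != 0 by apply: contra_neq ab0 => E; rewrite Dz E mulr0.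
have [mz|nmz] := pselect (m (cv a1 b1)); last first.
  exists i, 1, (cv a1 b1); rewrite mul1r Du -Dz; split=> //; first by split=> //;
    exact: inA1.
  by split=> //; exact: inA_cv.
(* If [m] contained both conjugates it would contain [2 a1] and then [b1 y]. As [y] is not in [m],
   [q] would divide both [a1] and [b1]. *)
have nconj : ~ m (cv a1 (- b1)).
  move=> mz'; have ma1 : q %| a1.
    apply/prime_evE; have : m (ev (2%:P * a1)).
      have -> : ev (2%:P * a1) = cv a1 b1 + cv a1 (- b1).
        by rewrite !cvE evN evM evC rmorph_nat; ring.
      exact: (primeD hm).
    by move/prime_evE; rewrite irredp_dvdp_mul // irredp_dvdp_polyC //
      (negPf two_neq0) /= => /prime_dvd.
  move: nq; rewrite ma1 /= => /negP; apply; apply/prime_evE.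
  have : m (ev b1 * y).
    have -> : ev b1 * y = cv a1 b1 - ev a1 by rewrite cvE addrC addKr.
    by apply: (primeD hm) => //; apply: primeN; exact: prime_dvd.
  case/(primeP hm (inA_ev _) inA_y) => // /prime_y.
  by rewrite (negPf nqf).
have [j [N0 [DN nqN]]] := irredp_val_exists irr_q (norm_neq0 ab10).
exists (i + j)%N, (cv a1 (- b1)), (ev N0); split.
- by split=> //; exact: inA_cv.
- by split; [exact: inA_ev | move/prime_evE; apply/negP].
by rewrite Dz mulrCA [cv a1 (- b1) * _]mulrC cv_norm DN evM evXn Du exprD mulrA.
Qed.

Lemma prime_factor_frac z : z != 0 -> exists (n : int) s w,
  [/\ inA s /\ ~ m s, inA w /\ ~ m w & z = unif ^ n * (w / s)].
Proof.
move=> z0; have [u [w [Au Aw w0 Dz]]] := inA_frac z.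
have u0 : u != 0 by apply: contra_neq z0 => u0; rewrite Dz u0 mul0r.
have [n [s [e [[As ns] [Ae ne] E]]]] := prime_factor Au u0.
have [n' [s' [e' [[As' ns'] [Ae' ne'] E']]]] := prime_factor Aw w0.
have nz0 t : ~ m t -> t != 0.
  by move=> nt; apply/eqP => t0; apply: nt; rewrite t0; exact: prime0.
exists (n%:Z - n'%:Z), (s * e'), (e * s'); split.
- by split; [exact: inA_M | exact: not_prime_mul].
- by split; [exact: inA_M | exact: not_prime_mul].
have t0 := unif_neq0.
have Eu : u = unif ^+ n * e / s by rewrite -E mulrAC mulfV ?mul1r // nz0.
have Ew : w = unif ^+ n' * e' / s' by rewrite -E' mulrAC mulfV ?mul1r // nz0.
rewrite Dz Eu Ew expfzDr // -invr_expz -!exprnP.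
have := nz0 _ ns; have := nz0 _ ne'; have := nz0 _ ns'; have := expf_neq0 n' t0.
by move=> *; field; do ?[apply/andP; split].
Qed.

End Local.
End CoordinateRing.

Lemma dvXz (F : fieldType) (v : dvaluation F) (a : F) (n : int) : v (a ^ n) = v a * n.
Proof.
case: n => n; first by rewrite -exprnP dvX -mulr_natr natz.
by rewrite NegzE -invr_expz dvV -exprnP dvX -mulr_natr natz mulrN.
Qed.

(** * Correspondence between finite points and primes of the coordinate ring *)

Section Points.
Variables (K F : fieldType) (iota : {rmorphism K -> F}) (f : {poly K}) (x y : F).
Hypothesis hF : hyperelliptic_function_field iota f x y.
Hypothesis two_neq0 : 2 != 0 :> K.
Implicit Types (a b q r : {poly K}) (z : F) (P Q : closed_point iota).
Notation cv := (coord_val iota x y).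
Notation ev := (xeval iota x).
Notation inA := (in_coord iota x y).
Notation prime_over := (prime_above iota x y).

Lemma vge_iota P c : vge P 0 (iota c).
Proof. by rewrite /vge pt_triv lexx orbT. Qed.

Lemma vge_ev P a : vge P 0 x -> vge P 0 (ev a).
Proof.
move=> vx; elim/poly_ind: a => [|a c IHa]; first by rewrite ev0 vge0.
by rewrite evD evM evC evX vgeD ?vge_iota // vgeMl.
Qed.

Lemma vge_y P : vge P 0 x -> vge P 0 y.
Proof. by move=> vx; apply: vge_half; rewrite (ysqr hF) vge_ev. Qed.

Lemma vge_inA P z : vge P 0 x -> inA z -> vge P 0 z.
Proof.
move=> vx [a [b ->]]; rewrite cvE; apply: vgeD; first exact: vge_ev.
by rewrite vgeMl ?vge_ev // vge_y.
Qed.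

(** Finite points are those where [x] is integral; there the whole coordinate ring is integral, and
    the maximal ideal of the valuation cuts out a prime of it. The converse is [point_of_prime]. *)
Lemma prime_of_point P q : vge P 0 x -> vge P 1 (ev q) -> prime_over q (vge P 1).
Proof.
move=> vx vq; split=> //.
- by move=> z w; apply: vgeD.
- by move=> z w /(vge_inA vx) vz vw; apply: vgeMl.
- by move=> z w /(vge_inA vx) vz /(vge_inA vx) vw; apply: vge1_mul.
- exact/negP/not_vge1_1.
Qed.

Section OverIrreducible.
Variable q : {poly K}.
Hypotheses (irr_q : irreducible_poly q) (q2f : ~~ (q ^+ 2 %| f)).
Notation unif := (uniformizer iota f x y q).

Section FixedPoint.
Variable P : closed_point iota.
Hypotheses (vx : vge P 0 x) (vq : vge P 1 (ev q)).

Lemma point_unitE z : inA z -> ~ vge P 1 z -> z != 0 /\ P z = 0.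
Proof. by move=> Az /negP nz; apply: vunitE => //; exact: vge_inA. Qed.

Lemma point_frac_unif (n : int) s w : inA s /\ ~ vge P 1 s -> inA w /\ ~ vge P 1 w ->
  P (unif ^ n * (w / s)) = P unif * n.
Proof.
move=> [As ns] [Aw nw].
have [s0 vs] := point_unitE As ns; have [w0 vw] := point_unitE Aw nw.
have u0 := unif_neq0 hF irr_q q2f.
by rewrite dvM ?expfz_neq0 ?mulf_neq0 ?invr_neq0 // dv_div // vs vw subrr addr0 dvXz.
Qed.

(** The valuation is normalized: some element has order 1 and is a power of [unif] times a unit, so
    [P unif] divides 1. *)
Lemma point_unif : P unif = 1.
Proof.
have hm := prime_of_point vx vq.
have [t t0 vt] := dv_unif P.
have [n [s [w [Hs Hw Dt]]]] := prime_factor_frac hF two_neq0 irr_q hm q2f t0.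
have := prime_unif hF irr_q hm; rewrite vgeE ?(unif_neq0 hF irr_q q2f) // => vu.
have : P unif * n = 1 by rewrite -(point_frac_unif n Hs Hw) -Dt vt.
move=> E; have : (`|P unif| * `|n| = 1)%N by rewrite -abszM E.
by move/eqP; rewrite muln_eq1 => /andP[/eqP + _]; lia.
Qed.

Lemma point_frac (n : int) s w : inA s /\ ~ vge P 1 s -> inA w /\ ~ vge P 1 w ->
  P (unif ^ n * (w / s)) = n.
Proof. by move=> Hs Hw; rewrite point_frac_unif // point_unif mul1r. Qed.

Lemma point_unramified : ~~ (q %| f) -> P (ev q) = 1.
Proof. by move=> /negPf nqf; have := point_unif; rewrite /uniformizer nqf. Qed.

Lemma point_ramified : q %| f -> P y = 1.
Proof. by move=> qf; have := point_unif; rewrite /uniformizer qf. Qed.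

(** The valuation ring is the localization of the coordinate ring; this reduces differentials of its
    elements to the quotient rule. *)
Lemma point_fraction z : vge P 0 z ->
  exists u s, [/\ inA u, inA s, s != 0, P s = 0 & z = u / s].
Proof.
have [->|z0] := eqVneq z 0.
  move=> _; exists 0, 1; split; rewrite ?dv1 ?oner_neq0 ?mul0r //; last exact: inA1.
  by rewrite -(ev0 iota x); exact: inA_ev.
have hm := prime_of_point vx vq.
have [n [s [w [Hs Hw Dz]]]] := prime_factor_frac hF two_neq0 irr_q hm q2f z0.
rewrite vgeE // Dz (point_frac n Hs Hw).
have [s0 vs] := point_unitE Hs.1 Hs.2.
case: n Dz => // n Dz _; exists (unif ^+ n * w), s; split=> //; last by rewrite -mulrA.
- by apply: (inA_M hF); [apply: (inA_X hF); exact: inA_unif | exact: Hw.1].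
- exact: Hs.1.
Qed.

End FixedPoint.

Lemma point_eq P Q : vge P 0 x -> vge P 1 (ev q) -> vge Q 0 x ->
  (forall z, inA z -> vge P 1 z <-> vge Q 1 z) -> P = Q.
Proof.
move=> Px Pq Qx PQ; have Qq : vge Q 1 (ev q) by apply/PQ => //; exact: inA_ev.
apply: closed_point_eq => z; have [->|z0] := eqVneq z 0; first by rewrite !dv0.
have hm := prime_of_point Px Pq.
have [n [s [w [Hs Hw Dz]]]] := prime_factor_frac hF two_neq0 irr_q hm q2f z0.
rewrite Dz point_frac // point_frac //.
- by case: Hs => As ns; split=> // vs; apply: ns; apply/PQ.
- by case: Hw => Aw nw; split=> // vw; apply: nw; apply/PQ.
Qed.

Section PointOfPrime.
Variable m : F -> Prop.
Hypothesis hm : prime_over q m.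

Let unitA z := inA z /\ ~ m z.
(** The order of [z] at [m], kept as a relation until it is known to be single-valued, total on
    nonzero elements and compatible with the operations; only then is a function chosen. *)
Let rel z (n : int) := exists s w, [/\ unitA s, unitA w & z = unif ^ n * (w / s)].

Let t0 : unif != 0. Proof. exact: (unif_neq0 hF irr_q q2f). Qed.

Let unitA_neq0 z : unitA z -> z != 0.
Proof. by move=> [_ nz]; apply/eqP => z0; apply: nz; rewrite z0; exact: (prime0 hm). Qed.

Let unitA_mul z w : unitA z -> unitA w -> unitA (z * w).
Proof.
move=> [Az nz] [Aw nw]; split; first exact: (inA_M hF).
by move/(primeP hm Az Aw) => [].
Qed.

Let unitA1 : unitA 1.
Proof. by split; [exact: inA1 | exact: (prime1 hm)]. Qed.

Let m_unif (k : nat) z : inA z -> m (unif ^+ k.+1 * z).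
Proof.
move=> Az; rewrite exprSr mulrC mulrA; apply: (primeM hm);
  last exact: (prime_unif hF irr_q hm).
by apply: (inA_M hF) => //; apply: (inA_X hF); exact: inA_unif.
Qed.

Let rel_unique z n n' : rel z n -> rel z n' -> n = n'.
Proof.
wlog le_n : n n' / n <= n' => [hwlog r1 r2|].
  by case/orP: (le_total n n') => le; [apply: hwlog | apply/esym; apply: hwlog].
move=> [s [w [us uw ->]]] [s' [w' [us' uw' E]]].
have s0 := unitA_neq0 us; have s0' := unitA_neq0 us'.
have [k Dk] : exists k : nat, n' = n + k by exists `|n' - n|%N; lia.
have {}E : w * s' = unif ^+ k * (w' * s).
  move: E; rewrite Dk expfzDr // -mulrA => /(mulfI (expfz_neq0 _ t0)) E.
  have -> : w * s' = (w / s) * (s * s') by field.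
  by rewrite E -exprnP; field.
case: k Dk E => [|k] Dk E; first by rewrite Dk addr0.
have [_] := unitA_mul uw us'; rewrite E => nm; case: nm; apply: m_unif.
by apply: (inA_M hF); [case: uw' | case: us].
Qed.

Let rel_exists z : exists n : int, (z = 0 -> n = 0) /\ (z != 0 -> rel z n).
Proof.
have [->|z0] := eqVneq z 0; first by exists 0.
have [n [s [w [Hs Hw Dz]]]] := prime_factor_frac hF two_neq0 irr_q hm q2f z0.
by exists n; split=> [z0'|_]; [rewrite z0' eqxx in z0 | exists s, w].
Qed.

Let relM z z' n n' : rel z n -> rel z' n' -> rel (z * z') (n + n').
Proof.
move=> [s [w [us uw ->]]] [s' [w' [us' uw' ->]]]; exists (s * s'), (w * w').
split; [exact: unitA_mul | exact: unitA_mul |].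
have s0 := unitA_neq0 us; have s0' := unitA_neq0 us'.
by rewrite expfzDr //; field; rewrite s0 s0'.
Qed.

Let relD z z' n n' e : rel z n -> rel z' n' -> n <= n' -> z + z' != 0 ->
  rel (z + z') e -> n <= e.
Proof.
move=> [s [w [us uw Dz]]] [s' [w' [us' uw' Dz']]] le_n zz0 re.
have s0 := unitA_neq0 us; have s0' := unitA_neq0 us'.
have [k Dk] : exists k : nat, n' = n + k by exists `|n' - n|%N; lia.
pose u := w * s' + unif ^+ k * (w' * s).
have Du : z + z' = unif ^ n * (u / (s * s')).
  by rewrite Dz Dz' Dk expfzDr // /u -exprnP; field; rewrite s0 s0'.
have Au : inA u.
  apply: inA_D; first by apply: (inA_M hF); [case: uw | case: us'].
  apply: (inA_M hF); first by apply: (inA_X hF); exact: inA_unif.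
  by apply: (inA_M hF); [case: uw' | case: us].
have u0 : u != 0 by apply: contra_neq zz0 => u0; rewrite Du u0 mul0r mulr0.
have [j [s2 [w2 [us2 uw2 E]]]] := prime_factor hF two_neq0 irr_q hm q2f Au u0.
have s20 := unitA_neq0 us2.
suff /(rel_unique re)-> : rel (z + z') (n + j%:Z) by rewrite lerDl.
exists (s2 * (s * s')), w2; split=> //; first by do 2!apply: unitA_mul => //.
rewrite Du expfzDr // -exprnP; have -> : u = unif ^+ j * w2 / s2.
  by rewrite -E mulrAC mulfV ?mul1r.
by field; rewrite s0 s0' s20.
Qed.

(** The localization at [m] is a discrete valuation ring. All points whose existence is needed are
    built through this lemma, from explicit primes. *)
Lemma point_of_prime : exists P, vge P 0 x /\ forall z, inA z -> vge P 1 z <-> m z.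
Proof.
have [V HV] := choice rel_exists.
have V0 : V 0 = 0 by have [-> //] := HV 0.
have Vrel z : z != 0 -> rel z (V z) by have [_] := HV z.
have VM (a b : F) : a != 0 -> b != 0 -> V (a * b) = V a + V b.
  by move=> a0 b0; apply: (@rel_unique (a * b)); [apply/Vrel/mulf_neq0 | apply: relM;
    exact: Vrel].
have VD (a b : F) : a != 0 -> b != 0 -> a + b != 0 -> Num.min (V a) (V b) <= V (a + b).
  move=> a0 b0 ab0; rewrite minEle; case: ifP => le.
    exact: (relD (Vrel _ a0) (Vrel _ b0) le ab0 (Vrel _ ab0)).
  rewrite addrC in ab0 *; apply: (relD (Vrel _ b0) (Vrel _ a0) _ ab0 (Vrel _ ab0)).
  by rewrite ltW // ltNge le.
have Vt : V unif = 1.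
  apply: (rel_unique (Vrel _ t0)); exists 1, 1; split=> //.
  by rewrite divff ?oner_neq0 // mulr1 expr1z.
pose vP := @DValuation F V V0 VM VD (ex_intro2 _ _ unif t0 Vt).
have Vtriv c : V (iota c) = 0.
  have [->|c0] := eqVneq c 0; first by rewrite rmorph0.
  have ic0 : iota c != 0 by rewrite fmorph_eq0.
  apply: (rel_unique (Vrel _ ic0)); exists 1, (ev c%:P); split=> //; last first.
    by rewrite expr0z divr1 mul1r evC.
  split; first exact: inA_ev.
  by move/(prime_evE irr_q hm); rewrite irredp_dvdp_polyC // (negPf c0).
pose P := @ClosedPoint K F iota vP Vtriv.
have VA z : inA z -> z != 0 -> exists2 n : nat, V z = n & (0 < n)%N <-> m z.
  move=> Az z0; have [n [s [w [us uw E]]]] := prime_factor hF two_neq0 irr_q hm q2f Az z0.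
  have s0 := unitA_neq0 us; exists n.
    apply: (rel_unique (Vrel _ z0)); exists s, w; split=> //.
    by rewrite -exprnP mulrA -E mulrAC mulfV ?mul1r.
  split=> [|mz].
    case: n E => // n E _; have : m (s * z) by rewrite E; apply: m_unif; case: uw.
    by case/(primeP hm us.1 Az) => //; case: us.
  case: n E => // E; case: uw => _; case.
  by rewrite -[w]mul1r -[1](expr0 unif) -E; apply: (primeM hm) => //; case: us.
exists P; split.
  have [->|x0] := eqVneq x 0; first exact: vge0.
  rewrite vgeE //=; have [|n -> //] := VA x _ x0.
  by have := inA_ev iota x y 'X; rewrite evX.
move=> z Az; have [->|z0] := eqVneq z 0.
  by rewrite vge0; split=> // _; exact: (prime0 hm).
by rewrite vgeE //=; have [n -> <-] := VA z Az z0.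
Qed.

End PointOfPrime.

Lemma cv_inj a b a' b' : cv a b = cv a' b' -> a = a' /\ b = b'.
Proof.
move=> E; have : cv (a - a') (b - b') = 0.
  rewrite !cvE !evB in E *; rewrite -[X in _ = X](subrr (ev a' + ev b' * y)) -{1}E; ring.
by move=> /(cv_eq0 hF)[/eqP + /eqP]; rewrite !subr_eq0 => /eqP-> /eqP->.
Qed.

Lemma sqrt_mod_exists a b : ~~ (q %| b) -> q %| a ^+ 2 - b ^+ 2 * f ->
  exists r, q %| f - r ^+ 2 /\ q %| a + b * r.
Proof.
move=> nqb qN; move: (nqb); rewrite -irreducible_poly_coprime // => /Bezout_eq1_coprimepP.
move=> [[u w] /= E].
(* [w] inverts [b] modulo [q], so this is [- a / b]; its square is [f] because the norm vanishes
   modulo [q]. *)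
exists (- (w * a)); split; last first.
  have -> : a + b * - (w * a) = a * u * q.
    by rewrite -[X in X + _]mulr1 -E; ring.
  by rewrite dvdp_mull.
have -> : f - (- (w * a)) ^+ 2
    = f * (1 + w * b) * u * q - w ^+ 2 * (a ^+ 2 - b ^+ 2 * f).
  have Eu : u * q = 1 - w * b by rewrite -E addrK.
  by rewrite -mulrA Eu; ring.
by rewrite dvdp_sub ?dvdp_mull.
Qed.

(** The prime is the kernel of evaluation at [y = r] into [K[x]/(q)]. The ramified case is included,
    with [q] dividing [r]. *)
Lemma point_split r : q %| f - r ^+ 2 ->
  exists P, vge P 0 x /\ forall a b, vge P 1 (cv a b) <-> q %| a + b * r.
Proof.
move=> qr; pose m z := exists a b, z = cv a b /\ q %| a + b * r.
have mE a b : m (cv a b) <-> q %| a + b * r.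
  by split=> [[a' [b' [/cv_inj[-> ->]]]] //|]; exists a, b.
have prodE a b a' b' : (a * a' + b * b' * f) + (a * b' + a' * b) * r
    = (a + b * r) * (a' + b' * r) + b * b' * (f - r ^+ 2) by ring.
have hm : prime_over q m.
  split.
  - move=> _ _ [a [b [-> qa]]] [a' [b' [-> qa']]]; exists (a + a'), (b + b').
    split; first by rewrite !cvE !evD; ring.
    by have -> : a + a' + (b + b') * r = (a + b * r) + (a' + b' * r) by [ring];
      rewrite dvdp_add.
  - move=> _ _ [a [b ->]] [a' [b' [-> qa']]]; rewrite (cvM hF); apply/mE.
    by rewrite prodE dvdp_add ?dvdp_mull.
  - move=> _ _ [a [b ->]] [a' [b' ->]]; rewrite (cvM hF) => /mE.
    rewrite prodE (dvdp_addl _ (dvdp_mull _ qr)) irredp_dvdp_mul // => /orP[] ?;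
      [left|right]; exact/mE.
  - have -> : 1 = cv 1 0 by rewrite cvE ev1 ev0 mul0r addr0.
    by move/mE; rewrite mul0r addr0 irredp_dvdp_polyC // oner_eq0.
  - have -> : ev q = cv q 0 by rewrite cvE ev0 mul0r addr0.
    by apply/mE; rewrite mul0r addr0.
have [P [vx HP]] := point_of_prime hm; exists P; split=> // a b.
by rewrite HP ?mE //; exact: inA_cv.
Qed.

(** If [f] is not a square modulo [q], the norm form of [a + b y] is anisotropic over the field
    [K[x]/(q)]. *)
Lemma inert_norm a b : (forall r, ~~ (q %| f - r ^+ 2)) ->
  q %| a ^+ 2 - b ^+ 2 * f -> q %| a /\ q %| b.
Proof.
move=> inert qN; have [qb|nqb] := boolP (q %| b).
  split=> //; apply: (@irredp_dvdp_exp _ _ _ 2) => //.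
  by rewrite -(dvdp_subl _ (_ : q %| b ^+ 2 * f)) // dvdp_mulr // expr2 dvdp_mulr.
by have [r [qr _]] := sqrt_mod_exists nqb qN; have := inert r; rewrite qr.
Qed.

(** Here [q] generates a prime ideal of the coordinate ring, by multiplicativity of the norm and
    [inert_norm]. *)
Lemma point_inert : (forall r, ~~ (q %| f - r ^+ 2)) ->
  exists P, vge P 0 x /\ vge P 1 (ev q).
Proof.
move=> inert; pose m z := exists a b, [/\ z = cv a b, q %| a & q %| b].
have mE a b : m (cv a b) <-> q %| a /\ q %| b.
  by split=> [[a' [b' [/cv_inj[-> ->]]]] //|[]]; exists a, b.
have hm : prime_over q m.
  split.
  - move=> _ _ [a [b [-> qa qb]]] [a' [b' [-> qa' qb']]]; exists (a + a'), (b + b').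
    by split; rewrite ?dvdp_add // !cvE !evD; ring.
  - move=> _ _ [a [b ->]] [a' [b' [-> qa' qb']]]; rewrite (cvM hF); apply/mE.
    by split; apply: dvdp_add; [exact: dvdp_mull | apply: dvdp_mulr;
      exact: dvdp_mull | exact: dvdp_mull | exact: dvdp_mulr].
  - move=> _ _ [a [b ->]] [a' [b' ->]]; rewrite (cvM hF) => /mE[q1 q2].
    have : q %| (a ^+ 2 - b ^+ 2 * f) * (a' ^+ 2 - b' ^+ 2 * f).
      have -> : (a ^+ 2 - b ^+ 2 * f) * (a' ^+ 2 - b' ^+ 2 * f)
        = (a * a' + b * b' * f) * (a * a' + b * b' * f)
          - (a * b' + a' * b) * ((a * b' + a' * b) * f) by ring.
      by rewrite dvdp_sub ?dvdp_mulr.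
    rewrite irredp_dvdp_mul // => /orP[] /(inert_norm inert) ?; [left|right]; exact/mE.
  - have -> : 1 = cv 1 0 by rewrite cvE ev1 ev0 mul0r addr0.
    by move/mE => []; rewrite irredp_dvdp_polyC // oner_eq0.
  - have -> : ev q = cv q 0 by rewrite cvE ev0 mul0r addr0.
    by apply/mE; rewrite dvdp0.
have [P [vx HP]] := point_of_prime hm; exists P; split=> //.
by apply/HP; [exact: inA_ev | exact: (prime_ev hm)].
Qed.

Lemma point_exists : exists P, vge P 0 x /\ vge P 1 (ev q).
Proof.
have [[r qr]|nr] := pselect (exists r, q %| f - r ^+ 2); last first.
  by apply: point_inert => r; apply/negP => qr; apply: nr; exists r.
have [P [vx HP]] := point_split qr; exists P; split=> //.
have -> : ev q = cv q 0 by rewrite cvE ev0 mul0r addr0.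
by apply/HP; rewrite mul0r addr0.
Qed.

(** There are at most two: at such a point [y] reduces to [r] or [- r] when [f] is the square of [r]
    modulo [q], and otherwise the prime is generated by [q]. *)
Lemma finite_points : finite_set [set P : closed_point iota | vge P 0 x /\ vge P 1 (ev q)].
Proof.
have primeE P a : vge P 0 x -> vge P 1 (ev q) -> vge P 1 (ev a) <-> q %| a.
  by move=> Px Pq; apply: (prime_evE irr_q (prime_of_point Px Pq)).
have [[r qr]|nr] := pselect (exists r, q %| f - r ^+ 2); last first.
  apply: finite_set_subsingleton => P Q [Px Pq] [Qx Qq].
  apply: (point_eq Px Pq Qx) => z; wlog: P Q Px Pq Qx Qq / vge P 1 z.
    by move=> hwlog Az; split=> vz; [apply/(hwlog P Q) | apply/(hwlog Q P)].
  move=> vz [a [b Dz]]; split=> // _; rewrite {}Dz in vz *.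
  suff [qa qb] : q %| a /\ q %| b.
    rewrite cvE; apply: vgeD; first exact/primeE.
    by rewrite mulrC; apply: vgeMl; [exact: vge_y | exact/primeE].
  apply: inert_norm; first by move=> r; apply/negP => qr; apply: nr; exists r.
  apply/(primeE P) => //; rewrite -(cv_norm hF) mulrC; apply: vgeMl => //.
  by apply: vge_inA => //; exact: inA_cv.
pose S r' := [set P : closed_point iota | [/\ vge P 0 x,
  vge P 1 (ev q) & vge P 1 (y - ev r')]]%classic.
have finS r' : finite_set (S r').
  apply: finite_set_subsingleton => P Q [Px Pq Pr] [Qx Qq Qr].
  apply: (point_eq Px Pq Qx) => _ [a [b ->]].
  have -> : cv a b = ev (a + b * r') + ev b * (y - ev r') by rewrite cvE evD evM; ring.
  have vb (R : closed_point iota) : vge R 0 x -> vge R 1 (y - ev r') ->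
    vge R 1 (ev b * (y - ev r')).
    by move=> Rx Ry; rewrite vgeMl ?vge_ev.
  rewrite (vge_addr _ (vb P Px Pr)) (vge_addr _ (vb Q Qx Qr)).
  by split=> v_; apply/primeE => //; [apply/(primeE P) | apply/(primeE Q)].
apply: (@sub_finite_set _ _ (S r `|` S (- r))%classic); last by rewrite finite_setU.
move=> P [Px Pq] /=; rewrite /S /=.
have : vge P 1 ((y - ev r) * (y - ev (- r))).
  have -> : (y - ev r) * (y - ev (- r)) = ev (f - r ^+ 2).
    by rewrite evB evN evXn -(ysqr hF); ring.
  exact/primeE.
have Py := vge_y Px.
by case/vge1_mul; [rewrite vgeB ?vge_ev | rewrite vgeB ?vge_ev | left | right].
Qed.

End OverIrreducible.

Lemma finite_zeros_ev n : (forall q, irreducible_poly q -> ~~ (q ^+ 2 %| f)) ->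
  n != 0 -> finite_set [set P : closed_point iota | vge P 0 x /\ vge P 1 (ev n)].
Proof.
move=> sf; elim: (size n) {-2}n (leqnn (size n)) => [|j IHj] {}n le_nj n0.
  by move: le_nj; rewrite leqn0 size_poly_eq0 (negPf n0).
have [n1|n_le1] := ltnP 1%N (size n); last first.
  suff -> : [set P : closed_point iota | vge P 0 x /\ vge P 1 (ev n)]%classic =
    set0 :> set (closed_point iota) by exact: finite_set0.
  apply/seteqP; split=> // P [Px]; rewrite (size1_polyC n_le1) evC.
  have c0 : n`_0 != 0 by apply: contra_neq n0 => c0; rewrite (size1_polyC n_le1) c0.
  by rewrite vgeE ?fmorph_eq0 // pt_triv.
have [q irr_q /dvdp_mulE[n' Dn]] := irredp_dvdp_exists n1.
have n0' : n' != 0 by apply: contra_neq n0 => E; rewrite Dn E mul0r.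
have fin' : finite_set [set P : closed_point iota | vge P 0 x /\ vge P 1 (ev n')].
  apply: IHj => //; move: le_nj; rewrite Dn (size_mulp n0' (irredp_neq0 irr_q)).
  have := irredp_size irr_q; lia.
apply: (@sub_finite_set _ _ ([set P : closed_point iota | vge P 0 x /\ vge P 1 (ev n')]
  `|` [set P : closed_point iota | vge P 0 x /\ vge P 1 (ev q)])%classic).
  move=> P [Px]; rewrite Dn evM => /(vge1_mul (vge_ev _ Px) (vge_ev _ Px))[] ?;
    [left|right] => //.
by rewrite finite_setU; split=> //; apply: finite_points; rewrite ?sf.
Qed.

End Points.

(** * Differentials and the canonical divisor *)

Section Derivations.
Variables (K F : fieldType) (iota : {rmorphism K -> F}) (f : {poly K}) (x y : F).
Hypothesis hF : hyperelliptic_function_field iota f x y.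
Hypothesis two_neq0 : 2 != 0 :> K.
Hypothesis f0 : f != 0.
Implicit Types (a b q r : {poly K}) (z : F) (P Q : closed_point iota).
Notation cv := (coord_val iota x y).
Notation ev := (xeval iota x).
Notation inA := (in_coord iota x y).

(* The derivation [y d/dx] of [K[x, y]]. *)
Definition derA a b : F := cv (b^`() * f + (2^-1)%:P * b * f^`()) a^`().

Let two_neq0F : 2 != 0 :> F.
Proof. by rewrite -(rmorph_nat iota) fmorph_eq0. Qed.

Lemma hyper_y_neq0 : y != 0.
Proof.
by apply: contra_neq f0 => y0; apply/eqP; rewrite -(ev_eq0 hF) -(ysqr hF) y0 expr0n.
Qed.

Lemma derAE a b : derA a b = ev b^`() * y ^+ 2 + ev b * ev f^`() / 2 + ev a^`() * y.
Proof.
rewrite /derA cvE evD !evM evC (ysqr hF) fmorphV rmorph_nat; field.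
exact: two_neq0F.
Qed.

Lemma derA_inA a b : inA (derA a b). Proof. exact: inA_cv. Qed.

Lemma derA_D a b a' b' : derA (a + a') (b + b') = derA a b + derA a' b'.
Proof. by rewrite !derAE !derivD !evD; field; exact: two_neq0F. Qed.

Lemma derA_M a b a' b' :
  derA (a * a' + b * b' * f) (a * b' + a' * b)
    = derA a b * cv a' b' + cv a b * derA a' b'.
Proof.
rewrite !derAE !cvE !(derivD, derivM, evD, evM) -!(ysqr hF); field.
exact: two_neq0F.
Qed.

Section Der.
Variables (M : lmodType F) (d : F -> M).
Hypothesis hd : derivation iota d.

Let dD (a b : F) : d (a + b) = d a + d b. Proof. by case: hd. Qed.
Let dM (a b : F) : d (a * b) = a *: d b + b *: d a. Proof. by case: hd. Qed.
Let dC c : d (iota c) = 0. Proof. by case: hd. Qed.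

Lemma der_ev a : d (ev a) = ev a^`() *: d x.
Proof.
elim/poly_ind: a => [|a c IHa].
  by rewrite deriv0 ev0 scale0r -(rmorph0 iota) dC.
rewrite derivD derivM derivX derivC addr0 !evD !evM evC evX dD dC addr0 dM IHa.
by rewrite ev1 mulr1 !scalerA -scalerDl addrC mulrC.
Qed.

(** The differential [dx / y]. Both [dx] and [dy] are multiples of it, by [y] and by [f' / 2]; for
    separable [f] these never vanish together at a finite point, so it generates the canonical sheaf
    there. *)
Definition omega0 : M := y^-1 *: d x.

Lemma der_x : d x = y *: omega0.
Proof. by rewrite /omega0 scalerA divff ?scale1r // hyper_y_neq0. Qed.

Lemma der_y : d y = (ev f^`() / 2) *: omega0.
Proof.
have y0 := hyper_y_neq0.
have : d (y ^+ 2) = (2 * y) *: d y by rewrite expr2 dM -scalerDl mulr2n mulrDl mul1r.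
rewrite (ysqr hF) der_ev => E; rewrite /omega0 scalerA.
have -> : ev f^`() / 2 / y = 2^-1 / y * ev f^`() by ring.
rewrite -scalerA E.
by rewrite scalerA; have -> : (2^-1 / y * (2 * y) = 1) by [field; rewrite y0 two_neq0F];
  rewrite scale1r.
Qed.

Lemma der_cv a b : d (cv a b) = derA a b *: omega0.
Proof.
rewrite cvE dD dM !der_ev der_x der_y !scalerA -!scalerDl derAE; congr (_ *: _).
by field; rewrite hyper_y_neq0 two_neq0F.
Qed.

Lemma der_frac a b a' b' : cv a' b' != 0 ->
  d (cv a b / cv a' b')
    = ((derA a b - cv a b / cv a' b' * derA a' b') / cv a' b') *: omega0.
Proof.
move=> w0; set z := cv a b / cv a' b';
  have Dz : cv a b = cv a' b' * z by rewrite mulrCA divff ?mulr1.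
have : d (cv a b) = cv a' b' *: d z + z *: d (cv a' b') by rewrite Dz dM.
rewrite !der_cv [z *: _]scalerA => E.
have {}E : (derA a b - z * derA a' b') *: omega0 = cv a' b' *: d z.
  by rewrite scalerBl E addrK.
by rewrite mulrC -scalerA E scalerA mulVf ?scale1r.
Qed.

End Der.

(** A concrete derivation is needed to show that [omega0] is nonzero: the universal property then
    maps it to [D x / y = 1]. *)
Lemma derivation_exists : exists D : F -> F^o, derivation iota D /\ D x = y.
Proof.
have [del Hdel] : exists del : F -> F, forall a b, del (cv a b) = derA a b.
  have : forall z, exists e, forall a b, z = cv a b -> e = derA a b.
    move=> z; have [[a [b ->]]|nz] := pselect (inA z).
      by exists (derA a b) => a' b' /(cv_inj hF)[-> ->].
    by exists 0 => a b Dz; case: nz; rewrite Dz; exact: inA_cv.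
  by move=> /choice[del H]; exists del => a b; apply: H.
have delD u w : inA u -> inA w -> del (u + w) = del u + del w.
  move=> [a [b ->]] [a' [b' ->]]; rewrite !Hdel -derA_D -Hdel; congr del.
  by rewrite !cvE !evD; ring.
have delM u w : inA u -> inA w -> del (u * w) = del u * w + u * del w.
  by move=> [a [b ->]] [a' [b' ->]]; rewrite !Hdel (cvM hF) Hdel derA_M.
have delC c : del (iota c) = 0.
  have -> : iota c = cv c%:P 0 by rewrite cvE ev0 mul0r addr0 evC.
  by rewrite Hdel derAE deriv0 derivC ev0 !mul0r !addr0.
have delx : del x = y.
  have -> : x = cv 'X 0 by rewrite cvE ev0 mul0r addr0 evX.
  by rewrite Hdel derAE deriv0 derivX ev0 ev1 !mul0r !add0r mul1r.
(* The quotient rule as a relation between [z] and its derivative [e]; [rel_unique] shows that the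
   chosen fraction does not matter. *)
pose rel z e := exists u w, [/\ inA u, inA w, w != 0,
  u = z * w & e = (del u - z * del w) / w].
have rel_unique z e e' : rel z e -> rel z e' -> e = e'.
  move=> [u [w [Au Aw w0 Du ->]]] [u' [w' [Au' Aw' w0' Du' ->]]].
  have E : u * w' = u' * w by rewrite Du Du'; ring.
  have := congr1 del E; rewrite !delM // => E'.
  have Eu c : u * c = z * w * c by rewrite Du.
  have Eu' c : u' * c = z * w' * c by rewrite Du'.
  have {}E' : (del u - z * del w) * w' = (del u' - z * del w') * w.
    have -> : (del u - z * del w) * w'
      = (del u * w' + u * del w') - u * del w' - z * del w * w' by ring.
    by rewrite E' Eu Eu'; ring.
  by apply: (mulIf w0'); rewrite mulrAC E'; field; rewrite w0 w0'.
have rel_exists z : exists e, rel z e.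
  have [u [w [Au Aw w0 Dz]]] := inA_frac hF z.
  exists ((del u - z * del w) / w), u, w; split=> //.
  by rewrite Dz mulfVK.
have [D HD] := choice rel_exists.
have relA z : inA z -> rel z (del z).
  move=> Az; exists z, 1; have A1 := inA1 iota x y; split=> //;
    rewrite ?oner_neq0 ?mulr1 //.
  have : del 1 = 0 by rewrite -(rmorph1 iota).
  by move=> ->; rewrite mulr0 subr0 divr1.
exists D; split; last first.
  rewrite -delx; apply: (rel_unique x); first exact: HD.
  by apply: relA; have := inA_ev iota x y 'X; rewrite evX.
split.
- move=> z z'; apply: (rel_unique (z + z')); first exact: HD.
  have [u [w [Au Aw w0 Du ->]]] := HD z; have [u' [w' [Au' Aw' w0' Du' ->]]] := HD z'.
  exists (u * w' + u' * w), (w * w').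
  have A1 : inA (u * w') by exact: (inA_M hF).
  have A2 : inA (u' * w) by exact: (inA_M hF).
  split; [exact: inA_D | exact: (inA_M hF) | by rewrite mulf_neq0 | by rewrite Du Du';
    ring |].
  have Eu c : u * c = z * w * c by rewrite Du.
  have Eu' c : u' * c = z' * w' * c by rewrite Du'.
  by rewrite delD // !delM // Eu Eu'; field; rewrite w0 w0'.
- move=> z z'; apply: (rel_unique (z * z')); first exact: HD.
  have [u [w [Au Aw w0 Du ->]]] := HD z; have [u' [w' [Au' Aw' w0' Du' ->]]] := HD z'.
  exists (u * u'), (w * w').
  split; [exact: (inA_M hF) | exact: (inA_M hF) | by rewrite mulf_neq0 |
    by rewrite Du Du'; ring |].
  have Eu c : u * c = z * w * c by rewrite Du.
  have Eu' c : c * u' = z' * w' * c by rewrite mulrC Du'.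
  by rewrite !delM // /GRing.scale /= Eu Eu'; field; rewrite w0 w0'.
- move=> c; apply: (rel_unique (iota c)); first exact: HD.
  rewrite -(delC c); apply: relA; rewrite -(evC iota x); exact: inA_ev.
Qed.

Section Kaehler.
Variables (Omega : lmodType F) (d : F -> Omega).
Hypothesis hd : kaehler_differentials iota d.

(** Let [phi] be the linear form induced by the derivation with [D x = y]. The map sending [eta] to
    [phi eta *: omega0 d] fixes every [d z], so by uniqueness in the universal property it is the
    identity. *)
Lemma kaehler_rank1 :
  omega0 d != 0 /\ forall eta, exists z, eta = z *: omega0 d.
Proof.
have [dd univ] := hd; have y0 := hyper_y_neq0.
have [D [Dder Dx]] := derivation_exists.
have [phi [phid _]] := univ _ _ Dder.
have phi1 : phi (omega0 d) = 1 by rewrite /omega0 linearZ /= phid Dx /GRing.scale /= mulVf.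
split.
  by apply/eqP => w0; move: phi1; rewrite w0 linear0 => /esym/eqP; rewrite oner_eq0.
pose psi_fun (eta : Omega) : Omega := (phi eta : F) *: omega0 d.
have psi_lin : linear psi_fun.
  move=> c u w; rewrite /psi_fun.
  have -> : (phi (c *: u + w) : F) = c * (phi u : F) + phi w by rewrite linearP.
  by rewrite scalerDl -scalerA.
pose psi_add := GRing.isLinear.Build F Omega Omega *:%R psi_fun psi_lin.
pose psi : {linear Omega -> Omega} := HB.pack psi_fun psi_add.
have [phi' [_ uniq]] := univ _ _ dd.
have psid z : psi (d z) = d z.
  rewrite /psi /= /psi_fun phid.
  have [_ _ /(_ z)[a [b [a' [b' [w0 ->]]]]]] := hF.
  rewrite (der_frac dd) // (der_frac Dder) // /omega0 Dx /GRing.scale /=.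
  by rewrite mulVf // mulr1.
pose id_add := GRing.isLinear.Build F Omega Omega *:%R id (fun _ _ _ => erefl).
pose idl : {linear Omega -> Omega} := HB.pack id id_add.
move=> eta; exists (phi eta : F).
have := uniq idl (fun _ => erefl) eta; rewrite /= => {1}->.
by rewrite -(uniq psi psid).
Qed.

Let dd : derivation iota d. Proof. by case: hd. Qed.

(** The derivation [y d/dx] preserves the coordinate ring, hence its localization, so the stalk is
    contained in the multiples of [omega0]. Conversely [y] or [f'] is a unit at [P], and [omega0] is
    then a unit multiple of [dx], or an integral multiple of [dy]. *)
Lemma stalk_finite P q eta : irreducible_poly q -> ~~ (q ^+ 2 %| f) ->
  vge P 0 x -> vge P 1 (ev q) -> ~~ vge P 1 y \/ ~~ vge P 1 (ev f^`()) ->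
  canonical_stalk d P eta <-> exists2 z, vge P 0 z & eta = z *: omega0 d.
Proof.
move=> irr_q q2f Px Pq smooth; split.
  move=> [n [b [a [vb va ->]]]].
  have dO z : vge P 0 z -> exists2 e, vge P 0 e & d z = e *: omega0 d.
    move=> vz; have [u [s [[a1 [b1 Du]] [a2 [b2 Ds]] s0 vs Dz]]]
      := point_fraction hF two_neq0 irr_q q2f Px Pq vz.
    rewrite Ds in s0 vs; exists ((derA a1 b1 - z * derA a2 b2) / cv a2 b2).
      rewrite -[0]addr0 vgeM //; last by rewrite vgeE ?invr_eq0 // dvV vs oppr0.
      have vder a' b' : vge P 0 (derA a' b') by apply: (vge_inA hF Px); exact: derA_inA.
      by rewrite vgeB // vgeMl.
    by rewrite Dz Du Ds (der_frac dd).
  have /choice[e He] : forall i, exists e, vge P 0 e /\ d (a i) = e *: omega0 d.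
    by move=> i; have [e ve De] := dO _ (va i); exists e.
  exists (\sum_i b i * e i); first by apply: vge_sum => i _; rewrite vgeMl //; case: (He i).
  by rewrite scaler_suml; apply: eq_bigr => i _; rewrite (He i).2 scalerA.
move=> [z vz ->].
have Py := vge_y hF Px.
case: smooth => [ny|nf'].
  have [y0 vy] := vunitE Py ny.
  exists 1%N, (fun=> z / y), (fun=> x); split=> // [_|]; last first.
    by rewrite big_ord1 /omega0 scalerA.
  by rewrite vgeMl // vgeE ?invr_eq0 // dvV vy oppr0.
have [f'0 vf'] := vunitE (vge_ev _ Px) nf'.
exists 1%N, (fun=> z * (2 / ev f^`())), (fun=> y); split=> // [_|]; last first.
  rewrite big_ord1 (der_y dd) scalerA; congr (_ *: _); field.
  by rewrite f'0 two_neq0F.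
rewrite vgeMl // vgeMl //; first by rewrite -(rmorph_nat iota) vge_iota.
by rewrite vgeE ?invr_eq0 // dvV vf' oppr0.
Qed.

End Kaehler.
End Derivations.

(** Some element of the coordinate ring has positive order at [P]; so does its norm in [K[x]], and
    hence one of the irreducible factors of that norm. *)
Lemma point_lies_over (K F : fieldType) (iota : {rmorphism K -> F}) (f : {poly K})
    (x y : F) (P : closed_point iota) :
  hyperelliptic_function_field iota f x y -> vge P 0 x ->
  exists2 q, irreducible_poly q & vge P 1 (xeval iota x q).
Proof.
move=> hF Px.
have [t t0 vt] := dv_unif P; have [u [w [Au Aw w0 Dt]]] := inA_frac hF t.
have u0 : u != 0 by apply: contra_neq t0 => u0; rewrite Dt u0 mul0r.
have [z [Az z0 vz]] : exists z, [/\ in_coord iota x y z, z != 0 & vge P 1 z].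
  exists u; split=> //; have := vge_inA hF Px Aw; rewrite !vgeE // => vw.
  by move: vt; rewrite Dt dv_div //; lia.
case: Az => a [b Dz]; rewrite Dz in z0 vz.
have N0 := norm_neq0 hF z0.
have {vz} : vge P 1 (xeval iota x (a ^+ 2 - b ^+ 2 * f)).
  by rewrite -(cv_norm hF) mulrC vgeMl // (vge_inA hF) //; exact: inA_cv.
move: N0; move: (a ^+ 2 - b ^+ 2 * f : {poly K}) => n.
elim: (size n) {-2}n (leqnn (size n)) => [|j IHj] {}n le_nj n0 vn.
  by move: le_nj; rewrite leqn0 size_poly_eq0 (negPf n0).
have [n1|n_le1] := ltnP 1%N (size n); last first.
  move: n0 vn; rewrite (size1_polyC n_le1) polyC_eq0 evC => c0.
  by rewrite vgeE ?fmorph_eq0 // pt_triv.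
have [q irr_q /dvdp_mulE[n' Dn]] := irredp_dvdp_exists n1.
have n0' : n' != 0 by apply: contra_neq n0 => E; rewrite Dn E mul0r.
move: vn; rewrite Dn evM => /(vge1_mul (vge_ev _ Px) (vge_ev _ Px))[vn'|]; last by exists q.
apply: (IHj n') => //; move: le_nj; rewrite Dn (size_mulp n0' (irredp_neq0 irr_q)).
have := irredp_size irr_q; lia.
Qed.

Lemma scaler_injl (F : fieldType) (V : lmodType F) (w : V) :
  w != 0 -> injective (fun c : F => c *: w).
Proof.
move=> w0 a b /= /eqP; rewrite -subr_eq0 -scalerBl scaler_eq0 (negPf w0) orbF.
by rewrite subr_eq0 => /eqP.
Qed.

(** * The chart at infinity and the divisor of [dx / y] *)

Section ReversePoly.
Variable K : fieldType.
Implicit Types a : {poly K}.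

(** This is [X^n a(1/X)]. The integer [n] is given, not read off from [a], so that several
    polynomials can be reversed in a common degree. *)
Definition revp (n : nat) a : {poly K} := \poly_(i < n.+1) a`_(n - i).

Lemma size_revp n a : (size (revp n a) <= n.+1)%N.
Proof. exact: size_poly. Qed.

Lemma revpK n a : (size a <= n.+1)%N -> revp n (revp n a) = a.
Proof.
move=> sa; apply/polyP => i; rewrite coef_poly ltnS; case: leqP => [le_in|lt_ni].
  by rewrite coef_poly ltnS leq_subr subKn.
by rewrite nth_default // (leq_trans sa).
Qed.

Lemma revp_eq0 n a : (size a <= n.+1)%N -> (revp n a == 0) = (a == 0).
Proof.
move=> sa; apply/eqP/eqP => [r0|->].
  by rewrite -(revpK sa) r0; apply/polyP=> i; rewrite coef_poly !coef0 if_same.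
by apply/polyP=> i; rewrite coef_poly !coef0 if_same.
Qed.

Lemma ev_revp (F : fieldType) (iota : {rmorphism K -> F}) (x : F) n a :
  x != 0 -> (size a <= n.+1)%N -> xeval iota x^-1 (revp n a) = x ^- n * xeval iota x a.
Proof.
move=> x0 sa; have evE z (b : {poly K}) : (size b <= n.+1)%N ->
    xeval iota z b = \sum_(i < n.+1) iota b`_i * z ^+ i.
  move=> sb; rewrite /xeval (@horner_coef_wide _ n.+1) ?size_map_poly //.
  by apply: eq_bigr => i _; rewrite coef_map.
rewrite !evE ?size_revp // (reindex_inj rev_ord_inj) /= mulr_sumr.
apply: eq_bigr => i _; rewrite coef_poly subSS ltnS leq_subr subKn -1?ltnS //.
rewrite mulrCA; congr (_ * _).
have le_in : (i <= n)%N by rewrite -ltnS.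
have -> : x ^- n = x ^- (n - i) * x ^- i by rewrite -invfM -exprD subnK.
by rewrite exprVn mulfVK // expf_neq0.
Qed.

End ReversePoly.

Section Infinity.
Variables (K F : fieldType) (iota : {rmorphism K -> F}) (f : {poly K}) (x y : F).
Hypothesis hF : hyperelliptic_function_field iota f x y.
Hypothesis two_neq0 : 2 != 0 :> K.
Variable d : nat.
Hypotheses (d2 : (2 <= d)%N) (sf : size f = (d + d).+1).
Hypothesis fsep : coprimep f f^`().
Implicit Types (a b q r : {poly K}) (z : F) (P Q : closed_point iota).
Notation cv := (coord_val iota x y).
Notation ev := (xeval iota x).
Notation inA := (in_coord iota x y).

Lemma size_f_neq0 : f != 0.
Proof. by rewrite -size_poly_eq0 sf. Qed.

Lemma squarefree_of_separable q : irreducible_poly q -> ~~ (q ^+ 2 %| f).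
Proof.
move=> irr_q; apply/negP => /dvdp_mulE[b Db].
have qf : q %| f by rewrite Db expr2 mulrA dvdp_mulIr.
have qf' : q %| f^`().
  rewrite Db expr2 !derivM.
  have -> : b^`() * (q * q) + b * (q^`() * q + q * q^`())
    = (b^`() * q + 2 * b * q^`()) * q by ring.
  exact: dvdp_mulIr.
by have := coprimep_dvdl qf' fsep; rewrite coprimep_sym irreducible_poly_coprime // qf.
Qed.

Lemma x_neq0 : x != 0.
Proof. by rewrite -(evX iota x) (ev_eq0 hF) polyX_eq0. Qed.

Let u := x^-1.
Let w := y / x ^+ d.
Let finf := revp (d + d) f.

(** The curve has the same shape in the coordinates [1/x] and [y / x^d]. The points at infinity
    become the finite points above ['X], and the local results apply to them unchanged. *)
Lemma hyper_infinity : hyperelliptic_function_field iota finf u w.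
Proof.
have x0 := x_neq0; split.
- rewrite -/(xeval iota u finf) ev_revp ?sf // -(ysqr hF) /w exprD; field.
  by rewrite expf_neq0.
- move=> a b E; set N := maxn (size a) (size b).
  have sa : (size a <= N.+1)%N by rewrite leqW // leq_maxl.
  have sb : (size b <= N.+1)%N by rewrite leqW // leq_maxr.
  (* This is the value of [a] and [b] in the new coordinates, multiplied by [x^(N + d)] to clear
     denominators. *)
  have : cv ('X^d * revp N a) (revp N b) = 0.
    rewrite cvE evM evXn evX -[X in X + _]mul1r -(mulVf (expf_neq0 N x0)) -mulrA.
    have -> c : x ^- N * (x ^+ N * c) = c by rewrite mulKf // expf_neq0.
    apply: (mulfI (expf_neq0 N (invr_neq0 x0))).
    apply: (mulfI (expf_neq0 d (invr_neq0 x0))).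
    rewrite !mulr0 -E cvE -/u /w -[in RHS](revpK sa) -[in RHS](revpK sb).
    rewrite /u !ev_revp ?size_revp // !exprVn; field.
    by rewrite !expf_neq0.
  move=> /(cv_eq0 hF)[/eqP + /eqP]; rewrite mulf_eq0 (negPf (expf_neq0 _ _)) ?polyX_eq0 //=.
  by rewrite !revp_eq0 // => /eqP-> /eqP->.
- move=> z; have [_ _ /(_ z)[a [b [a' [b' [w0 Dz]]]]]] := hF.
  pose N := (size a + size b + size a' + size b')%N.
  have conv a1 b1 : (size a1 <= N.+1)%N -> (size b1 <= N.+1)%N ->
      cv a1 b1 = x ^+ N * x ^+ d * coord_val iota u w ('X^d * revp N a1) (revp N b1).
    move=> sa sb; rewrite !cvE evM evXn evX /u !ev_revp // /w exprVn; field.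
    by rewrite !expf_neq0.
  have E1 : cv a b = x ^+ N * x ^+ d * coord_val iota u w ('X^d * revp N a) (revp N b).
    by apply: conv; rewrite /N; lia.
  have E2 : cv a' b' = x ^+ N * x ^+ d * coord_val iota u w ('X^d * revp N a') (revp N b').
    by apply: conv; rewrite /N; lia.
  exists ('X^d * revp N a), (revp N b), ('X^d * revp N a'), (revp N b').
  have nz : coord_val iota u w ('X^d * revp N a') (revp N b') != 0.
    by apply: contra_neq w0 => E; rewrite E2 E mulr0.
  by split=> //; rewrite Dz E1 E2; field; rewrite nz !expf_neq0.
Qed.

Let irrX : irreducible_poly ('X : {poly K}).
Proof. by have := irredp_XsubC (0 : K); rewrite subr0. Qed.

(** The constant coefficient of [finf] is the leading coefficient of [f], whose degree is exactly
    [2 d]; so infinity is unramified. *)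
Lemma X_ndvd_finf : ~~ ('X %| finf).
Proof.
rewrite -['X]subr0 dvdp_XsubCl /root horner_coef0 coef_poly subn0 /=.
have -> : (d + d)%N = (size f).-1 by rewrite sf.
by rewrite -lead_coefE lead_coef_eq0 size_f_neq0.
Qed.

Lemma X2_ndvd_finf : ~~ ('X ^+ 2 %| finf).
Proof.
by apply: contra X_ndvd_finf; apply: dvdp_trans; rewrite expr2 dvdp_mulIl.
Qed.

Lemma vge_infinity P : ~~ vge P 0 x -> vge P 0 u /\ vge P 1 (xeval iota u 'X).
Proof.
move=> /vge_neg[x0 vx]; rewrite evX /u !vgeE ?invr_eq0 ?x_neq0 // dvV.
by split; lia.
Qed.

Lemma val_x_infinity P : ~~ vge P 0 x -> P x = -1.
Proof.
move=> nx; have [Pu Pu1] := vge_infinity nx.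
have := point_unramified hyper_infinity two_neq0 irrX X2_ndvd_finf Pu Pu1 X_ndvd_finf.
by rewrite evX /u dvV; lia.
Qed.

Lemma infinity_exists : exists P, ~~ vge P 0 x.
Proof.
have [P [Pu Pu1]] := point_exists hyper_infinity two_neq0 irrX X2_ndvd_finf.
exists P; move: Pu1; rewrite evX /u !vgeE ?invr_eq0 ?x_neq0 // dvV; lia.
Qed.

Lemma finite_infinity : finite_set [set P : closed_point iota | ~~ vge P 0 x].
Proof.
have := finite_points hyper_infinity two_neq0 irrX X2_ndvd_finf.
by apply: sub_finite_set => P /=; exact: vge_infinity.
Qed.

Lemma val_ev_infinity P a : ~~ vge P 0 x -> a != 0 -> P (ev a) = - (size a).-1%:Z.
Proof.
move=> nx a0; have [Pu Pu1] := vge_infinity nx.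
have sa : (size a <= (size a).-1.+1)%N by exact: leqSpred.
have x0 := x_neq0.
have : P (xeval iota u (revp (size a).-1 a)) = 0.
  apply: (proj2 (point_unitE hyper_infinity Pu (inA_ev _ _ _ _) _)).
  move=> /(prime_evE irrX (prime_of_point hyper_infinity Pu Pu1)).
  rewrite -['X]subr0 dvdp_XsubCl /root horner_coef0 coef_poly subn0 /=.
  by rewrite -lead_coefE lead_coef_eq0 (negPf a0).
rewrite ev_revp // dvM ?invr_eq0 ?expf_neq0 ?(ev_eq0 hF) // dvV dvX val_x_infinity //.
by rewrite mulNrn opprK natz; lia.
Qed.

Lemma val_y_infinity P : ~~ vge P 0 x -> P y = - d%:Z.
Proof.
move=> nx; have := val_ev_infinity nx size_f_neq0.
by rewrite -(ysqr hF) dvX sf /=; lia.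
Qed.

(* The polar divisor of [x]: its poles are simple because [deg f] is even. *)
Definition infinity_mult P : int := if vge P 0 x then 0 else 1.

Notation inf_mult := infinity_mult.

Section Canonical.
Variables (Omega : lmodType F) (dF : F -> Omega).
Hypothesis hd : kaehler_differentials iota dF.
Let w0 := omega0 x y dF.

Let dd : derivation iota dF. Proof. by case: hd. Qed.

(** The source of the multiplicity [d - 2]: [d(1/x) = - dx / x^2] is divided by [y / x^d]. *)
Lemma omega0_infinity : omega0 u w dF = (- x ^+ (d - 2)) *: w0.
Proof.
have x0 := x_neq0; have y0 := hyper_y_neq0 hF size_f_neq0.
have [dD dM dC] := dd.
have d1 : dF 1 = 0 by rewrite -(rmorph1 iota).
have du : dF u = (- x ^- 2) *: dF x.
  have : dF (x * u) = 0 by rewrite /u divff.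
  rewrite dM => /eqP; rewrite addr_eq0 => /eqP E.
  have -> : dF u = x^-1 *: (x *: dF u) by rewrite scalerA mulVf ?scale1r.
  rewrite E scalerN scalerA -scaleNr /u; congr (_ *: _); field.
  by rewrite x0.
rewrite /w0 /omega0 du !scalerA; congr (_ *: _).
have Ed : x ^+ d = x ^+ (d - 2) * x ^+ 2 by rewrite -exprD subnK.
by rewrite /w Ed; field; rewrite x0 y0 expf_neq0.
Qed.

Lemma stalk_canonical P eta : canonical_stalk dF P eta <->
  exists2 z, vge P (- ((d - 2)%:Z * inf_mult P)) z & eta = z *: w0.
Proof.
rewrite /infinity_mult; case: ifP => [Px|/negbT nx].
  rewrite mulr0 oppr0; have [q irr_q Pq] := point_lies_over hF Px.
  suff smooth : ~~ vge P 1 y \/ ~~ vge P 1 (ev f^`()).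
    exact: (stalk_finite hF two_neq0 size_f_neq0 hd _ irr_q (squarefree_of_separable
      irr_q) Px Pq smooth).
  have [Py|] := boolP (vge P 1 y); last by left.
  right; apply/negP => Pf'; have /Bezout_eq1_coprimepP[[a b] /= E] := fsep.
  have := not_vge1_1 P; rewrite -(ev1 iota x) -E evD !evM => /negP; apply.
  by rewrite vgeD // vgeMl ?vge_ev // -(ysqr hF) expr2 vgeMl // (vge_y hF).
have [Pu Pu1] := vge_infinity nx.
have finf0 : finf != 0 by rewrite revp_eq0 ?sf ?size_f_neq0.
have xd0 : - x ^+ (d - 2) != 0 by rewrite oppr_eq0 expf_neq0 // x_neq0.
have vxd : P (- x ^+ (d - 2)) = - (d - 2)%:Z by rewrite dvN dvX val_x_infinity //; lia.
have nw : ~~ vge P 1 w \/ ~~ vge P 1 (xeval iota u finf^`()).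
  left; apply/negP => /(prime_y hyper_infinity irrX (prime_of_point hyper_infinity Pu Pu1)).
  by rewrite (negPf X_ndvd_finf).
rewrite (stalk_finite hyper_infinity two_neq0 finf0 hd _ irrX X2_ndvd_finf Pu Pu1 nw).
rewrite omega0_infinity mulr1; split=> [[z vz ->]|[z vz ->]].
  exists (z * - x ^+ (d - 2)); last by rewrite scalerA.
  by rewrite -vxd -[P _]add0r vge_dvM.
exists (z / - x ^+ (d - 2)); last by rewrite [RHS]scalerA divfK.
by rewrite -(vge_dvM P _ _ xd0) divfK // add0r vxd.
Qed.

Lemma finite_inf_mult : finite_set [set P : closed_point iota |
  (d - 2)%:Z * inf_mult P != 0].
Proof.
apply: sub_finite_set finite_infinity => P /=; apply: contraNN => Px.
by rewrite /infinity_mult Px mulr0.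
Qed.

Definition canonical_div : divisor iota := Divisor finite_inf_mult.

Lemma canonical_divP : canonical_divisor dF canonical_div.
Proof.
exists w0; first by have [] := kaehler_rank1 hF two_neq0 size_f_neq0 hd.
exact: stalk_canonical.
Qed.

(** Two nonzero differentials differ by a function [z]. Since both describe the same stalks, their
    divisors differ by that of [z]. *)
Lemma canonical_div_unique (W : divisor iota) : canonical_divisor dF W ->
  exists2 z, z != 0 & forall P, W P = (d - 2)%:Z * inf_mult P + P z.
Proof.
move=> [omega om0 HW]; have [w00 gen] := kaehler_rank1 hF two_neq0 size_f_neq0 hd.
have [z Dom] := gen omega.
have z0 : z != 0 by apply: contra_neq om0 => z0; rewrite Dom z0 scale0r.
exists z => // P; set D := (_ * _ : int).
have key c : c != 0 -> (- W P <= P c) = (- D <= P c + P z).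
  move=> c0; rewrite -dvM // -!vgeE ?mulf_neq0 //.
  apply/idP/idP => vc.
    have /HW/stalk_canonical[c' vc']
      : exists2 e, vge P (- W P) e & c *: omega = e *: omega by exists c.
    by rewrite Dom scalerA => /(scaler_injl w00)->.
  have /stalk_canonical/HW[c' vc'] : exists2 e, vge P (- D) e & c *: omega = e *: w0.
    by exists (c * z); rewrite // Dom scalerA.
  by move=> /(scaler_injl om0)->.
(* Elements whose order is exactly at either threshold turn the equivalence [key] into the two
   opposite inequalities. *)
have [c1 c10 v1] := dv_exists P (- W P).
have [c2 c20 v2] := dv_exists P (- D - P z).
move: (key _ c10) (key _ c20); rewrite v1 v2 lexx subrK lexx => /esym h1 h2.
apply/eqP; rewrite eq_le; apply/andP; split; [move: h1 | move: h2]; clear.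
  by move: (W P) (P z) => A B h; have {h}: is_true _ := h; lia.
by move: (W P) (P z) => A B h; have {h}: is_true _ := h; lia.
Qed.

End Canonical.
End Infinity.

(** * Rational theta characteristics *)

Section Theta.
Variables (K F : fieldType) (iota : {rmorphism K -> F}) (f : {poly K}) (x y : F).
Hypothesis hF : hyperelliptic_function_field iota f x y.
Hypothesis two_neq0 : 2 != 0 :> K.
Variable d : nat.
Hypotheses (d2 : (2 <= d)%N) (sf : size f = (d + d).+1).
Hypothesis fsep : coprimep f f^`().
Variables (Omega : lmodType F) (dF : F -> Omega).
Hypothesis hd : kaehler_differentials iota dF.
Implicit Types (a b q r A B : {poly K}) (z : F) (P Q : closed_point iota).
Notation cv := (coord_val iota x y).
Notation ev := (xeval iota x).
Notation inA := (in_coord iota x y).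
Notation inf_mult := (@infinity_mult K F iota x).

Let sqf q : irreducible_poly q -> ~~ (q ^+ 2 %| f) := squarefree_of_separable fsep (q:=q).
Let W0 := canonical_div hF two_neq0 d2 sf fsep.
Let f0 : f != 0 := size_f_neq0 sf.

Let cv0 a : cv a 0 = ev a. Proof. by rewrite cvE ev0 mul0r addr0. Qed.

Lemma theta_even : ~~ odd d -> has_rational_theta_characteristic iota dF.
Proof.
move=> ed; have fin : finite_set [set P : closed_point iota |
  (d./2.-1)%:Z * inf_mult P != 0].
  apply: sub_finite_set (finite_infinity hF two_neq0 d2 sf fsep) => P /=;
    apply: contraNN => Px.
  by rewrite /infinity_mult Px mulr0.
exists (Divisor fin); exists W0; first exact: canonical_divP.
exists 1; rewrite ?oner_neq0 // => P /=; rewrite dv1.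
have -> : (d - 2)%N = (d./2.-1).*2 by have := odd_double_half d; rewrite (negPf ed); lia.
by rewrite -mulr_natr; lia.
Qed.

(* In [(y - A)(y + A) = - c B^2] the two factors have no common finite zero, as
   [f] is squarefree, so [y - A] has even order at finite points; it has odd
   order at infinity, where one factor has order [-d] and the orders add up to an
   even number. Hence [div (y - A) + W0] is twice a divisor. *)
Lemma theta_of_decomp (c : K) A B : odd d -> (size A <= d.+1)%N -> (size B <= d.+1)%N ->
  f = A ^+ 2 - c *: B ^+ 2 -> has_rational_theta_characteristic iota dF.
Proof.
move=> od sA sB Df.
(* A square would have a repeated factor; this is what keeps [c] and [B] nonzero. *)
have nsq a : f != a ^+ 2.
  apply/eqP => Da; have a1 : (1 < size a)%N.
    rewrite ltnNge; apply/negP => a_le1; move: sf; rewrite Da (size1_polyC a_le1).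
    by rewrite -polyC_exp size_polyC; case: (_ != 0); lia.
  have [q irr_q qa] := irredp_dvdp_exists a1.
  by have := sqf irr_q; rewrite Da dvdp_exp2r.
have cB0 : c *: B ^+ 2 != 0.
  by apply: contra_neq (nsq A) => cB0; rewrite Df cB0 subr0.
have [c0 B0] : c != 0 /\ B != 0.
  by split; apply: contra_neq cB0 => ->; rewrite ?scale0r // expr0n scaler0.
have ic0 : iota c != 0 by rewrite fmorph_eq0.
have vic P : P (iota c) = 0 by exact: pt_triv.
set z := y - ev A; set z' := y + ev A.
have y0 := hyper_y_neq0 hF f0.
have zz' : z * z' = - (iota c * ev B ^+ 2).
  have -> : z * z' = y ^+ 2 - ev A ^+ 2 by rewrite /z /z'; ring.
  rewrite (ysqr hF) Df evB -mul_polyC evM evC !evXn; ring.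
have eB0 : ev B != 0 by rewrite (ev_eq0 hF).
have zz'0 : z * z' != 0 by rewrite zz' oppr_eq0 mulf_neq0 ?expf_neq0.
have z0 : z != 0 by apply: contra_neq zz'0 => ->; rewrite mul0r.
have z'0 : z' != 0 by apply: contra_neq zz'0 => ->; rewrite mulr0.
have vzz' P : P z + P z' = P (ev B) *+ 2.
  by rewrite -dvM // zz' dvN dvM ?expf_neq0 // vic dvX add0r.
have Az : inA z by apply: inA_D; [exact: inA_y | apply: (inA_N hF); exact: inA_ev].
have Az' : inA z' by apply: inA_D; [exact: inA_y | exact: inA_ev].
have v2 P : P 2 = 0 by rewrite -(rmorph_nat iota) pt_triv.
have n20 : 2 != 0 :> F by rewrite -(rmorph_nat iota) fmorph_eq0.
have common P : vge P 0 x -> ~ (vge P 1 z /\ vge P 1 z').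
  move=> Px [vz vz']; have [q irr_q Pq] := point_lies_over hF Px.
  have hm := prime_of_point hF Px Pq.
  have half e : vge P 1 (2 * e) -> vge P 1 e.
    have [->|e0] := eqVneq e 0; first by rewrite vge0.
    by rewrite !vgeE ?mulf_neq0 // dvM // v2 add0r.
  have qA : q %| A.
    apply/(prime_evE irr_q hm)/half; have -> : 2 * ev A = z' - z by rewrite /z /z'; ring.
    exact: vgeB.
  have qB : q %| B.
    apply/(prime_evE irr_q hm); apply: (@prime_X _ _ _ _ _ _ hF _ _ hm _ 2);
      first exact: inA_ev.
    have : vge P 1 (iota c * ev B ^+ 2) by rewrite -vgeN -zz' vgeMl // (vge_inA hF).
    by rewrite !vgeE ?mulf_neq0 ?expf_neq0 // dvM ?expf_neq0 // vic add0r.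
  have := sqf irr_q; rewrite Df dvdp_sub ?dvdp_exp2r //.
  by rewrite -mul_polyC dvdp_mull // dvdp_exp2r.
have even_z P : exists m, P z + (d - 2)%:Z * inf_mult P = m *+ 2.
  rewrite /infinity_mult; case: ifP => [Px|/negbT nx].
    rewrite mulr0 addr0; have [vz|nvz] := boolP (vge P 1 z); last first.
      by exists 0; have [_ ->] := point_unitE hF Px Az (negP nvz).
    exists (P (ev B)); rewrite -vzz'; have nz' : ~ vge P 1 z' by move=> vz';
      apply: (common P).
    by have [_ ->] := point_unitE hF Px Az' nz'; rewrite addr0.
  have vy := val_y_infinity hF two_neq0 d2 sf fsep nx.
  have vA : vge P (- d%:Z) (ev A).
    have [->|A0] := eqVneq A 0; first by rewrite ev0 vge0.
    have eA0 : ev A != 0 by rewrite (ev_eq0 hF).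
    rewrite vgeE // (val_ev_infinity hF two_neq0 d2 sf fsep nx) // lerN2 lez_nat.
    by move: sA; case: (size A).
  have vy' : vge P (- d%:Z) y by rewrite vgeE // vy.
  have vz : - d%:Z <= P z by rewrite -vgeE // vgeB.
  have vz' : - d%:Z <= P z' by rewrite -vgeE // vgeD.
  (* Otherwise [2 y = z + z'] would have order greater than [- d]. In the second case [P z] is
     [2 P (ev B) + d], and adding [d - 2] again gives an even number. *)
  have : P z = - d%:Z \/ P z' = - d%:Z.
    apply: contrapT => /not_orP[n1 n2].
    have : vge P (1 - d%:Z) (2 * y).
      have -> : 2 * y = z + z' by rewrite /z /z'; ring.
      have lt (m : int) : - d%:Z <= m -> m <> - d%:Z -> 1 - d%:Z <= m by clear; lia.
      by rewrite vgeD // vgeE //; apply: lt.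
    by rewrite vgeE ?mulf_neq0 // dvM // v2 vy; clear; lia.
  have := vzz' P; move: (P z) (P z') (P (ev B)) od d2 => m1 m2 m3 od d2' E H.
  rewrite mulr1 mulr2n in E *.
  have Ed : d = (d./2.*2).+1 by rewrite -[LHS]odd_double_half od.
  by clear - E H Ed d2'; case: H => H; [exists (-1) | exists (m3 + d%:Z - 1)];
    rewrite mulr2n; lia.
have [D HD] := choice even_z.
(* At a finite point where [B] does not vanish, the orders of [z] and [z'] are nonnegative with sum
   0, so [D] is supported at infinity and at the zeros of [B]. *)
have finD : finite_set [set P : closed_point iota | D P != 0].
  have fin1 := finite_infinity hF two_neq0 d2 sf fsep.
  have fin2 := finite_zeros_ev hF two_neq0 sqf B0.
  apply: sub_finite_set (_ : finite_set (_ `|` _)%classic); last by rewrite finite_setU;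
    split; [exact: fin1 | exact: fin2].
  move=> P /= DP; have [Px|] := boolP (vge P 0 x); last by left.
  right; split=> //; apply: contraNT DP => nB;
    have [_ vB] := point_unitE hF Px (inA_ev _ _ _ _) (negP nB).
  have := HD P; rewrite /infinity_mult Px mulr0 addr0.
  have := vzz' P; rewrite vB.
  have vz := vge_inA hF Px Az; have vz' := vge_inA hF Px Az'.
  rewrite !vgeE // in vz vz'; rewrite !mulr2n; move: (P z) (P z') (D P) vz vz'; clear; lia.
exists (Divisor finD); exists W0; first exact: canonical_divP.
by exists z => // P; rewrite /= -HD addrK.
Qed.

(** From [2 D - W = div z] and [W = W0 + div t] follows [div (t z) + W0 = 2 D]. Multiplying by the
    square of a denominator moves [t z] into the coordinate ring without changing parities. *)
Lemma theta_parity : has_rational_theta_characteristic iota dF ->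
  exists a b, cv a b != 0 /\
    forall P, exists m, P (cv a b) + (d - 2)%:Z * inf_mult P = m *+ 2.
Proof.
move=> [D [W canW [z z0 HD]]].
have [t t0 HW] := canonical_div_unique hF two_neq0 d2 sf fsep hd canW.
have tz0 : t * z != 0 by rewrite mulf_neq0.
have [u [w [Au Aw w0 Dtz]]] := inA_frac hF (t * z).
have [a [b Dab]] : inA (t * z * w ^+ 2).
  have -> : t * z * w ^+ 2 = u * w by rewrite Dtz; field.
  exact: (inA_M hF).
exists a, b; rewrite -Dab; split; first by rewrite mulf_neq0 ?expf_neq0.
move=> P; exists (D P + P w); rewrite dvM ?expf_neq0 // dvM // dvX.
have := HD P; rewrite HW !mulr2n.
by move: (D P) (P w) (P z) (P t) (_ * _ : int); clear; lia.
Qed.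

(* Compares the orders of [a + b y] at the two points above [q] exchanged by
   [y |-> -y]; at a point above an inert [q] the order of the norm is even. *)
Lemma norm_parity a b q (n : nat) N0 : cv a b != 0 ->
  (forall P, vge P 0 x -> exists m, P (cv a b) = m *+ 2) ->
  irreducible_poly q -> a ^+ 2 - b ^+ 2 * f = q ^+ n * N0 -> ~~ (q %| N0) -> ~~ odd n.
Proof.
move=> ab0 par irr_q DN nqN0.
have [|j [a1 [b1 [Da Db nq]]]] := @primitive_pair_exists _ q a b irr_q.
  by apply: contraNT ab0; rewrite negb_or !negbK => /andP[/eqP-> /eqP->]; rewrite cv0 ev0.
set N1 := a1 ^+ 2 - b1 ^+ 2 * f.
have DN1 : a ^+ 2 - b ^+ 2 * f = q ^+ j.*2 * N1.
  by rewrite /N1 Da Db -muln2 exprM; ring.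
have Dcv : cv a b = ev q ^+ j * cv a1 b1 by rewrite !cvE Da Db !evM !evXn; ring.
have ab10 : cv a1 b1 != 0 by apply: contra_neq ab0 => E; rewrite Dcv E mulr0.
have N10 : N1 != 0 by exact: (norm_neq0 hF).
have q0 : ev q != 0 by rewrite (ev_eq0 hF) irredp_neq0.
have [n1 [N2 [DN2 nqN2]]] := irredp_val_exists irr_q N10.
have Dn : n = (j.*2 + n1)%N.
  apply: (irredp_val_unique irr_q nqN0 nqN2).
  by rewrite -DN DN1 DN2 exprD mulrA.
rewrite Dn oddD odd_double /=.
case: n1 DN2 {Dn} => // n1 DN2; have qN1 : q %| N1 by rewrite DN2 exprS -mulrA dvdp_mulr.
have nqb1 : ~~ (q %| b1).
  apply: contra nq => qb1; rewrite qb1 andbT; apply: (@irredp_dvdp_exp _ _ _ 2) => //.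
  by move: qN1; rewrite dvdp_subl // dvdp_mulr // expr2 dvdp_mulr.
have [r [qr qabr]] := sqrt_mod_exists irr_q nqb1 qN1.
have [P [Px HP]] := point_split hF two_neq0 irr_q (sqf irr_q) qr.
have evq R (HR : forall a b,
  vge R 1 (cv a b) <-> q %| a + b * r) a2 : vge R 1 (ev a2) <-> q %| a2.
  by have := HR a2 0; rewrite cv0 mul0r addr0.
have Pq : vge P 1 (ev q) by apply/(evq P).
have P1 : vge P 1 (cv a1 b1) by apply/HP.
have [m Hm] := par P Px.
(* If [q] ramifies, [a1] has order at least 2 at [P] and [b1 y] has order 1, so [a1 + b1 y] has
   order 1; as [q] has order 2, this contradicts evenness. *)
have [qf|nqf] := boolP (q %| f).
  have qr' : q %| r.
    by apply: (@irredp_dvdp_exp _ _ _ 2) => //; move: qr; rewrite dvdp_subr.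
  have [a2 Da2] : exists a2 : {poly K}, a1 = a2 * q.
    by apply: dvdp_mulE; move: qabr; rewrite dvdp_addl // dvdp_mull.
  have Py := point_ramified hF two_neq0 irr_q (sqf irr_q) Px Pq qf.
  have y0 := hyper_y_neq0 hF f0.
  have b10 : ev b1 != 0 by rewrite (ev_eq0 hF); apply: contraNneq nqb1 => ->; rewrite dvdp0.
  have [f1 Df1] := dvdp_mulE qf.
  have nf1 : ~~ (q %| f1).
    by apply: contra (sqf irr_q) => qf1; rewrite Df1 expr2 dvdp_mul.
  have unitP a3 : ~~ (q %| a3) -> ev a3 != 0 /\ P (ev a3) = 0.
    move=> nq3; apply: (point_unitE hF Px (inA_ev _ _ _ _)).
    by move/evq => /(_ HP); apply/negP.
  have vq : P (ev q) = 2.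
    have := congr1 P (ysqr hF);
      rewrite dvX Py Df1 evM dvM // ?(unitP f1 nf1).2 ?(unitP f1 nf1).1 //.
    by rewrite add0r.
  have vb1y : P (ev b1 * y) = 1 by rewrite dvM // (unitP b1 nqb1).2 add0r.
  have va1 : vge P 2 (ev a1).
    by rewrite Da2 evM vgeMl ?vge_ev // vgeE // vq.
  have vz1 : P (cv a1 b1) = 1.
    apply/eqP; rewrite eq_le -[1 <= _](vgeE P 1 ab10) P1 andbT leNgt; apply/negP => lt.
    have : vge P 2 (ev b1 * y).
      have -> : ev b1 * y = cv a1 b1 - ev a1 by rewrite cvE addrC addKr.
      by rewrite vgeB // vgeE.
    by rewrite vgeE ?mulf_neq0 // vb1y.
  move: Hm; rewrite Dcv dvM ?expf_neq0 // dvX vq vz1 !mulr2n -mulr_natr; clear; lia.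
have nqr : ~~ (q %| r).
  apply: contra nqf => qr'; move: qr; rewrite dvdp_subl //.
  by rewrite expr2 dvdp_mulr.
have nconj : ~~ (q %| a1 - b1 * r).
  apply/negP => qc; have qa1 : q %| a1.
    have : q %| 2%:P * a1.
      have -> : 2%:P * a1 = (a1 + b1 * r) + (a1 - b1 * r) by rewrite polyC_natr; ring.
      exact: dvdp_add.
    by rewrite irredp_dvdp_mul // irredp_dvdp_polyC // (negPf two_neq0).
  by move: qabr; rewrite dvdp_addr // irredp_dvdp_mul // (negPf nqb1) (negPf nqr).
have vq := point_unramified hF two_neq0 irr_q (sqf irr_q) Px Pq nqf.
have unitcv (R : closed_point iota) a3 b3 : vge R 0 x -> ~ vge R 1 (cv a3 b3) ->
    cv a3 b3 != 0 /\ R (cv a3 b3) = 0.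
  by move=> Rx; apply: (point_unitE hF Rx (inA_cv _ _ _ _ _)).
have [c10 vc1] : cv a1 (- b1) != 0 /\ P (cv a1 (- b1)) = 0.
  by apply: unitcv => // /HP; rewrite mulNr; apply/negP.
have [N20 vN2] : ev N2 != 0 /\ P (ev N2) = 0.
  by apply: (point_unitE hF Px (inA_ev _ _ _ _)) => /(evq P HP); apply/negP.
have vz1 : P (cv a1 b1) = n1.+1%:Z.
  have := congr1 P (cv_norm hF a1 b1); rewrite dvM // vc1 addr0 -/N1 DN2 evM evXn.
  by rewrite dvM ?expf_neq0 // vN2 addr0 dvX vq natz.
(* At the conjugate point [Q] the order of [a + b y] is [j], against [j + n1 + 1] at [P]; both are
   even, so [n1 + 1] is. *)
have qr' : q %| f - (- r) ^+ 2 by rewrite sqrrN.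
have [Q [Qx HQ]] := point_split hF two_neq0 irr_q (sqf irr_q) qr'.
have Qq : vge Q 1 (ev q) by rewrite -cv0; apply/HQ; rewrite mul0r addr0.
have [m' Hm'] := par Q Qx.
have wq := point_unramified hF two_neq0 irr_q (sqf irr_q) Qx Qq nqf.
have [_ wz1] : cv a1 b1 != 0 /\ Q (cv a1 b1) = 0.
  by apply: unitcv => // /HQ; rewrite mulrN; apply/negP.
move: Hm Hm'; rewrite Dcv !dvM ?expf_neq0 // !dvX vq wq vz1 wz1 !natz !mulr2n; clear; lia.
Qed.

(* With [z = a + b y] and [a^2 - b^2 f = c r^2]: if [c] is not a square, then
   [f] is a value of [X^2 - c Y^2] over [K(x)]. If [c r^2 = r'^2], then
   [2 (a + r') z = (a + r' + b y)^2], so that [2 (a + r')] has odd degree and even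
   order at all finite points, which needs an odd degree factor of [f]. *)
Lemma decomp_of_theta : odd d ->
  (forall q, irreducible_poly q -> q %| f -> odd (size q)) ->
  has_rational_theta_characteristic iota dF ->
  exists (c : K) A B, (forall e, c != e ^+ 2) /\ f = A ^+ 2 - c *: B ^+ 2.
Proof.
move=> od evf /theta_parity[a [b [ab0 par]]].
have N0 := norm_neq0 hF ab0.
have [c [r DN]] : exists (c : K) (r : {poly K}), a ^+ 2 - b ^+ 2 * f = c *: r ^+ 2.
  apply: even_vals_square => // q n N1 irr_q DN nq.
  apply: (norm_parity ab0 _ irr_q DN nq) => P Px.
  by have [m] := par P; rewrite /infinity_mult Px mulr0 addr0; exists m.
have [[e De]|nsq] := pselect (exists e, c = e ^+ 2); last first.
  have {}nsq e : c != e ^+ 2 by apply/eqP => De; apply: nsq; exists e.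
  have b0 : b != 0.
    apply: contra_neq N0 => b0; move: DN; rewrite b0 expr0n mul0r subr0.
    by move/(sum_squares_anisotropic nsq) => [-> _]; rewrite expr0n.
  have [|A [B DAB]] := @cassels_pfister _ c f a r b nsq b0.
    by rewrite -DN; ring.
  by exists c, A, B.
(* The sign of the square root is free, and [a + r'] cannot vanish for both signs, since the norm
   [r' ^+ 2] is nonzero. *)
have {c DN De} [r' DN nz] : exists2 r', a ^+ 2 - b ^+ 2 * f = r' ^+ 2 & a + r' != 0.
  have DN' : a ^+ 2 - b ^+ 2 * f = (e *: r) ^+ 2 by rewrite DN De exprZn.
  have [ar|] := eqVneq (a + e *: r) 0; last by exists (e *: r).
  exists (- (e *: r)); first by rewrite sqrrN.
  apply: contra_neq N0 => ar'; rewrite DN'.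
  have : 2%:P * (e *: r) = 0.
    have -> : 2%:P * (e *: r) = (a + e *: r) - (a - e *: r) by rewrite polyC_natr; ring.
    by rewrite ar ar' subr0.
  by move/eqP; rewrite mulf_eq0 polyC_eq0 (negPf two_neq0) /= => /eqP->; rewrite expr0n.
pose rho := 2%:P * (a + r').
have rho0 : rho != 0 by rewrite mulf_neq0 // polyC_eq0.
have Esq : cv (a + r') b ^+ 2 = ev rho * cv a b.
  have : ev (b ^+ 2 * f) = ev (a ^+ 2 - r' ^+ 2) by rewrite -DN; congr ev; ring.
  rewrite evM evXn -(ysqr hF) evB !evXn => E.
  rewrite /rho !cvE !evM evC rmorph_nat !evD.
  have -> : (ev a + ev r' + ev b * y) ^+ 2
    = (ev a + ev r') ^+ 2 + 2 * (ev a + ev r') * (ev b * y) + ev b ^+ 2 * y ^+ 2 by ring.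
  by rewrite E; ring.
have erho0 : ev rho != 0 by rewrite (ev_eq0 hF).
have par_rho P : exists m, P (ev rho) + (d - 2)%:Z * inf_mult P = m *+ 2.
  have [m Hm] := par P; have := congr1 P Esq; rewrite dvX dvM // => E.
  exists (P (cv (a + r') b) - P (cv a b) + m); move: E Hm; rewrite !mulr2n.
  by move: (P _) (P _) (P _) (_ * _ : int); clear; lia.
(* That is, [rho] has odd degree: its order at infinity is minus its degree and must have the parity
   of [d - 2]. *)
have even_rho : ~~ odd (size rho).
  have [P nx] := infinity_exists hF two_neq0 d2 sf fsep.
  have [m] := par_rho P;
    rewrite (val_ev_infinity hF two_neq0 d2 sf fsep nx) // /infinity_mult (negPf nx).
  have : (0 < size rho)%N by rewrite size_poly_gt0.
  rewrite mulr2n mulr1; move: od d2 (size rho) => od d2' n n_gt0 E.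
  have Ed : d = (d./2.*2).+1 by rewrite -[LHS]odd_double_half od.
  apply/negP => on; have En : n = (n./2.*2).+1 by rewrite -[LHS]odd_double_half on.
  clear - E Ed En n_gt0 d2'; lia.
have [q [n [e1 [irr_q eq_ Drho nq on]]]] := odd_degree_factor rho0 even_rho.
have nqf : ~~ (q %| f) by apply: contra eq_ => /evf; apply.
have [P [Px Pq]] := point_exists hF two_neq0 irr_q (sqf irr_q).
have vq := point_unramified hF two_neq0 irr_q (sqf irr_q) Px Pq nqf.
have [e10 ve1] : ev e1 != 0 /\ P (ev e1) = 0.
  apply: (point_unitE hF Px (inA_ev _ _ _ _)).
  by move/(prime_evE irr_q (prime_of_point hF Px Pq)); apply/negP.
have q0 : ev q != 0 by rewrite (ev_eq0 hF) irredp_neq0.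
have [m] := par_rho P; rewrite /infinity_mult Px Drho evM evXn dvM ?expf_neq0 // dvX vq ve1.
rewrite mulr2n natz mulr0 !addr0 => E.
have En : n = (n./2.*2).+1 by rewrite -[LHS]odd_double_half on.
clear - E En; lia.
Qed.

End Theta.

(** * Completeness and residue field of a local field *)

Definition dv_complete (F : fieldType) (v : dvaluation F) : Prop :=
  forall u : nat -> F, cauchy_seq v u -> exists l, converges_to v u l.

Section Sequences.
Variables (F : fieldType) (v : dvaluation F).
Implicit Types (u w : nat -> F) (a b l : F).

Lemma vge_all_eq0 a : (forall N : int, vge v N a) -> a = 0.
Proof.
move=> va; apply/eqP; apply: contrapT => /negP a0.
by have := va (v a + 1); rewrite vgeE // gerDl.
Qed.

Lemma cauchy_sub u w : cauchy_seq v u -> cauchy_seq v w ->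
  cauchy_seq v (fun n => u n - w n).
Proof.
move=> cu cw N; have [M1 H1] := cu N; have [M2 H2] := cw N.
exists (maxn M1 M2) => m n; rewrite !geq_max => /andP[m1 m2] /andP[n1 n2].
have -> : u m - w m - (u n - w n) = (u m - u n) - (w m - w n) by ring.
by rewrite vgeB ?H1 ?H2.
Qed.

Lemma converges_cauchy u l : converges_to v u l -> cauchy_seq v u.
Proof.
move=> cu N; have [M HM] := cu N; exists M => m n mM nM.
have -> : u m - u n = (u m - l) - (u n - l) by ring.
by rewrite vgeB ?HM.
Qed.

Lemma converges_add u w l l' : converges_to v u l -> converges_to v w l' ->
  converges_to v (fun n => u n + w n) (l + l').
Proof.
move=> cu cw N; have [M1 H1] := cu N; have [M2 H2] := cw N.
exists (maxn M1 M2) => n; rewrite geq_max => /andP[n1 n2].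
have -> : u n + w n - (l + l') = (u n - l) + (w n - l') by ring.
by rewrite vgeD ?H1 ?H2.
Qed.

Lemma converges_mulr u l b : converges_to v u l -> converges_to v (fun n =>
  u n * b) (l * b).
Proof.
move=> cu N; have [->|b0] := eqVneq b 0.
  by exists 0%N => n _; rewrite !mulr0 subrr vge0.
have [M HM] := cu (N - v b); exists M => n nM.
by rewrite -mulrBl -[N](subrK (v b)) vge_dvM // HM.
Qed.

Lemma converges_ext u w l : u =1 w -> converges_to v u l -> converges_to v w l.
Proof. by move=> uw cu N; have [M HM] := cu N; exists M => n /HM; rewrite uw. Qed.

Lemma cauchy_ext u w : u =1 w -> cauchy_seq v u -> cauchy_seq v w.
Proof. by move=> uw cu N; have [M HM] := cu N; exists M => m n mM nM; rewrite -!uw HM. Qed.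

End Sequences.

Section Laurent.
Variables (F : fieldType) (v : dvaluation F) (k0 : fieldType) (coef : F -> int -> k0).
Hypothesis coef_lead : forall a : F, a != 0 ->
  coef a (v a) != 0 /\ (forall i : int, i < v a -> coef a i = 0).
Hypothesis coef_surj : forall c : int -> k0,
  (exists N : int, forall i : int, i < N -> c i = 0) ->
  exists a : F, forall i : int, coef a i = c i.
Hypothesis coefD : forall (a b : F) (i : int), coef (a + b) i = coef a i + coef b i.

Lemma laurent_coef0 i : coef 0 i = 0.
Proof. by apply: (addrI (coef 0 i)); rewrite -coefD !addr0. Qed.

Lemma laurent_coefB a b i : coef (a - b) i = coef a i - coef b i.
Proof. by apply: (addIr (coef b i)); rewrite -coefD !subrK. Qed.

Lemma laurent_vge n a : vge v n a <-> forall i, i < n -> coef a i = 0.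
Proof.
have [->|a0] := eqVneq a 0.
  by rewrite vge0; split=> // _ i _; rewrite laurent_coef0.
rewrite vgeE //; have [lead low] := coef_lead a0; split=> [na i lt|H].
  by rewrite low // (lt_le_trans lt).
by rewrite leNgt; apply/negP => /H; apply/eqP.
Qed.

Lemma laurent_complete_aux : dv_complete v.
Proof.
move=> u cu; have [M HM] := choice cu.
have agree N m n i : (M N <= m)%N -> (M N <= n)%N -> i < N -> coef (u m) i = coef (u n) i.
  move=> mM nM lt; have /laurent_vge/(_ _ lt) := HM N m n mM nM.
  by rewrite laurent_coefB => /eqP; rewrite subr_eq0 => /eqP.
(* Terms that differ by order at least [i + 1] share the coefficient of [T^i], so it is constant
   from this index on. *)
pose M1 (i : int) := M (i + 1); pose c (i : int) := coef (u (M1 i)) i.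
have cE (i : int) (m : nat) : (M1 i <= m)%N -> coef (u m) i = c i.
  by move=> mM; apply: (agree (i + 1)) => //; rewrite ltrDl.
have [|l Hl] := coef_surj (c := c).
  (* In negative degrees all terms from index [M 0] on agree with [u (M 0)], which bounds the
     support of the limit from below. *)
  have [B HB] : exists B : int, forall i, i < B -> coef (u (M 0)) i = 0.
    have [a0|a0] := eqVneq (u (M 0)) 0; first by exists 0 => i _; rewrite a0 laurent_coef0.
    by exists (v (u (M 0))); case: (coef_lead a0).
  exists (Num.min 0 B) => i; rewrite lt_min => /andP[i0 iB].
  rewrite -(cE i (maxn (M1 i) (M 0))) ?leq_maxl //.
  by rewrite (agree 0 _ (M 0)) ?leq_maxr // HB.
exists l => N; exists (M N) => n nM; apply/laurent_vge => i iN.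
rewrite laurent_coefB Hl -(cE i (maxn n (M1 i))) ?leq_maxr //.
by rewrite (agree N n (maxn n (M1 i))) ?subrr // (leq_trans nM) ?leq_maxl.
Qed.

End Laurent.

Lemma laurent_complete (F : fieldType) (v : dvaluation F) (k0 : fieldType) :
  laurent_series v k0 -> dv_complete v.
Proof. by move=> [coef [H1 H2 H3 _]]; apply: (laurent_complete_aux H1 H2 H3). Qed.

Section FiniteExtension.
Variables (K0 K : fieldType) (v0 : dvaluation K0) (v : dvaluation K).
Variables (j : {rmorphism K0 -> K}) (e : nat).
Hypotheses (e0 : (0 < e)%N) (vj : forall a, v (j a) = v0 a *+ e).

Lemma vge_ext (n : int) a : vge v (n *+ e) (j a) = vge v0 n a.
Proof.
have [->|a0] := eqVneq a 0; first by rewrite rmorph0 !vge0.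
by rewrite !vgeE ?fmorph_eq0 // vj lerMn2r gtn_eqF.
Qed.

(** Spans over [K0] by recursion on the generators, so that completeness can be proved one vector at
    a time. *)
Fixpoint in_span (s : seq K) (z : K) : Prop :=
  if s is b :: s' then exists c w, in_span s' w /\ z = j c * b + w else z = 0.

Lemma in_span0 s : in_span s 0.
Proof. by elim: s => //= b s IHs; exists 0, 0; rewrite rmorph0 mul0r addr0. Qed.

Lemma in_span_lin s c z w : in_span s z -> in_span s w -> in_span s (j c * z + w).
Proof.
elim: s z w => [|b s IHs] z w /=; first by move=> -> ->; rewrite mulr0 addr0.
move=> [c1 [z1 [sz ->]]] [c2 [w2 [sw ->]]]; exists (c * c1 + c2), (j c * z1 + w2).
by split; [exact: IHs | rewrite rmorphD rmorphM; ring].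
Qed.

Lemma in_span_sub s z w : in_span s z -> in_span s w -> in_span s (z - w).
Proof.
move=> sz sw; have := in_span_lin (- 1) sw sz.
by rewrite rmorphN rmorph1 mulN1r addrC.
Qed.

(* A vector [b] outside the span [W] of [s], complete by induction, is at positive
   distance from [W]; this bounds the [b]-coordinate by the norm. *)
Lemma in_span_complete s : dv_complete v0 -> forall u, cauchy_seq v u ->
  (forall n, in_span s (u n)) -> exists2 l, in_span s l & converges_to v u l.
Proof.
move=> comp0; elim: s => [|b s IHs] u cu su.
  by exists 0 => // N; exists 0%N => n _; rewrite (su n) subrr vge0.
have [sb|nsb] := pselect (in_span s b).
  have [|l sl cl] := IHs u cu.
    by move=> n; have [c [w [sw ->]]] := su n; apply: in_span_lin.
  by exists l => //=; exists 0, l; rewrite rmorph0 mul0r add0r.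
(* Otherwise elements of the span would converge to [- b], and its completeness would put [b] in
   it. *)
have [N HN] : exists N : int, forall w, in_span s w -> ~~ vge v N (b + w).
  apply: contrapT => nN; apply: nsb.
  have : forall n : nat, exists w, in_span s w /\ vge v n%:Z (b + w).
    move=> n; apply: contrapT => nw; apply: nN; exists n%:Z => w sw.
    by apply/negP => vw; apply: nw; exists w.
  move=> /choice[w Hw].
  have conv : converges_to v w (- b).
    move=> N; exists `|N|%N => n nN'; rewrite opprK addrC.
    by have [_] := Hw n; apply: vge_le; lia.
  have [|l sl cl] := IHs w (converges_cauchy conv); first by move=> n; case: (Hw n).
  suff -> : b = 0 - l by apply: in_span_sub => //; exact: in_span0.
  apply/eqP; rewrite -subr_eq0 sub0r opprK; apply/eqP/(@vge_all_eq0 _ v) => N.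
  have [M1 H1] := conv N; have [M2 H2] := cl N.
  have -> : b + l = (w (maxn M1 M2) - - b) - (w (maxn M1 M2) - l) by ring.
  by rewrite vgeB ?H1 ?H2 ?leq_maxl ?leq_maxr.
have bound m c w : in_span s w -> vge v m (j c * b + w) -> vge v (m - N) (j c).
  move=> sw; have [->|c0] := eqVneq c 0; first by rewrite rmorph0 vge0.
  have jc0 : j c != 0 by rewrite fmorph_eq0.
  have sw' : in_span s (j c^-1 * w + 0) by apply: in_span_lin => //; exact: in_span0.
  have /vge_neg[x0 vx] := HN _ sw'.
  have -> : j c * b + w = j c * (b + (j c^-1 * w + 0)) by rewrite fmorphV; field.
  by rewrite !vgeE ?mulf_neq0 // dvM //; lia.
have /choice[cw Hcw] : forall n, exists cw : K0 * K,
  in_span s cw.2 /\ u n = j cw.1 * b + cw.2.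
  by move=> n; have [c [w H]] := su n; exists (c, w).
have cc : cauchy_seq v0 (fun n => (cw n).1).
  move=> N0; have [M HM] := cu (N0 *+ e + N); exists M => m n mM nM.
  rewrite -vge_ext -[_ *+ e](addrK N).
  apply: (bound _ _ ((cw m).2 - (cw n).2)).
    by apply: in_span_sub; [case: (Hcw m) | case: (Hcw n)].
  have := HM m n mM nM; rewrite (Hcw m).2 (Hcw n).2; congr vge.
  by rewrite rmorphB; ring.
have [c0 cv0] := comp0 _ cc.
have cj : converges_to v (fun n => j (cw n).1) (j c0).
  move=> N0; have [M HM] := cv0 `|N0|%:Z; exists M => n nM.
  have := HM n nM; rewrite -vge_ext rmorphB; apply: vge_le.
  by rewrite -mulr_natr; nia.
have cjb := converges_mulr b cj.
have [||l sl cl] := IHs (fun n => (cw n).2).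
- apply: (cauchy_ext _ (cauchy_sub cu (converges_cauchy cjb))) => n.
  by rewrite (Hcw n).2 addrC addKr.
- by move=> n; case: (Hcw n).
exists (j c0 * b + l); first by exists c0, l.
apply: (converges_ext _ (converges_add cjb cl)) => n.
by rewrite (Hcw n).2.
Qed.

Lemma in_span_sum (I : Type) (r : seq I) (b : I -> K) (c : I -> K0) :
  in_span [seq b i | i <- r] (\sum_(i <- r) j (c i) * b i).
Proof.
elim: r => [|i r IHr] /=; first by rewrite big_nil.
by exists (c i), (\sum_(i <- r) j (c i) * b i); rewrite big_cons.
Qed.

Lemma finite_extension_complete : finite_extension j -> dv_complete v0 -> dv_complete v.
Proof.
move=> [n [b gen]] comp0 u cu.
have [|l _ cl] := @in_span_complete [seq b i | i <- enum 'I_n] comp0 u cu; last by exists l.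
by move=> m; have [c ->] := gen (u m); rewrite -big_enum; apply: in_span_sum.
Qed.

End FiniteExtension.

Lemma local_field_complete (p : nat) (K : fieldType) (v : dvaluation K) :
  local_field p v -> dv_complete v.
Proof.
move=> [_ [K0 [v0 [j [base ext [e e0 vj]]]]]].
apply: (finite_extension_complete e0 vj ext).
by case: base => [[_ _ _]|[k0 _]] //; exact: laurent_complete.
Qed.

(** * Finiteness of the residue field *)

Section FiniteResidue.

(** Finiteness of the residue field through representatives in [F], as the base field comes without
    a chosen residue map. *)
Definition finite_residue (F : fieldType) (v : dvaluation F) : Prop :=
  exists S : seq F, forall a, vge v 0 a ->
    exists s, [/\ s \in S, vge v 0 s & vge v 1 (a - s)].

Lemma laurent_finite_residue (F : fieldType) (v : dvaluation F) (k0 : finFieldType) :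
  laurent_series v k0 -> finite_residue v.
Proof.
move=> [coef [H1 H2 H3 _]].
have : forall c : k0, exists a, forall i, coef a i = if i == 0 then c else 0.
  move=> c; apply: (H2 (fun i => if i == 0 then c else 0)).
  by exists 0 => i i0; rewrite lt_eqF.
move=> /choice[s Hs]; exists [seq s c | c <- enum k0] => a va.
exists (s (coef a 0)); split.
- by apply: map_f; rewrite mem_enum.
- by apply/(laurent_vge H1 H3) => i i0; rewrite Hs lt_eqF.
- apply/(laurent_vge H1 H3) => i i1; rewrite (laurent_coefB H3) Hs.
  case: eqP => [->|/eqP i0]; first by rewrite subrr.
  rewrite subr0; move/(laurent_vge H1 H3): va; apply; lia.
Qed.

(** An integral element is close to a rational number, which is integral too. Its denominator is
    therefore prime to [p], and it is congruent to an integer between 0 and [p - 1]. *)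
Lemma padic_finite_residue (F : fieldType) (v : dvaluation F) (p : nat) : prime p ->
  padic_numbers v p -> finite_residue v.
Proof.
move=> pr_p [char0 vn dense _]; have p_gt0 := prime_gt0 pr_p.
have vnat (n : nat) : vge v 0 (n%:R).
  by rewrite /vge; case: n => [|n]; rewrite ?eqxx // vn // orbT.
have vint (t : int) : vge v 0 (t%:~R).
  by case: t => n; rewrite ?NegzE ?rmorphN ?vgeN; apply: vnat.
have int_abs (N : int) (t : int) : vge v N (t%:~R) = vge v N (`|t|%N%:R).
  by case: t => n; rewrite ?NegzE ?rmorphN ?vgeN ?abszN.
have vp : vge v 1 p%:R by rewrite /vge vn // (logn_prime p pr_p) eqxx orbT.
have vdvd (t : int) : (p %| t)%Z -> vge v 1 (t%:~R).
  by move=> /dvdzP[t' ->]; rewrite intrM -[1]add0r; exact: (vgeM (vint t') vp).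
have vndvd (t : int) : vge v 1 (t%:~R) -> (p %| t)%Z.
  rewrite int_abs dvdzE absz_nat; case: (`|t|)%N => [|n]; first by rewrite dvdn0.
  rewrite /vge vn // => /orP[|]; last first.
    by apply: contraTT => npn; rewrite logn_coprime // prime_coprime.
  by rewrite (pcharf0P _).1 //=.
exists [seq i%:R | i <- iota 0 p] => a va.
have [q Hq] := dense a 1.
have vq : vge v 0 (ratr q).
  have -> : ratr q = a - (a - ratr q) by rewrite opprB addrC subrK.
  by rewrite vgeB // (vge_le _ Hq).
have Eq : ratr q * (denq q)%:~R = (numq q)%:~R :> F.
  rewrite /ratr divfK //; apply: contraNneq (denq_neq0 q) => d0.
  have : (denq q)%:~R == 0 :> F by rewrite d0.
  have := denq_gt0 q; case: (denq q) => // n _; rewrite -[n%:~R]/(n%:R).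
  by rewrite (pcharf0P _).1.
have npd : ~~ (p %| denq q)%Z.
  apply/negP => pd; have /vndvd pn : vge v 1 (numq q)%:~R.
    by rewrite -Eq vgeMl // vdvd.
  have : (p %| gcdn `|numq q| `|denq q|)%N by rewrite dvdn_gcd; apply/andP; split.
  have := coprime_num_den q; rewrite /coprime => /eqP->.
  by rewrite dvdn1 => /eqP p1; move: pr_p; rewrite p1.
have cop : gcdz (denq q) p = 1.
  by rewrite /gcdz gcdnC; congr Posz; apply/eqP;
    rewrite -/(coprime _ _) absz_nat prime_coprime.
(* [s] inverts the denominator modulo [p]; the residue is the numerator times [s]. *)
have [s [t Est]] := Bezoutz (denq q) p; rewrite cop in Est.
pose m := (numq q * s %% p)%Z.
have m0 : 0 <= m by rewrite modz_ge0 // -lt0n.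
have mp : m < p by rewrite ltz_pmod.
exists `|m|%N%:R; split=> //.
  by apply/mapP; exists `|m|%N => //; rewrite mem_iota add0n; lia.
have -> : `|m|%N%:R = m%:~R :> F by case: (m) m0.
have -> : a - m%:~R = (a - ratr q) + (ratr q - m%:~R) by ring.
rewrite vgeD //; have := vdvd (numq q - m * denq q).
have -> : (p %| numq q - m * denq q)%Z.
  have Em : m = numq q * s - (numq q * s %/ p)%Z * p.
    by apply/esym/eqP; rewrite subr_eq addrC; apply/eqP; exact: divz_eq.
  have -> : numq q - m * denq q = (numq q * t + (numq q * s %/ p)%Z * denq q) * p.
    by rewrite Em -{1}[numq q]mulr1 -Est; ring.
  exact: dvdz_mull.
move=> /(_ isT); rewrite rmorphB rmorphM /= -Eq -mulrBl => /vge1_mul[||//|vd].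
- exact: vgeB.
- exact: vint.
by move: npd; rewrite vndvd.
Qed.

(* Lift [n + 1] residues, divide a linear relation between the lifts by its last
   coefficient of minimal valuation, and reduce: one of the residues is a
   combination of the previous ones with coefficients in the residue field of
   [K0]. *)
Lemma finite_residue_field (K0 K : fieldType) (v0 : dvaluation K0) (v : dvaluation K)
    (j : {rmorphism K0 -> K}) (e : nat) (k : fieldType)
    (red : {rmorphism vring v -> k}) :
  (0 < e)%N -> (forall a, v (j a) = v0 a *+ e) -> finite_extension j ->
  finite_residue v0 -> (forall c : k, exists a : vring v, red a = c) ->
  (forall a : vring v, vge v 1 (val a) -> red a = 0) ->
  exists l : seq k, forall c, c \in l.
Proof.
move=> e0 vj [n [b gen]] [S HS] surj red0.
apply: contrapT => infin.
have vge_j m a : vge v0 m a -> vge v (m *+ e) (j a) by rewrite (vge_ext e0 vj).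
have lift a : vge v0 0 a -> exists A : vring v, val A = j a.
  move=> va; have Ha : j a \in vint_pred v.
    rewrite unfold_in; have := vge_j 0 a va; rewrite mul0rn /vge => /orP[/eqP->|//].
    by rewrite dv0.
  by exists (VRing Ha).
(* A finite list containing the reductions of all integral elements of [K0]. *)
have [kap Hkap] : exists kap : seq k, forall (a : K0) (A : vring v),
    vge v0 0 a -> val A = j a -> red A \in kap.
  have /choice[r Hr] : forall s, exists c : k, forall A : vring v, val A = j s -> red A = c.
    move=> s; have [[A DA]|nA] := pselect (exists A : vring v, val A = j s).
      by exists (red A) => B DB; have -> : B = A by apply: val_inj; rewrite DA DB.
    by exists 0 => A DA; case: nA; exists A.
  exists [seq r s | s <- S] => a A va DA.
  have [s [Ss vs vas]] := HS a va; have [B DB] := lift s vs.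
  suff -> : red A = red B by rewrite (Hr s B DB) map_f.
  apply/eqP; rewrite -subr_eq0 -rmorphB; apply/eqP/red0.
  rewrite rmorphB /= DA DB -rmorphB; apply: vge_le (vge_j _ _ vas).
  by rewrite -mulr_natr mul1r; lia.
(* Combinations of [g 0, ..., g (m - 1)] with coefficients in [kap] are finite in number, so if [k]
   were infinite each new [g m] could avoid them. *)
pose comb (m : nat) (g : nat -> k) z := exists kp : nat -> k,
  (forall l, (l < m)%N -> kp l \in kap) /\ z = \sum_(l < m) kp l * g l.
have comb_fin m g : exists L : seq k, forall z, comb m g z -> z \in L.
  elim: m => [|m [L HL]].
    by exists [:: 0] => z [kp [_ ->]]; rewrite big_ord0 mem_head.
  exists [seq s + c * g m | s <- L, c <- kap] => z [kp [Hkp ->]].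
  rewrite big_ord_recr /=; apply: allpairs_f; last exact: Hkp.
  by apply: HL; exists kp; split=> // l lm; apply: Hkp; rewrite ltnW.
have [g Hg] : exists g : nat -> k, forall i, (i < n.+1)%N -> ~ comb i g (g i).
  elim: n.+1 => [|m [g Hg]]; first by exists (fun=> 0).
  have [L HL] := comb_fin m g.
  have [z nz] : exists z, z \notin L.
    by apply: contrapT => nz; apply: infin; exists L => c; apply: contrapT => /negP nc;
      apply: nz; exists c.
  exists (fun i => if (i < m)%N then g i else z) => i;
    rewrite ltnS leq_eqVlt => /predU1P[->|lt_im].
    rewrite ltnn => -[kp [Hkp Dz]]; move: nz; rewrite HL //; exists kp; split=> //.
    by rewrite Dz; apply: eq_bigr => l _; rewrite ltn_ord.
  rewrite lt_im => -[kp [Hkp Dz]]; apply: (Hg i lt_im); exists kp; split=> //.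
  by rewrite Dz; apply: eq_bigr => l _; rewrite (ltn_trans (ltn_ord l)).
have /choice[X HX] : forall i, exists A : vring v, red A = g i by move=> i; exact: surj.
have /choice[C HC] : forall i : 'I_n.+1, exists c : 'I_n -> K0,
    val (X i) = \sum_(l < n) j (c l) * b l by move=> i; exact: gen.
pose M : 'M[K0]_(n.+1, n) := \matrix_(i, l) C i l.
have ker0 : kermx M != 0.
  by rewrite kermx_eq0 /row_free neq_ltn (leq_ltn_trans (rank_leq_col M)).
pose c := nz_row (kermx M).
have c0 : c != 0 by rewrite nz_row_eq0.
have cM : c *m M = 0 by apply/sub_kermxP; exact: nz_row_sub.
have rel : \sum_i j (c 0 i) * val (X (nat_of_ord i)) = 0.
  under eq_bigr do rewrite HC mulr_sumr.
  rewrite exchange_big /= big1 // => l _.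
  transitivity (j ((c *m M) 0 l) * b l); last by rewrite cM mxE rmorph0 mul0r.
  rewrite mxE rmorph_sum mulr_suml; apply: eq_bigr => i _.
  by rewrite mxE rmorphM mulrA.
have [i0 ci0] : exists i, c 0 i != 0.
  apply: contrapT => nc; move/eqP: c0; apply; apply/rowP => i; rewrite mxE.
  by apply/eqP; apply: contrapT => /negP ci; apply: nc; exists i.
have [m Hm] : exists m : int, (exists2 i, c 0 i != 0 & v0 (c 0 i) = m) /\
    forall i, vge v0 m (c 0 i).
  have := @arg_minP _ int _ i0 (fun i => c 0 i != 0) (fun i => v0 (c 0 i)) ci0.
  case=> i ci Hi; exists (v0 (c 0 i)); split; first by exists i.
  by move=> l; rewrite /vge; case: eqP => //= /eqP; exact: Hi.
have [[i2 ci2 vi2] Hmin] := Hm.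
pose P i := (c 0 i != 0) && (v0 (c 0 i) == m).
have Pi2 : P i2 by rewrite /P ci2 vi2 eqxx.
case: (arg_maxnP (fun i : 'I_n.+1 => i : nat) Pi2) => i1 /andP[ci1 /eqP vi1] Hmax.
pose D i := - (c 0 i / c 0 i1).
have vD i : vge v0 0 (D i).
  by rewrite vgeN -(vge_dvM v0 _ _ ci1) divfK // add0r vi1.
have vD1 (i : 'I_n.+1) : (i1 < i)%N -> vge v0 1 (D i).
  move=> lt; rewrite vgeN -(vge_dvM v0 _ _ ci1) divfK // vi1.
  have [->|ci] := eqVneq (c 0 i) 0; first exact: vge0.
  have := Hmin i; rewrite !vgeE // le_eqVlt => /orP[/eqP Em|]; last by lia.
  by have := Hmax i; rewrite /P ci -Em eqxx => /(_ isT) /=; rewrite leqNgt lt.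
have /choice[A HA] : forall i, exists A : vring v, val A = j (D i) by move=> i; exact: lift.
have relX : X i1 = \sum_(i < n.+1 | i != i1) A i * X i.
  apply: val_inj; rewrite rmorph_sum.
  have jc0 : j (c 0 i1) != 0 by rewrite fmorph_eq0.
  apply: (mulfI jc0); move: rel; rewrite (bigD1 i1) // => /eqP.
  rewrite addr_eq0 => /eqP->; rewrite -sumrN mulr_sumr; apply: eq_bigr => i _.
  by rewrite rmorphM /= HA mulrA -rmorphM /D mulrN [c 0 i1 * _]mulrC divfK // rmorphN mulNr.
apply: (Hg i1); first exact: ltn_ord.
exists (fun l => red (A (inord l))); split.
  by move=> l _; apply: (Hkap (D (inord l))).
rewrite -[LHS]HX relX rmorph_sum /=.
rewrite (big_ord_widen n.+1 (fun l => red (A (inord l)) * g l)); last by rewrite ltnW.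
(* Coefficients after [i1] reduce to 0, since [i1] is the last index of minimal valuation. *)
rewrite (bigID (fun i : 'I_n.+1 => (i < i1)%N)) /= [X in _ + X]big1 ?addr0; last first.
  move=> i /andP[ne ge]; rewrite rmorphM (_ : red (A i) = 0) ?mul0r //.
  apply: red0; rewrite HA; apply: vge_le (vge_j _ _ (vD1 i _)).
    by rewrite -mulr_natr mul1r; lia.
  by move: ne; rewrite -val_eqE /=; lia.
apply: eq_big => [i|i _].
  by rewrite andbC -val_eqE /=; case: ltngtP.
by rewrite rmorphM HX inord_val.
Qed.

End FiniteResidue.

Lemma vring_lift (K : fieldType) (v : dvaluation K) (a : K) :
  vge v 0 a -> exists A : vring v, val A = a.
Proof.
move=> va; have Ha : a \in vint_pred v.
  by move: va; rewrite unfold_in /vge => /orP[/eqP->|//]; rewrite dv0.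
by exists (VRing Ha).
Qed.

Lemma vge_val (K : fieldType) (v : dvaluation K) (A : vring v) : vge v 0 (val A).
Proof. by rewrite /vge [0 <= _](valP A) orbT. Qed.

Lemma red_eq0 (K : fieldType) (v : dvaluation K) (pi : vring v) (k : fieldType)
    (red : {rmorphism vring v -> k}) (A : vring v) :
  v (val pi) = 1 -> residue_map pi red -> red A = 0 <-> vge v 1 (val A).
Proof.
move=> vpi [_ ker]; split=> [/ker[B ->]|vA].
  rewrite rmorphM /= -[1]addr0; apply: vgeM (vge_val B).
  by rewrite /vge vpi lexx orbT.
have pi0 : val pi != 0 by apply: contra_eqN vpi => /eqP->; rewrite dv0.
have [B DB] : exists B : vring v, val B = val A / val pi.
  by apply: vring_lift; rewrite -(vge_dvM v _ _ pi0) divfK // vpi add0r.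
apply/ker; exists B; apply: val_inj.
by rewrite rmorphM /= DB mulrC divfK.
Qed.

Lemma local_field_finite_residue (p : nat) (K : fieldType) (v : dvaluation K)
    (pi : vring v) (k : fieldType) (red : {rmorphism vring v -> k}) :
  local_field p v -> v (val pi) = 1 -> residue_map pi red ->
  exists l : seq k, forall c, c \in l.
Proof.
move=> [pr_p [K0 [v0 [j [base ext [e e0 vj]]]]]] vpi hred.
apply: (finite_residue_field e0 vj ext _ hred.1).
  by case: base => [|[k0 _]]; [exact: padic_finite_residue | exact: laurent_finite_residue].
by move=> a va; apply/(red_eq0 _ vpi hred).
Qed.

(** * Polynomials over the valuation ring *)

Section IntegralPolynomials.
Variables (K : fieldType) (v : dvaluation K) (pi : vring v).
Hypothesis vpi : v (val pi) = 1.
Variables (k : fieldType) (red : {rmorphism vring v -> k}).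
Hypothesis hred : residue_map pi red.
Notation O := (vring v).
Notation vp := (map_poly (val : O -> K)).
Notation rp := (map_poly red).
Implicit Types (P Q R : {poly O}).

Lemma vringM (a b : O) : val (a * b) = val a * val b. Proof. exact: rmorphM. Qed.
Lemma vringD (a b : O) : val (a + b) = val a + val b. Proof. exact: rmorphD. Qed.
Lemma vringB (a b : O) : val (a - b) = val a - val b. Proof. exact: rmorphB. Qed.
Lemma vringN (a : O) : val (- a) = - val a. Proof. exact: rmorphN. Qed.
Lemma vringXn (a : O) n : val (a ^+ n) = val a ^+ n. Proof. exact: rmorphXn. Qed.
Lemma vring0 : val (0 : O) = 0. Proof. exact: rmorph0. Qed.
Lemma vpM P Q : vp (P * Q) = vp P * vp Q. Proof. exact: rmorphM. Qed.
Lemma vpB P Q : vp (P - Q) = vp P - vp Q. Proof. exact: rmorphB. Qed.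
Lemma vpXn P n : vp (P ^+ n) = vp P ^+ n. Proof. exact: rmorphXn. Qed.
Lemma vp0 : vp 0 = 0. Proof. exact: rmorph0. Qed.
Lemma vpC (a : O) : vp a%:P = (val a)%:P. Proof. exact: map_polyC. Qed.
Lemma coef_vp P i : (vp P)`_i = val P`_i. Proof. exact: coef_map. Qed.

Lemma rpM P Q : rp (P * Q) = rp P * rp Q. Proof. exact: rmorphM. Qed.
Lemma rpD P Q : rp (P + Q) = rp P + rp Q. Proof. exact: rmorphD. Qed.
Lemma rpB P Q : rp (P - Q) = rp P - rp Q. Proof. exact: rmorphB. Qed.
Lemma rpN P : rp (- P) = - rp P. Proof. exact: rmorphN. Qed.
Lemma rpXn P n : rp (P ^+ n) = rp P ^+ n. Proof. exact: rmorphXn. Qed.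
Lemma rp0 : rp 0 = 0. Proof. exact: rmorph0. Qed.
Lemma rpC (a : O) : rp a%:P = (red a)%:P. Proof. exact: map_polyC. Qed.
Lemma rp_nat n : rp n%:R = n%:R. Proof. exact: rmorph_nat. Qed.

Lemma rp_deriv P : rp P^`() = (rp P)^`(). Proof. by rewrite deriv_map. Qed.
Lemma vp_deriv P : vp P^`() = (vp P)^`(). Proof. by rewrite deriv_map. Qed.

Lemma pi_neq0 : val pi != 0.
Proof. by apply: contra_eqN vpi => /eqP->; rewrite dv0. Qed.

Lemma vp_inj : injective vp.
Proof. by apply: map_inj_poly => //; exact: val_inj. Qed.

Lemma mulpi_inj P Q : pi%:P * P = pi%:P * Q -> P = Q.
Proof.
move=> /(congr1 vp); rewrite !vpM vpC => /mulfI E; apply/vp_inj/E.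
by rewrite polyC_eq0 pi_neq0.
Qed.

Lemma rp_pi P : rp (pi%:P * P) = 0.
Proof.
rewrite rmorphM /= map_polyC /= (_ : red pi = 0) ?mul0r //.
by apply/hred.2; exists 1; rewrite mulr1.
Qed.

(** Divisibility by [pi ^+ n], phrased by valuations of coefficients so that it passes to limits. *)
Definition congp (n : nat) Q := forall i, vge v n%:Z (val Q`_i).

Lemma congp_div n Q : congp n Q ->
  exists R : {poly O}, Q = (pi ^+ n)%:P * R /\ (size R <= size Q)%N.
Proof.
move=> cQ; have pn0 : val pi ^+ n != 0 by rewrite expf_neq0 // pi_neq0.
have /choice[r Hr] : forall i, exists r : O, val r = val Q`_i / val pi ^+ n.
  move=> i; apply: vring_lift; rewrite -(vge_dvM v _ _ pn0) divfK //.
  by rewrite dvX vpi natz add0r.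
exists (\poly_(i < size Q) r i); split; last exact: size_poly.
apply/polyP => i; rewrite coefCM coef_poly; apply: val_inj.
case: ltnP => [_|le]; last by rewrite mulr0 nth_default.
by rewrite vringM vringXn Hr mulrC divfK.
Qed.

Lemma congp_pi n R : congp n ((pi ^+ n)%:P * R).
Proof.
move=> i; rewrite coefCM vringM vringXn -[_%:Z]addr0; apply: vgeM (vge_val _).
by rewrite /vge dvX vpi natz lexx orbT.
Qed.

Lemma congp_add n P Q : congp n P -> congp n Q -> congp n (P + Q).
Proof. by move=> cP cQ i; rewrite coefD vringD; apply: vgeD. Qed.

Lemma congp_opp n P : congp n P -> congp n (- P).
Proof. by move=> cP i; rewrite coefN vringN vgeN. Qed.

Lemma congp_sub n P Q : congp n P -> congp n Q -> congp n (P - Q).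
Proof. by move=> cP cQ; apply: congp_add => //; exact: congp_opp. Qed.

Lemma congp_mull n P Q : congp n Q -> congp n (P * Q).
Proof. by move=> /congp_div[R [-> _]]; rewrite mulrCA; exact: congp_pi. Qed.

Lemma congp_mulr n P Q : congp n P -> congp n (P * Q).
Proof. by rewrite mulrC; exact: congp_mull. Qed.

Lemma congp_le m n P : (m <= n)%N -> congp n P -> congp m P.
Proof. by move=> mn cP i; apply: vge_le (cP i); rewrite lez_nat. Qed.

Lemma congp0 n : congp n 0.
Proof. by move=> i; rewrite coef0 vring0 vge0. Qed.

Lemma congp_eq0 P : (forall n, congp n P) -> P = 0.
Proof.
move=> cP; apply/polyP => i; rewrite coef0; apply: val_inj; rewrite vring0.
by apply: (@vge_all_eq0 _ v) => N; apply: vge_le (cP `|N|%N i); lia.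
Qed.

Lemma congp1 P : congp 1 P <-> rp P = 0.
Proof.
split=> [cP|rP i].
  by apply/polyP => i; rewrite coef0 coef_map; apply/(red_eq0 _ vpi hred).
by apply/(red_eq0 _ vpi hred); rewrite -coef_map rP coef0.
Qed.

Lemma rp_eq0 P : rp P = 0 -> exists R : {poly O}, P = pi%:P * R.
Proof. by move=> /congp1/congp_div[R [-> _]]; exists R. Qed.

Lemma congpS n P : congp 1 P -> congp n.+1 ((pi ^+ n)%:P * P).
Proof.
move=> /congp_div[R [-> _]]; rewrite mulrA -polyCM -exprD addn1; exact: congp_pi.
Qed.

Lemma red_lift (c : k) : exists C : O, red C = c.
Proof. exact: hred.1. Qed.

Lemma rp_lift (q : {poly k}) : exists Q, rp Q = q /\ (size Q <= size q)%N.
Proof.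
have [r Hr] := choice red_lift.
exists (\poly_(i < size q) r q`_i); split; last exact: size_poly.
apply/polyP => i; rewrite coef_map coef_poly /=; case: ltnP => [_|le]; first by rewrite Hr.
by rewrite rmorph0 nth_default.
Qed.

(** The scalar is a coefficient of least valuation, so its own quotient becomes 1. *)
Lemma primitive_part_exists (a : {poly K}) : a != 0 ->
  exists (c : K) (a1 : {poly O}), [/\ c != 0, a = c *: vp a1 & rp a1 != 0].
Proof.
move=> a0; have [i0 ai0] : exists i : 'I_(size a), a`_i != 0.
  have lt : ((size a).-1 < size a)%N by rewrite prednK // size_poly_gt0.
  by exists (Ordinal lt); rewrite /= -lead_coefE lead_coef_eq0.
have := @arg_minP _ int _ i0 (fun i => a`_i != 0) (fun i => v a`_i) ai0.
case=> i ai Hi; set c := a`_i.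
have /choice[r Hr] : forall l, exists r : O, val r = a`_l / c.
  move=> l; apply: vring_lift; rewrite -(vge_dvM v _ _ ai) divfK // add0r.
  rewrite /vge; case: eqP => //= /eqP al.
  have lt : (l < size a)%N by rewrite ltnNge; apply: contra al => /(nth_default 0)->.
  by have := Hi (Ordinal lt); apply.
exists c, (\poly_(l < size a) r l); split=> //.
  apply/polyP => l; rewrite coefZ coef_vp coef_poly.
  case: ltnP => [_|le]; last by rewrite vring0 mulr0 nth_default.
  by rewrite Hr mulrC divfK.
apply: contraTneq (not_vge1_1 v) => r0; rewrite negbK.
have -> : 1 = val (\poly_(l < size a) r l)`_i by rewrite coef_poly ltn_ord Hr divff.
by apply/(red_eq0 _ vpi hred); rewrite -coef_map r0 coef0.
Qed.

(** Gauss's lemma. If the content of [b] were not integral, scaling by its inverse would make the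
    reduction of [q * b1] vanish, although both factors have nonzero reduction. *)
Lemma gauss_dvd U q (b : {poly K}) : rp q != 0 -> vp U = vp q * b ->
  exists b1 : {poly O}, U = q * b1.
Proof.
move=> rq EU; have [b0|b0] := eqVneq b 0.
  by exists 0; apply: vp_inj; rewrite EU b0 !mulr0 vp0.
have [c [b1 [c0 Db rb1]]] := primitive_part_exists b0.
have [vc|nvc] := boolP (vge v 0 c).
  have [C DC] := vring_lift vc; exists (C%:P * b1); apply: vp_inj.
  by rewrite EU Db !vpM vpC DC mul_polyC.
have [_ vc] := vge_neg nvc.
have vc' : vge v 1 c^-1 by rewrite vgeE ?invr_eq0 // dvV; lia.
have [C DC] := vring_lift (vge_le ler01 vc').
have E : C%:P * U = q * b1.
  apply: vp_inj; rewrite !vpM vpC DC EU Db mulrCA mul_polyC.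
  by rewrite scalerA mulVf // scale1r.
have : rp (q * b1) = 0.
  rewrite -E rmorphM /= map_polyC /= (_ : red C = 0) ?mul0r //.
  by apply/(red_eq0 _ vpi hred); rewrite DC.
by move/eqP; rewrite rmorphM mulf_eq0 (negPf rq) (negPf rb1).
Qed.

(** * Hensel lifting *)

Section Hensel.
Hypothesis comp : dv_complete v.

Lemma poly_limit (s : nat -> {poly O}) N :
  (forall n, (size (s n) <= N)%N) -> (forall n, congp n (s n.+1 - s n)) ->
  exists2 l : {poly O}, (size l <= N)%N & forall n, congp n (l - s n).
Proof.
move=> sN cs.
have cs' n m : (n <= m)%N -> congp n (s m - s n).
  move=> /subnKC <-; elim: (m - n)%N => [|i IHi].
    by rewrite addn0 subrr; exact: congp0.
  have -> : s (n + i.+1)%N - s n = (s (n + i).+1 - s (n + i)%N) + (s (n + i)%N - s n).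
    by rewrite addnS; ring.
  by apply: congp_add => //; apply: congp_le (cs _); exact: leq_addr.
have /choice[l Hl] : forall i, exists l : O, forall n, vge v n%:Z (val l - val (s n)`_i).
  move=> i; have cau : cauchy_seq v (fun n => val (s n)`_i).
    move=> B; exists `|B|%N; move=> m n Bm Bn.
    have H q : (`|B| <= q)%N -> vge v B (val (s q)`_i - val (s `|B|%N)`_i).
      move=> Bq; have := cs' _ _ Bq i; rewrite coefB vringB; apply: vge_le; lia.
    have -> : val (s m)`_i - val (s n)`_i = (val (s m)`_i - val (s `|B|%N)`_i)
      - (val (s n)`_i - val (s `|B|%N)`_i) by ring.
    by rewrite vgeB ?H.
  have [l Hl] := comp cau.
  have cl n : vge v n%:Z (l - val (s n)`_i).
    have [M HM] := Hl n%:Z; have := HM (maxn M n) (leq_maxl _ _).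
    have := cs' n (maxn M n) (leq_maxr _ _) i; rewrite coefB vringB => h1 h2.
    have -> : l - val (s n)`_i = (val (s (maxn M n))`_i - val (s n)`_i)
      - (val (s (maxn M n))`_i - l) by ring.
    exact: vgeB.
  have vl : vge v 0 l.
    by rewrite -(subrK (val (s 0%N)`_i) l); apply: vgeD (cl 0%N) (vge_val _).
  by have [L DL] := vring_lift vl; exists L => n; rewrite DL.
exists (\poly_(i < N) l i); first exact: size_poly.
move=> n i; rewrite coefB vringB coef_poly; case: ltnP => [_|le]; first exact: Hl.
by rewrite nth_default ?subrr ?vge0 // (leq_trans (sN n)).
Qed.

(** Common to the two lifting arguments. The limit is only said to be approximated by pairs
    satisfying [Inv n]; each application deduces its exact equation from that. *)
Lemma newton_limit (Inv : nat -> {poly O} -> {poly O} -> Prop) N1 N2 E0 B0 :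
  Inv 0%N E0 B0 ->
  (forall n E B, Inv n E B -> (size E <= N1)%N /\ (size B <= N2)%N) ->
  (forall n E B, Inv n E B -> exists E' B' : {poly O},
     [/\ Inv n.+1 E' B', congp n (E' - E) & congp n (B' - B)]) ->
  exists E B : {poly O}, [/\ (size E <= N1)%N, (size B <= N2)%N &
    forall n, exists E' B' : {poly O}, [/\ Inv n E' B',
      congp n (E - E') & congp n (B - B')]].
Proof.
move=> I0 sI step.
(* The step function is chosen on all pairs, with a dummy value where the invariant fails. *)
have /choice[st Hst] : forall t : nat * ({poly O} * {poly O}),
  exists t' : {poly O} * {poly O},
    Inv t.1 t.2.1 t.2.2 ->
    [/\ Inv t.1.+1 t'.1 t'.2, congp t.1 (t'.1 - t.2.1) & congp t.1 (t'.2 - t.2.2)].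
  move=> [n [E B]] /=; have [IEB|nI] := pselect (Inv n E B); last by exists (0, 0).
  by have [E' [B' H]] := step _ _ _ IEB; exists (E', B').
pose s := fix s n := if n is n'.+1 then st (n', s n') else (E0, B0).
have Is n : Inv n (s n).1 (s n).2.
  by elim: n => //= n IHn; case: (Hst (n, s n) IHn).
have [|n|E sE cE] := @poly_limit (fun n => (s n).1) N1.
- by move=> n; case: (sI _ _ _ (Is n)).
- by case: (Hst (n, s n) (Is n)).
have [|n|B sB cB] := @poly_limit (fun n => (s n).2) N2.
- by move=> n; case: (sI _ _ _ (Is n)).
- by case: (Hst (n, s n) (Is n)).
by exists E, B; split=> // n; exists (s n).1, (s n).2; split.
Qed.

(** To fit [newton_limit], the scalar is encoded as a polynomial of size at most 1 and the other
    component stays 0. *)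
Lemma hensel_sqrt (C : O) (e : k) : 2 != 0 :> k -> e != 0 -> red C = e ^+ 2 ->
  exists B : O, C = B ^+ 2.
Proof.
move=> k2 e0 De; pose Inv n (E B : {poly O}) :=
  [/\ E = 0, (size B <= 1)%N, rp B = e%:P & congp n.+1 (C%:P - B ^+ 2)].
have [b0 Db0] := red_lift e.
have sqr_size (B : {poly O}) : (size B <= 1)%N -> (size (C%:P - B ^+ 2)%R <= 1)%N.
  by move=> /size1_polyC->; rewrite -polyC_exp -polyCB size_polyC_leq1.
have [||n E B [-> sB rB cB]|E [B [_ sB H]]] := @newton_limit Inv 0 1 0 b0%:P.
- split=> //; [by rewrite size_polyC_leq1 | by rewrite map_polyC /= Db0 |].
  by apply/congp1; rewrite rmorphB rmorphXn /= !map_polyC /= De Db0 polyC_exp subrr.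
- by move=> n E B [-> sB _ _]; rewrite size_poly0.
- have [R [DR sR]] := congp_div cB.
  have {}sR : (size R <= 1)%N by apply: leq_trans sR (sqr_size _ sB).
  (* The Newton correction: the error divided by the derivative [2 e] of the square. *)
  have [b Hb] := red_lift (red R`_0 / (2 * e)).
  exists 0, (B + (pi ^+ n.+1)%:P * b%:P); split; last first.
  + rewrite addrC addKr; apply: congp_le (congp_pi _ _); exact: leqnSn.
  + by rewrite subrr; exact: congp0.
  split=> //.
  + by rewrite (size1_polyC sB) -polyCM -polyCD size_polyC_leq1.
  + by rewrite rmorphD /= rB exprS polyCM -mulrA rp_pi addr0.
  have -> : C%:P - (B + (pi ^+ n.+1)%:P * b%:P) ^+ 2
    = (C%:P - B ^+ 2) - (pi ^+ n.+1)%:P * (2 * B * b%:P)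
      - (pi ^+ n.+1)%:P * ((pi ^+ n.+1)%:P * b%:P ^+ 2) by ring.
  rewrite DR -mulrBr; apply: congp_sub.
    apply: congpS; apply/congp1; rewrite rmorphB !rmorphM /= rB (size1_polyC sR).
    rewrite !map_polyC /= Hb rmorph_nat -polyC_natr -!polyCM -polyCB mulrC.
    by rewrite divfK ?subrr // mulf_neq0.
  by apply: congpS; rewrite exprS polyCM -mulrA; apply/congp1/rp_pi.
exists B`_0; apply/eqP; rewrite -subr_eq0; apply/eqP; apply: (@polyC_inj O).
rewrite polyCB polyC_exp -(size1_polyC sB) polyC0; apply: congp_eq0 => n.
have [E' [B' [[_ _ _ cB'] _ cBB']]] := H n.
have -> : C%:P - B ^+ 2 = (C%:P - B' ^+ 2) - (B + B') * (B - B') by ring.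
by apply: congp_sub; [apply: congp_le cB'; exact: leqnSn | exact: congp_mull].
Qed.

End Hensel.
End IntegralPolynomials.

(** * The polynomial [g^2 + pi h] *)

Section Arithmetic.
Variables (K : fieldType) (v : dvaluation K) (pi : vring v).
Hypothesis vpi : v (val pi) = 1.
Variables (k : fieldType) (red : {rmorphism vring v -> k}).
Hypothesis hred : residue_map pi red.
Hypothesis k2 : 2 != 0 :> k.
Variables (d : nat) (g h : {poly vring v}).
Hypotheses (hg_monic : g \is monic) (hg_deg : size g = d.+1).
Hypothesis hh_deg : (size h <= (d + d).+1)%N.
Hypothesis hgg' : unit_ideal3 pi%:P g g^`().
Hypothesis hgh : unit_ideal3 pi%:P g h.

Notation O := (vring v).
Notation vp := (map_poly (val : O -> K)).
Notation rp := (map_poly red).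
Implicit Types (P Q R A B X Y Z : {poly O}).

Let fO : {poly O} := g ^+ 2 + pi%:P * h.
Let gb := rp g.
Let hb := rp h.

Lemma gb_monic : gb \is monic. Proof. exact: monic_map. Qed.

Lemma size_gb : size gb = d.+1.
Proof.
by rewrite -hg_deg; apply: size_map_poly_id0; rewrite (monicP hg_monic) rmorph1 oner_neq0.
Qed.

Let gb0 : gb != 0. Proof. exact: monic_neq0 gb_monic. Qed.

Lemma rp_fO : rp fO = gb ^+ 2.
Proof. by rewrite /fO rpD rpXn (rp_pi hred) addr0. Qed.

Lemma size_gb2 : size (gb ^+ 2) = (d + d).+1.
Proof. by rewrite expr2 (size_mulp gb0 gb0) size_gb addnS. Qed.

Lemma size_fO : size fO = (d + d).+1.
Proof.
apply/eqP; rewrite eqn_leq; apply/andP; split.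
  apply: leq_trans (size_polyD _ _) _; rewrite geq_max; apply/andP; split.
    by apply: leq_trans (size_polyMleq _ _) _; rewrite hg_deg addnS.
  by rewrite mul_polyC; apply: leq_trans (size_scale_leq _ _) hh_deg.
by rewrite -size_gb2 -rp_fO; exact: size_poly.
Qed.

Lemma size_vp P : size (vp P) = size P.
Proof. exact: (size_map_inj_poly val_inj (rmorph0 _)). Qed.

Lemma size_vfO : size (vp fO) = (d + d).+1.
Proof. by rewrite size_vp size_fO. Qed.

Let bezout_red (P Q : {poly O}) : unit_ideal3 pi%:P P Q -> coprimep (rp P) (rp Q).
Proof.
move=> [r [s [t E]]]; apply/Bezout_eq1_coprimepP; exists (rp s, rp t) => /=.
have := congr1 rp E; rewrite !rpD [r * _]mulrC (rp_pi hred) add0r !rpM rmorph1.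
by [].
Qed.

Lemma coprime_gb_hb : coprimep gb hb. Proof. exact: bezout_red. Qed.

Lemma coprime_gb_gb' : coprimep gb gb^`().
Proof. by rewrite /gb -rp_deriv; exact: bezout_red. Qed.

Lemma ndvd_hb (l : {poly k}) : irreducible_poly l -> l %| gb -> ~~ (l %| hb).
Proof.
move=> irr_l lg; rewrite -irreducible_poly_coprime //.
exact: coprimep_dvdr lg coprime_gb_hb.
Qed.

Lemma ndvd_gb' (l : {poly k}) : irreducible_poly l -> l %| gb -> ~~ (l %| gb^`()).
Proof.
move=> irr_l lg; rewrite -irreducible_poly_coprime //.
exact: coprimep_dvdr lg coprime_gb_gb'.
Qed.

Lemma dvd_lift (l : {poly k}) L P : rp L = l -> l %| rp P ->
  exists Q R : {poly O}, P = L * Q + pi%:P * R.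
Proof.
move=> DL /dvdp_mulE[q Dq]; have [Q [DQ _]] := rp_lift hred q.
have [|R DR] := rp_eq0 vpi hred (P := P - L * Q).
  by rewrite rpB rpM DL DQ Dq mulrC subrr.
by exists Q, R; rewrite -DR; ring.
Qed.

(* [f] is Eisenstein-like at every prime [(pi, L)] above a factor of [gb]. *)
Lemma not_square_ideal (l : {poly k}) L X Y Z : irreducible_poly l -> l %| gb ->
  rp L = l -> fO <> L ^+ 2 * X + pi%:P * L * Y + pi%:P ^+ 2 * Z.
Proof.
move=> irr_l lg DL E; have [G [G' Dg]] := dvd_lift DL lg.
have E1 : pi%:P * h = L ^+ 2 * (X - G ^+ 2)
    + pi%:P * (L * (Y - 2 * G * G') + pi%:P * (Z - G' ^+ 2)).
  have -> : pi%:P * h = fO - g ^+ 2 by rewrite /fO; ring.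
  by rewrite E Dg; ring.
have := congr1 rp E1; rewrite rpD !(rp_pi hred) addr0 rpM rpXn DL.
move/esym/eqP; rewrite mulf_eq0 expf_eq0 (negPf (irredp_neq0 irr_l)) andbF /=.
move=> /eqP/(rp_eq0 vpi hred)[C DC].
have E2 : h = L ^+ 2 * C + (L * (Y - 2 * G * G') + pi%:P * (Z - G' ^+ 2)).
  by apply: (mulpi_inj vpi); rewrite E1 DC; ring.
have := ndvd_hb irr_l lg; rewrite /hb E2 !rpD (rp_pi hred) addr0 !(rpXn, rpM) DL.
by rewrite dvdp_add // dvdp_mulr // expr2 dvdp_mulr.
Qed.

(** Gauss's lemma gives an integral factorization. Reduction does not lower the degree of [fO],
    hence not that of either factor. *)
Lemma factor_lift (q : {poly K}) : irreducible_poly q -> q %| vp fO ->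
  exists q1 q2 : {poly O}, [/\ fO = q1 * q2, size (rp q1) = size q &
    exists2 c : K, c != 0 & q = c *: vp q1].
Proof.
move=> irr_q /dvdp_mulE[b Db].
have [c [q1 [c0 Dq rq1]]] := primitive_part_exists vpi hred (irredp_neq0 irr_q).
have [|q2 Df] := gauss_dvd vpi hred (U := fO) (q := q1) (b := c *: b) rq1.
  by rewrite Db Dq -!mul_polyC; ring.
exists q1, q2; split=> //; last by exists c.
have sq : size q = size q1 by rewrite Dq size_scale // size_vp.
have Erp : gb ^+ 2 = rp q1 * rp q2 by rewrite -rp_fO Df rpM.
have rq2 : rp q2 != 0.
  by apply: contraNneq gb0 => r2; move/eqP: Erp; rewrite r2 mulr0 expf_eq0.
have q20 : vp q2 != 0.
  by apply: contra_neq rq2 => /(congr1 (fun z : {poly K} => size z));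
    rewrite size_vp size_poly0 => /eqP; rewrite size_poly_eq0 => /eqP->; rewrite rp0.
have q10 : vp q1 != 0.
  by apply: contra_neq (irredp_neq0 irr_q) => q10; rewrite Dq q10 scaler0.
have S1 : (d + d).+1 = (size (rp q1) + size (rp q2)).-1.
  by rewrite -size_gb2 Erp (size_mulp rq1 rq2).
have S2 : (d + d).+1 = (size q1 + size q2).-1.
  by rewrite -size_vfO Df vpM (size_mulp q10 q20) !size_vp.
have S3 : (size (rp q2) <= size q2)%N by exact: size_poly.
have S4 : (0 < size (rp q2))%N by rewrite size_poly_gt0.
have S5 : (size q1 <= size (rp q1))%N by move: S1 S2 S3 S4; clear; lia.
by apply/eqP; rewrite sq eqn_leq size_poly.
Qed.

(** A common factor of [f] and [f'] divides [U = (f'^2 - 4 g'^2 f) / pi]. Its reduction shares an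
    irreducible factor with [gb], but modulo [gb] the reduction of [U] is [- 4 hb gb'^2], which is
    prime to [gb]. *)
Lemma coprime_f : coprimep (vp fO) (vp fO)^`().
Proof.
apply: contraT => ncop; set e := gcdp (vp fO) (vp fO)^`().
have f0 : vp fO != 0 by rewrite -size_poly_eq0 size_vfO.
have e0 : e != 0 by rewrite gcdp_eq0 (negPf f0).
have e1 : (1 < size e)%N.
  rewrite ltn_neqAle eq_sym size_poly_gt0 e0 andbT.
  by apply: contra ncop; rewrite coprimep_def.
have [q irr_q qe] := irredp_dvdp_exists e1.
have qf : q %| vp fO by apply: dvdp_trans qe (dvdp_gcdl _ _).
have qf' : q %| (vp fO)^`() by apply: dvdp_trans qe (dvdp_gcdr _ _).
pose U := - (4 * h * g^`() ^+ 2) + 4 * g * g^`() * h^`() + pi%:P * h^`() ^+ 2.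
have DU : pi%:P * U = fO^`() ^+ 2 - fO * (4 * g^`() ^+ 2).
  have -> : fO^`() = 2 * g * g^`() + pi%:P * h^`().
    by rewrite /fO derivD expr2 !derivM derivC; ring.
  by rewrite /U /fO; ring.
have qU : q %| vp U.
  have : q %| vp (pi%:P * U).
    rewrite DU vpB vpXn vpM vp_deriv; apply: dvdp_sub; last exact: dvdp_mulr.
    by rewrite expr2; apply: dvdp_mulr.
  by rewrite vpM vpC irredp_dvdp_mul // irredp_dvdp_polyC // (negPf (pi_neq0 vpi)).
have [q1 [q2 [Df sq [c c0 Dq]]]] := factor_lift irr_q qf.
have q1_gt1 : (1 < size (rp q1))%N by rewrite sq irredp_size.
have rq1 : rp q1 != 0 by rewrite -size_poly_gt0 ltnW.
have [b Db] := dvdp_mulE qU.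
have [|U1 DU1] := gauss_dvd vpi hred (U := U) (q := q1) (b := c *: b) rq1.
  by rewrite Db Dq -!mul_polyC; ring.
have [l irr_l lq1] := irredp_dvdp_exists q1_gt1.
have lg : l %| gb.
  apply: (@irredp_dvdp_exp _ _ _ 2) => //.
  by rewrite -rp_fO Df rpM dvdp_mulr.
have : l %| rp U by rewrite DU1 rpM dvdp_mulr.
rewrite /U !rpD (rp_pi hred) addr0 rpN !(rpXn, rpM) !rp_deriv -/gb -/hb.
rewrite dvdp_addl; last by rewrite -!mulrA dvdp_mull // dvdp_mulr.
rewrite dvdpNr !irredp_dvdp_mul // (negPf (ndvd_hb irr_l lg)).
rewrite rp_nat -polyC_natr irredp_dvdp_polyC //.
rewrite (_ : 4%:R = 2 * 2 :> k) ?mulf_eq0 ?(negPf k2) //=; last by ring.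
by rewrite (negPf (ndvd_gb' irr_l lg)).
Qed.

(** A factor of odd degree reduces to a polynomial in which some [l] has odd multiplicity. The
    multiplicity in [gb ^+ 2] is even, so [l] divides the reduced cofactor too, against
    [not_square_ideal]. *)
Lemma odd_size_factor (q : {poly K}) : irreducible_poly q -> q %| vp fO -> odd (size q).
Proof.
move=> irr_q qf; apply: contraT => eq_.
have [q1 [q2 [Df sq _]]] := factor_lift irr_q qf.
have rq1 : rp q1 != 0 by rewrite -size_poly_gt0 sq ltnW // irredp_size.
have [|l [n [b [irr_l _ Dq1 nlb on]]]] := odd_degree_factor rq1; first by rewrite sq.
have Erp : gb ^+ 2 = rp q1 * rp q2 by rewrite -rp_fO Df rpM.
have lq1 : l %| rp q1 by case: n on Dq1 => // n _ ->; rewrite exprS -mulrA dvdp_mulr.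
have lg : l %| gb.
  by apply: (@irredp_dvdp_exp _ _ _ 2) => //; rewrite Erp dvdp_mulr.
have lq2 : l %| rp q2.
  apply: contraT => nlq2; have [m [b' [Dg nlb']]] := irredp_val_exists irr_l gb0.
  suff En : n = m.*2 by move: on; rewrite En odd_double.
  apply: (@irredp_val_unique _ l _ _ (b * rp q2) (b' ^+ 2) irr_l).
  - by rewrite irredp_dvdp_mul // negb_or nlb.
  - by apply: contra nlb'; exact: irredp_dvdp_exp.
  - by rewrite mulrA -Dq1 -Erp Dg exprMn -muln2 exprM.
have [L [DL _]] := rp_lift hred l.
have [A [A' DA]] := dvd_lift DL lq1; have [B [B' DB]] := dvd_lift DL lq2.
case: (@not_square_ideal l L (A * B) (A * B' + A' * B) (A' * B') irr_l lg DL).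
by rewrite Df DA DB; ring.
Qed.

(** All large exponents are allowed, so that two polynomials can be cleared of denominators by one
    power of [pi]. *)
Lemma pow_lift (a : {poly K}) : exists N, forall n, (N <= n)%N ->
  exists a1 : {poly O}, vp a1 = val pi ^+ n *: a.
Proof.
have [->|a0] := eqVneq a 0; first by exists 0%N => n _; exists 0; rewrite vp0 scaler0.
have [c [a1 [c0 Da _]]] := primitive_part_exists vpi hred a0.
exists `|v c|%N => n le_n; have [|C DC] := @vring_lift _ v (val pi ^+ n * c).
  rewrite vgeE ?mulf_neq0 ?expf_neq0 ?(pi_neq0 vpi) // dvM ?expf_neq0 ?(pi_neq0 vpi) //.
  by rewrite dvX vpi natz; lia.
by exists (C%:P * a1); rewrite vpM vpC DC Da scalerA mul_polyC.
Qed.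

(** Descent on the power of [pi] in the denominator: the hypotheses force [A] and [B] to be
    divisible by [pi]. They are stated so as to cover both a nonsquare unit [C] and a
    uniformizer. *)
Lemma integral_decomp (C : O) :
  (forall A B, rp A ^+ 2 = red C *: rp B ^+ 2 -> rp A = 0) ->
  (forall A B R, pi%:P ^+ 2 * A ^+ 2 - C%:P * B ^+ 2 = pi%:P ^+ 2 * R -> rp B = 0) ->
  forall n A B, A ^+ 2 - C%:P * B ^+ 2 = pi%:P ^+ n.*2 * fO ->
  exists A' B' : {poly O}, A' ^+ 2 - C%:P * B' ^+ 2 = fO.
Proof.
move=> HA HB; elim=> [|n IHn] A B E; first by exists A, B; rewrite E mul1r.
have rA : rp A = 0.
  apply: (HA A B); apply/eqP; rewrite -subr_eq0 -mul_polyC -!rpXn.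
  have -> : (red C)%:P = rp C%:P by rewrite rpC.
  by rewrite -rpM -rpB E doubleS exprS -mulrA (rp_pi hred).
have [A1 DA] := rp_eq0 vpi hred rA.
have rB : rp B = 0.
  apply: (HB A1 B (pi%:P ^+ n.*2 * fO)).
  by rewrite -exprMn -DA E doubleS !exprS; ring.
have [B1 DB] := rp_eq0 vpi hred rB.
apply: (IHn A1 B1); apply: (mulpi_inj vpi); apply: (mulpi_inj vpi).
have -> : pi%:P * (pi%:P * (A1 ^+ 2 - C%:P * B1 ^+ 2)) = A ^+ 2 - C%:P * B ^+ 2.
  by rewrite DA DB; ring.
by rewrite E doubleS !exprS; ring.
Qed.

Lemma sqrt_mod_of_decomp (c : K) (A B : {poly K}) (alpha0 : k) : dv_complete v ->
  root gb alpha0 -> (forall e, c != e ^+ 2) -> vp fO = A ^+ 2 - c *: B ^+ 2 ->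
  exists (eta : k) (b : {poly k}), eta != 0 /\ gb %| b ^+ 2 - eta *: hb.
Proof.
move=> comp ga nsq Df.
have p0 := pi_neq0 vpi.
have c0 : c != 0 by have := nsq 0; rewrite expr0n.
(* Even powers of [pi] move from [c] into [B]. *)
wlog vc : c B nsq Df c0 / v c = 0 \/ v c = 1.
  move=> hwlog; pose m := (v c %/ 2)%Z.
  have pm0 : val pi ^ m != 0 by rewrite expfz_neq0.
  have vpm : v (val pi ^ m) = m.
    by case: (m) => n; rewrite ?NegzE -?invr_expz ?dvV -exprnP dvX vpi natz.
  apply: (hwlog (c / (val pi ^ m) ^+ 2) (val pi ^ m *: B)).
  - move=> e; apply: contra_neq (nsq (e * val pi ^ m)) => E.
    by rewrite exprMn -E divfK // expf_neq0.
  - by rewrite Df exprZn scalerA divfK // expf_neq0.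
  - by rewrite mulf_neq0 // invr_neq0 // expf_neq0.
  rewrite dv_div ?expf_neq0 // dvX vpm.
  have := divz_eq (v c) 2; have := ltz_pmod (v c) (d := 2) isT.
  have := modz_ge0 (v c) (d := 2) isT; rewrite -/m mulr2n.
  move: (v c %% 2)%Z (v c) => r n; clear; lia.
have [C DC] : exists C : O, val C = c.
  by apply: vring_lift; rewrite vgeE //; case: vc => ->.
have [n [A1 [B1 E]]] : exists (n : nat) (A1 B1 : {poly O}),
  A1 ^+ 2 - C%:P * B1 ^+ 2 = pi%:P ^+ n.*2 * fO.
  have [N1 H1] := pow_lift A; have [N2 H2] := pow_lift B.
  have [A1 DA1] := H1 (maxn N1 N2) (leq_maxl _ _).
  have [B1 DB1] := H2 (maxn N1 N2) (leq_maxr _ _).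
  exists (maxn N1 N2), A1, B1; apply: vp_inj.
  rewrite vpB !vpM !vpXn !vpC DA1 DB1 DC Df -!mul_polyC -muln2 exprM polyC_exp; ring.
have E0 : (red C == 0) = (v c == 1).
  apply/eqP/eqP => [/(red_eq0 _ vpi hred)|vc1].
    by rewrite DC vgeE //; case: vc => ->.
  by apply/(red_eq0 _ vpi hred); rewrite DC vgeE // vc1.
(* If [c = pi C0], then [A2] reduces to [gb] up to sign, say [A2 = g - pi E1]. Dividing the identity
   by [pi] shows that [hb] is [- C0 B2^2] modulo [gb], whence [eta = - 1 / C0]. *)
have [vc1|nvc1] := eqVneq (v c) 1.
  have rC : red C = 0 by apply/eqP; rewrite E0 vc1.
  have [C0 DC0] : exists C0 : O, C = pi * C0 by apply/hred.2.
  have rC0 : red C0 != 0.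
    apply/eqP => /(red_eq0 _ vpi hred) v1.
    have : vge v (1 + 1) c by rewrite -DC DC0 vringM; apply: vgeM => //;
      rewrite /vge vpi lexx orbT.
    by rewrite vgeE // vc1.
  have [||A2 [B2 E2]] := integral_decomp _ _ (n := n) (A := A1) (B := B1) E.
  - by move=> P Q /eqP; rewrite rC scale0r expf_eq0 => /eqP.
  - move=> P Q R ER.
    have /(congr1 rp) : pi%:P * P ^+ 2 - C0%:P * Q ^+ 2 = pi%:P * R.
      by apply: (mulpi_inj vpi); rewrite mulrA -expr2 -ER DC0 polyCM; ring.
    rewrite rpB !(rp_pi hred) sub0r rpM rpXn rpC => /eqP.
    by rewrite oppr_eq0 mulf_eq0 polyC_eq0 (negPf rC0) expf_eq0 => /eqP.
  have rA2 : rp A2 ^+ 2 = gb ^+ 2.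
    by rewrite -rp_fO -E2 DC0 polyCM -mulrA rpB (rp_pi hred) subr0 rpXn.
  wlog rA : A2 E2 rA2 / rp A2 = gb.
    move=> hwlog; move/eqP: (rA2); rewrite eqf_sqr => /orP[/eqP rA|/eqP rA];
      first exact: (hwlog A2).
    by apply: (hwlog (- A2)); [rewrite sqrrN | rewrite rpN sqrrN | rewrite rpN rA opprK].
  have [|E1 DE1] := rp_eq0 vpi hred (P := g - A2); first by rewrite rpB rA subrr.
  have DA2 : A2 = g - pi%:P * E1 by rewrite -DE1; ring.
  have Dh : h = - (2 * g * E1) + pi%:P * E1 ^+ 2 - C0%:P * B2 ^+ 2.
    apply: (mulpi_inj vpi); have -> : pi%:P * h = fO - g ^+ 2 by rewrite /fO; ring.
    by rewrite -E2 DA2 DC0 polyCM; ring.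
  exists (- (red C0)^-1), (rp B2); split; first by rewrite oppr_eq0 invr_neq0.
  have Dhb : hb = - (2 * gb * rp E1) - (red C0)%:P * rp B2 ^+ 2.
    rewrite /hb Dh rpB rpD (rp_pi hred) addr0 rpN !(rpXn, rpM) rpC.
    by rewrite rp_nat.
  have -> : rp B2 ^+ 2 - - (red C0)^-1 *: hb = gb * (- (2 * (red C0)^-1 *: rp E1)).
    have EC : (red C0)^-1%:P * (red C0)%:P = 1 by rewrite -polyCM mulVf.
    rewrite scaleNr opprK Dhb -!mul_polyC mulrBr mulrA EC; ring.
  exact: dvdp_mulIl.
(* A unit [c] is impossible. By Hensel its reduction is not a square, so the reductions of [A2] and
   [B2] both vanish at [alpha0], and [fO] would lie in the square of an ideal [(pi, L)]. *)
have vc0 : v c = 0 by case: vc => // vc1; rewrite vc1 eqxx in nvc1.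
have rC0 : red C != 0 by rewrite E0.
have [[e De]|nsqC] := pselect (exists e, red C = e ^+ 2).
  have e0 : e != 0 by apply: contra_neq rC0 => e0; rewrite De e0 expr0n.
  have [D DD] := hensel_sqrt vpi hred comp k2 e0 De.
  by have := nsq (val D); rewrite -vringXn -DD DC eqxx.
have {}nsqC e : red C != e ^+ 2 by apply/eqP => De; apply: nsqC; exists e.
have [||A2 [B2 E2]] := integral_decomp _ _ (n := n) (A := A1) (B := B1) E.
- by move=> P Q /(sum_squares_anisotropic nsqC)[].
- move=> P Q R ER; apply/eqP;
  have /(congr1 rp) : C%:P * Q ^+ 2 = pi%:P * (pi%:P * (P ^+ 2 - R)).
    by rewrite mulrA -expr2 mulrBr -ER; ring.
  rewrite (rp_pi hred) rpM rpXn rpC => /eqP.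
  by rewrite mulf_eq0 polyC_eq0 (negPf rC0) expf_eq0.
have irr := irredp_XsubC alpha0; have lg : 'X - alpha0%:P %| gb by rewrite dvdp_XsubCl.
have Erp : rp A2 ^+ 2 - red C *: rp B2 ^+ 2 = gb ^+ 2.
  by rewrite -rp_fO -E2 rpB !(rpXn, rpM) rpC mul_polyC.
have [ra rb] : (rp A2).[alpha0] = 0 /\ (rp B2).[alpha0] = 0.
  have : (rp A2).[alpha0] ^+ 2 = red C * (rp B2).[alpha0] ^+ 2.
    apply/eqP; rewrite -subr_eq0 -!horner_exp -hornerZ -hornerN -hornerD Erp.
    by rewrite horner_exp (rootP ga) expr0n.
  have [->|b0] := eqVneq (rp B2).[alpha0] 0.
    by rewrite expr0n mulr0 => /eqP; rewrite expf_eq0 => /eqP.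
  move=> Eab; have := nsqC ((rp A2).[alpha0] / (rp B2).[alpha0]).
  by rewrite expr_div_n Eab mulfK ?eqxx // expf_neq0.
have [L [DL _]] := rp_lift hred ('X - alpha0%:P).
have [A3 [A4 DA]] : exists Q R : {poly O}, A2 = L * Q + pi%:P * R.
  by apply: (dvd_lift DL); rewrite dvdp_XsubCl; apply/rootP.
have [B3 [B4 DB]] : exists Q R : {poly O}, B2 = L * Q + pi%:P * R.
  by apply: (dvd_lift DL); rewrite dvdp_XsubCl; apply/rootP.
case: (@not_square_ideal _ L (A3 ^+ 2 - C%:P * B3 ^+ 2) (2 * A3 * A4 - C%:P * (2 * B3 * B4))
  (A4 ^+ 2 - C%:P * B4 ^+ 2) irr lg DL).
by rewrite -E2 DA DB; ring.
Qed.

(* The identity [f = (g - pi E)^2 - pi C B^2] amounts to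
   [h + 2 g E - pi E^2 + C B^2 = 0]. Its linearization modulo [pi] is solvable
   because [gb] and the reduction of [B] are coprime. *)
Lemma decomp_of_sqrt_mod (eta : k) (b : {poly k}) : dv_complete v -> (0 < d)%N ->
  eta != 0 ->
  gb %| b ^+ 2 - eta *: hb ->
  exists (c : K) (A B : {poly K}), [/\ (size A <= d.+1)%N, (size B <= d.+1)%N &
    vp fO = A ^+ 2 - c *: B ^+ 2].
Proof.
move=> comp d_gt0 eta0 gdvd.
(* Chosen so that [gb] divides [hb + red C *: b^2]. *)
have [C DC] := red_lift hred (- eta^-1).
(* Reducing modulo [gb] keeps [B] of degree below [d], so that the errors have degree at most [2 d]
   and [E] at most [d]. *)
set b1 := b %% gb; have sb1 : (size b1 <= d)%N by rewrite -ltnS -size_gb ltn_modp.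
have rC0 : red C != 0 by rewrite DC oppr_eq0 invr_neq0.
have [m Dm] : exists m : {poly k}, hb + red C *: b1 ^+ 2 = m * gb.
  apply: dvdp_mulE; have -> : hb + red C *: b1 ^+ 2
      = (- eta^-1) *: ((b ^+ 2 - eta *: hb) - (b %/ gb * (b + b1)) * gb).
    have -> : b %/ gb * (b + b1) * gb = b ^+ 2 - b1 ^+ 2.
      have : b %/ gb * gb = b - b1 by rewrite {2}(divp_eq b gb) addrK.
      by rewrite mulrAC => ->; ring.
    have Ee : eta^-1%:P * eta%:P = 1 by rewrite -polyCM mulVf.
    by rewrite DC -!mul_polyC polyCN; ring: Ee.
  by rewrite dvdpZr ?oppr_eq0 ?invr_neq0 // dvdp_sub // dvdp_mulIr.
have cop : coprimep gb b1.
  apply: contraT; rewrite coprimep_sym /coprimep => sg.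
  have gg0 : gcdp b1 gb != 0 by rewrite gcdp_eq0 negb_and gb0 orbT.
  have : (1 < size (gcdp b1 gb))%N by rewrite ltn_neqAle eq_sym sg size_poly_gt0.
  move=> /irredp_dvdp_exists[l irr_l]; rewrite dvdp_gcd => /andP[lb lg].
  have := ndvd_hb irr_l lg; have -> : hb = m * gb - red C *: b1 ^+ 2 by rewrite -Dm addrK.
  by rewrite dvdp_sub ?dvdp_mull // dvdpZr // expr2 dvdp_mulr.
have /Bezout_eq1_coprimepP[[u w] /= Euw] := cop.
have sb12 : (size (red C *: b1 ^+ 2) <= (d + d).+1)%N.
  apply: leq_trans (size_scale_leq _ _) _; apply: leq_trans (size_sqr_leq sb1) _.
  by rewrite leqW // leq_pred.
have sz_quo (e : {poly k}) : (size (e * gb)%R <= (d + d).+1)%N -> (size e <= d.+1)%N.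
  have [->|e0] := eqVneq e 0; first by rewrite size_poly0.
  by rewrite (size_mulp e0 gb0) size_gb; clear; lia.
have sm : (size m <= d.+1)%N.
  apply: sz_quo; rewrite -Dm; apply: leq_trans (size_polyD _ _) _.
  by rewrite geq_max sb12 andbT (leq_trans (size_poly _ _)).
(* Solves the equation modulo [pi]: the term [2 g E] cancels [m * gb]. *)
have [E0 [DE0 sE0]] := rp_lift hred (- 2^-1 *: m).
have [B0 [DB0 sB0]] := rp_lift hred b1.
pose err (E B : {poly O}) := h + 2 * g * E - pi%:P * E ^+ 2 + C%:P * B ^+ 2.
pose Inv n (E B : {poly O}) :=
  [/\ (size E <= d.+1)%N, (size B <= d)%N, rp B = b1 & congp n.+1 (err E B)].
have size_err (E B : {poly O}) : (size E <= d.+1)%N -> (size B <= d)%N ->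
  (size (err E B) <= (d + d).+1)%N.
  move=> sE sB; rewrite /err.
  have mulle (P Q : {poly O}) i j : (size P <= i)%N -> (size Q <= j)%N ->
    (size (P * Q)%R <= (i + j).-1)%N.
    by move=> sP sQ; apply: leq_trans (size_polyMleq _ _) _;
      rewrite -!subn1 leq_sub2r // leq_add.
  have h1 : (size (2 * g * E)%R <= (d + d).+1)%N.
    have -> : 2 * g * E = (g * E) *+ 2 by rewrite -mulrA mulr_natl.
    rewrite mulr2n; apply: leq_trans (size_polyD _ _) _; rewrite maxnn.
    by apply: leq_trans (mulle _ _ d.+1 d.+1 _ sE) _; rewrite ?hg_deg // addnS.
  have h2 : (size (pi%:P * E ^+ 2)%R <= (d + d).+1)%N.
    rewrite mul_polyC; apply: leq_trans (size_scale_leq _ _) _.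
    by apply: leq_trans (mulle _ _ _ _ sE sE) _; rewrite addnS.
  have h3 : (size (C%:P * B ^+ 2)%R <= (d + d).+1)%N.
    rewrite mul_polyC; apply: leq_trans (size_scale_leq _ _) _.
    by apply: leq_trans (mulle _ _ _ _ sB sB) _; rewrite leqW // leq_pred.
  apply: leq_trans (size_polyD _ _) _; rewrite geq_max h3 andbT.
  apply: leq_trans (size_polyD _ _) _; rewrite geq_max size_polyN h2 andbT.
  by apply: leq_trans (size_polyD _ _) _; rewrite geq_max hh_deg.
have k2P : (2^-1)%:P * 2 = 1 :> {poly k} by rewrite -polyC_natr -polyCM mulVf.
have [||n E B [sE sB rB cE]|E [B [sE sB H]]] := newton_limit vpi comp (Inv := Inv) (N1 :=
  d.+1) (N2 := d) (E0 := E0) (B0 := B0).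
- split=> //; [apply: leq_trans sE0 _;
  by rewrite (leq_trans (size_scale_leq _ _)) | exact: leq_trans sB0 sb1 |].
  apply/(congp1 vpi hred); rewrite /err rpD rpB rpD (rp_pi hred) subr0 !(rpXn, rpM) /=.
  rewrite rpC DE0 DB0 rp_nat addrAC mul_polyC -/hb Dm -/gb -!mul_polyC polyCN.
  have -> : m * gb + 2 * gb * (- (2^-1)%:P * m) = m * gb * (1 - (2^-1)%:P * 2) by ring.
  by rewrite k2P subrr mulr0.
- by move=> n E B [].
- have [R [DR sR]] := congp_div vpi cE.
  have {}sR : (size R <= (d + d).+1)%N by apply: leq_trans sR (size_err _ _ sE sB).
  (* The equation for the corrections is [rp R + 2 gb E1 + 2 red C b1 bb = 0]. As [w] inverts [b1]
     modulo [gb], it yields [bb]; the multiple [e * gb] that remains is absorbed by [E1 = e / 2]. *)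
  pose s := (2 * red C)^-1 *: (- rp R * w); pose bb := s %% gb.
  have [e De] : exists e : {poly k}, - rp R - 2 * red C *: (b1 * bb) = e * gb.
    exists (- rp R * u + (2 * red C)%:P * b1 * (s %/ gb)).
    have Dbb : bb = s - s %/ gb * gb by apply/esym/eqP; rewrite subr_eq addrC; apply/eqP;
      exact: divp_eq.
    have Ecs : (2 * red C)%:P * s = - rp R * w.
      by rewrite /s mul_polyC scalerA divff ?scale1r // mulf_neq0.
    rewrite Dbb -mul_polyC.
    transitivity (- rp R * (u * gb + w * b1) - b1 * ((2 * red C)%:P * s)
        + (2 * red C)%:P * b1 * (s %/ gb) * gb); first by rewrite Euw; ring.
    by rewrite Ecs; ring.
  have sbb : (size bb <= d)%N by rewrite -ltnS -size_gb ltn_modp.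
  have se : (size (2^-1 *: e) <= d.+1)%N.
    apply: leq_trans (size_scale_leq _ _) _; apply: sz_quo; rewrite -De.
    apply: leq_trans (size_polyD _ _) _;
      rewrite !size_polyN geq_max (leq_trans (size_poly _ _) sR) /=.
    apply: leq_trans (size_scale_leq _ _) _; apply: leq_trans (size_polyMleq _ _) _.
    by rewrite leqW // (leq_trans (leq_pred _)) // leq_add.
  have [E1 [DE1 sE1]] := rp_lift hred (2^-1 *: e).
  have [B1 [DB1 sB1]] := rp_lift hred bb.
  pose P := (pi ^+ n.+1)%:P.
  exists (E + P * E1), (B + P * B1); split; last first.
  + by rewrite addrC addKr; apply: congp_le (congp_pi vpi _ _); exact: leqnSn.
  + by rewrite addrC addKr; apply: congp_le (congp_pi vpi _ _); exact: leqnSn.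
  have szP Q i : (size Q <= i)%N -> (size (P * Q)%R <= i)%N.
    by rewrite /P mul_polyC => sQ; apply: leq_trans (size_scale_leq _ _) sQ.
  split.
  + by apply: leq_trans (size_polyD _ _) _; rewrite geq_max sE szP // (leq_trans sE1).
  + by apply: leq_trans (size_polyD _ _) _; rewrite geq_max sB szP // (leq_trans sB1).
  + by rewrite rpD /= rB /P exprS polyCM -mulrA (rp_pi hred) addr0.
  have -> : err (E + P * E1) (B + P * B1) = err E B
     + P * (2 * g * E1 - pi%:P * (2 * E * E1) + C%:P * (2 * B * B1)
            + P * (C%:P * B1 ^+ 2 - pi%:P * E1 ^+ 2)) by rewrite /err; ring.
  rewrite DR -mulrDr; apply: (congpS vpi); apply/(congp1 vpi hred).
  have -> : P * (C%:P * B1 ^+ 2 - pi%:P * E1 ^+ 2)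
    = pi%:P * ((pi ^+ n)%:P * (C%:P * B1 ^+ 2 - pi%:P * E1 ^+ 2)).
    by rewrite /P exprS polyCM mulrA.
  rewrite !rpD (rp_pi hred) addr0 rpN (rp_pi hred) subr0 !rpM /= rpC DE1 DB1 rB !rp_nat
    -/gb.
  have {}De : rp R = - (e * gb) - 2 * red C *: (b1 * bb) by rewrite -De; ring.
  rewrite De -!mul_polyC polyCM polyC_natr.
  have -> : - (e * gb) - 2 * (red C)%:P * (b1 * bb)
    + (2 * gb * ((2^-1)%:P * e) + (red C)%:P * (2 * b1 * bb)) =
      e * gb * ((2^-1)%:P * 2 - 1) by ring.
  by rewrite k2P subrr mulr0.
have err0 : err E B = 0.
  apply: (congp_eq0 vpi) => n; have [E' [B' [[_ _ _ cE'] cE cB]]] := H n.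
  have -> : err E B = err E' B' + (E - E') * (2 * g - pi%:P * (E + E'))
     + (B - B') * (C%:P * (B + B')) by rewrite /err; ring.
  apply: congp_add; last exact: (congp_mulr vpi).
  apply: congp_add; last exact: (congp_mulr vpi).
  by apply: congp_le cE'; exact: leqnSn.
exists (val (pi * C)), (vp (g - pi%:P * E)), (vp B); split.
- rewrite size_vp; apply: leq_trans (size_polyD _ _) _;
  rewrite size_polyN geq_max hg_deg leqnn /=.
  by rewrite mul_polyC; apply: leq_trans (size_scale_leq _ _) sE.
- by rewrite size_vp leqW.
rewrite -mul_polyC -vpC -!vpXn -vpM -vpB; congr map_poly.
have : pi%:P * err E B = 0 by rewrite err0 mulr0.
rewrite /err /fO polyCM => E0'; apply/eqP; rewrite -subr_eq0 -E0'; apply/eqP; ring.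
Qed.

End Arithmetic.

(** * Square roots modulo a product, and assembly of the theorem *)

Lemma sqrt_mod_prod (k : fieldType) (G a : {poly k}) (ps : seq {poly k}) :
  (forall b c, b * c %| G -> coprimep b c) -> \prod_(q <- ps) q %| G ->
  (forall q, q \in ps -> exists b : {poly k}, q %| b ^+ 2 - a) ->
  exists b : {poly k}, \prod_(q <- ps) q %| b ^+ 2 - a.
Proof.
move=> sqf; elim: ps => [|q ps IHps]; first by exists 0; rewrite big_nil dvd1p.
rewrite big_cons => psG sqrt_ps; set P := \prod_(_ <- _) _ in psG *.
have [b1 qb1] := sqrt_ps q (mem_head _ _).
have [||b2 Pb2] := IHps.
- by apply: dvdp_trans psG; exact: dvdp_mull.
- by move=> r rps; apply: sqrt_ps; rewrite inE rps orbT.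
(* Chinese remaindering: complementary factors of a squarefree [G] are coprime, and the Bezout
   identity interpolates between [b1] and [b2]. *)
have cop := sqf _ _ psG; have /Bezout_eq1_coprimepP[[u w] /= E] := cop.
exists (b1 * (w * P) + b2 * (u * q)); rewrite Gauss_dvdp //; apply/andP; split.
  have -> : (b1 * (w * P) + b2 * (u * q)) ^+ 2 - a
    = (b1 ^+ 2 - a) + ((b1 * (w * P) + b2 * (u * q) + b1) * (u * (b2 - b1))) * q.
    have -> : w * P = 1 - u * q by rewrite -E addrC addKr.
    ring.
  by rewrite dvdp_add // dvdp_mulIr.
have -> : (b1 * (w * P) + b2 * (u * q)) ^+ 2 - a
  = (b2 ^+ 2 - a) + ((b1 * (w * P) + b2 * (u * q) + b2) * (w * (b1 - b2))) * P.
  have -> : u * q = 1 - w * P by rewrite -E addrK.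
  ring.
by rewrite dvdp_add // dvdp_mulIr.
Qed.

Lemma coprimep_mul_dvd (k : fieldType) (G b c : {poly k}) :
  coprimep G G^`() -> b * c %| G -> coprimep b c.
Proof.
move=> sep bcG; have G0 : b * c != 0.
  apply: contraTneq bcG => ->; rewrite dvd0p; apply: contraTneq sep => ->.
  by rewrite deriv0 coprimep0 -size_poly_eq1 size_poly0.
have [b0 c0] : b != 0 /\ c != 0 by move: G0; rewrite mulf_eq0 negb_or => /andP.
apply: contraT; rewrite /coprimep => sg.
have : (1 < size (gcdp b c))%N.
  by rewrite ltn_neqAle eq_sym sg size_poly_gt0 gcdp_eq0 negb_and b0.
move=> /irredp_dvdp_exists[l irr_l]; rewrite dvdp_gcd => /andP[lb lc].
have := squarefree_of_separable sep irr_l; rewrite (dvdp_trans _ bcG) // expr2.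
exact: dvdp_mul.
Qed.

Theorem theorem4p5
  (p : nat) (K : fieldType) (v : dvaluation K) (hK : local_field p v)
  (pi : vring v) (hpi : v (val pi) = 1)
  (k : fieldType) (red : {rmorphism vring v -> k})
  (hred : residue_map pi red) (hk : p \in [pchar k])
  (d : nat) (hd : (3 <= d)%N) (hpd : ~~ (p %| 2 * d)%N)
  (g h : {poly vring v})
  (hg_monic : g \is monic) (hg_deg : size g = d.+1)
  (hh_deg : (size h <= (2 * d).+1)%N)
  (hgg' : unit_ideal3 pi%:P g g^`())
  (hgh : unit_ideal3 pi%:P g h)
  (F : fieldType) (iota : {rmorphism K -> F}) (x y : F)
  (hF : hyperelliptic_function_field iota
          (map_poly (val : vring v -> K) (g ^+ 2 + pi%:P * h)) x y)
  (Omega : lmodType F) (dF : F -> Omega)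
  (hOmega : kaehler_differentials iota dF) :
  (forall (s : nat) (alpha0 : k) (g_ : 'I_s -> {poly k})
      (L : splittingFieldType k) (alpha : 'I_s -> L),
    odd d ->
    map_poly red g = ('X - alpha0%:P) * \prod_(i < s) g_ i ->
    (forall i : 'I_s, irreducible_poly (g_ i)) ->
    (forall i : 'I_s, root (map_poly (in_alg L) (g_ i)) (alpha i)) ->
    let hbar := map_poly red h in
    let hbarL := map_poly (in_alg L) hbar in
    [/\ hbar.[alpha0] != 0,
        forall i : 'I_s, hbarL.[alpha i] != 0
      & has_rational_theta_characteristic iota dF <->
        forall i : 'I_s, exists2 c : k, c != 0 &
          galNorm 1%VS <<1; alpha i>>%VS (hbar.[alpha0]%:A * hbarL.[alpha i])
            = (c ^+ 2)%:A]) /\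
  (~~ odd d \/ irreducible_poly (map_poly red g) ->
    has_rational_theta_characteristic iota dF).
Proof.
have k2 : 2 != 0 :> k.
  apply: contra hpd; rewrite -(dvdn_pcharf hk) => p2; exact: dvdn_mulr.
have K2 : 2 != 0 :> K.
  apply: contra_neq k2 => K2; have E : 2 = 0 :> vring v.
    by apply: val_inj; rewrite vring0 -K2; exact: rmorph_nat.
  by rewrite -(rmorph_nat red) E rmorph0.
have hh : (size h <= (d + d).+1)%N by rewrite addnn -mul2n.
have d2 : (2 <= d)%N by exact: ltnW.
have comp := local_field_complete hK.
have [l lP] := local_field_finite_residue hK hpi hred.
have sf := size_vfO hred hg_monic hg_deg hh.
have fsep := coprime_f hpi hred k2 hg_monic hg_deg hh hgg' hgh.
set gb := map_poly red g; set hb := map_poly red h.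
have theta_of_sqrt_mod (eta : k) (b : {poly k}) : odd d -> eta != 0 ->
  gb %| b ^+ 2 - eta *: hb ->
    has_rational_theta_characteristic iota dF.
  move=> od eta0 sqrt_gb; have d0 : (0 < d)%N by exact: ltnW.
  have [c [A [B [sA sB Df]]]]
    := decomp_of_sqrt_mod hpi hred k2 hg_monic hg_deg hh hgh comp d0 eta0 sqrt_gb.
  exact: (theta_of_decomp hF K2 d2 sf fsep hOmega od sA sB Df).
split; last first.
  have [od [//|irr_g]|ed _] := boolP (odd d);
    last exact: (theta_even hF K2 d2 sf fsep hOmega ed).
  have sgb : ~~ odd (size gb) by rewrite (size_gb _ hg_monic hg_deg) /= negbK.
  have [eta [b [eta0 sqrt_gb]]] :=
    irredp_odd_sqrt_mod_seq lP k2 irr_g sgb (ndvd_hb hred hgh irr_g (dvdpp _)).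
  exact: theta_of_sqrt_mod od eta0 sqrt_gb.
move=> s alpha0 g_ L alpha od Dg irr_g g_alpha hbar hbarL.
have a0g : 'X - alpha0%:P %| gb by rewrite Dg dvdp_mulIl.
have g_gb i : g_ i %| gb.
  by rewrite Dg dvdp_mull // (bigD1 i) //= dvdp_mulIl.
have h0 : hbar.[alpha0] != 0.
  have := ndvd_hb hred hgh (irredp_XsubC _) a0g.
  by rewrite dvdp_XsubCl.
have hL i : hbarL.[alpha i] != 0.
  apply: contra (ndvd_hb hred hgh (irr_g i) (g_gb i)) => hi.
  exact: (irredp_root_dvd (irr_g i) (g_alpha i)).
have uE i : hbar.[alpha0]%:A * hbarL.[alpha i] \in <<1; alpha i>>%VS.
  rewrite rpredM ?rpredZ ?rpred1 //.
  by apply: mempx_Fadjoin; apply/polyOver1P; exists hbar.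
have u0 i : hbar.[alpha0]%:A * hbarL.[alpha i] != 0.
  by rewrite mulf_neq0 // scaler_eq0 negb_or h0 oner_neq0.
have normE i := galNorm_square_seq lP k2 (uE i) (u0 i).
split=> //; split=> [theta i|norms].
  apply/normE.
  have [c [A [B [nsq Df]]]] := decomp_of_theta hF K2 d2 sf fsep hOmega od
    (odd_size_factor hpi hred hg_monic hg_deg hh hgh) theta.
  have ga0 : root gb alpha0 by rewrite -dvdp_XsubCl.
  have [eta [b [eta0 sqrt_gb]]] :=
    sqrt_mod_of_decomp hpi hred k2 hg_monic hg_deg hh hgh comp ga0 nsq Df.
  pose bL := map_poly (in_alg L) b.
  (* Modulo [gb] one has [b^2 = eta * hbar]. Evaluated at [alpha0] and at [alpha i], this makes the
     square of the witness [hbar(alpha0) hbar(alpha i)], the two factors [eta] cancelling. *)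
  exists ((b.[alpha0] / eta)%:A * bL.[alpha i]).
    rewrite rpredM ?rpredZ ?rpred1 //.
    by apply: mempx_Fadjoin; apply/polyOver1P; exists b.
  have E0 : b.[alpha0] ^+ 2 = eta * hbar.[alpha0].
    have := dvdp_trans a0g sqrt_gb; rewrite dvdp_XsubCl => /rootP.
    rewrite hornerD hornerN hornerZ horner_exp => /eqP.
    by rewrite subr_eq0 => /eqP.
  have Ei : bL.[alpha i] ^+ 2 = eta%:A * hbarL.[alpha i].
    have /dvdp_mulE[e De] := dvdp_trans (g_gb i) sqrt_gb.
    have := congr1 (fun r => (map_poly (in_alg L) r).[alpha i]) De.
    rewrite -mul_polyC rmorphB rmorphXn !rmorphM /= map_polyC hornerM (rootP (g_alpha i))
      mulr0.
    rewrite hornerD horner_exp hornerN hornerM hornerC /= => /eqP.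
    by rewrite subr_eq0 => /eqP.
  rewrite exprMn Ei exprZn expr1n mulrA; congr (_ * _).
  by rewrite -scalerAl mul1r scalerA expr_div_n E0; congr (_ *: _); field.
(* Conversely [eta = hbar(alpha0)] works: the norm conditions give a square root modulo each
   [g_ i]. *)
have [b sqrt_gb] : exists b : {poly k}, gb %| b ^+ 2 - hbar.[alpha0] *: hbar; last first.
  exact: theta_of_sqrt_mod od h0 sqrt_gb.
have Dgb : gb = \prod_(q <- ('X - alpha0%:P) :: [seq g_ i | i <- enum 'I_s]) q.
  by rewrite big_cons big_map big_enum.
have sep : coprimep gb gb^`() := coprime_gb_gb' hred hgg'.
rewrite Dgb; apply: (sqrt_mod_prod (G := gb)); first by move=> b c; exact: coprimep_mul_dvd.
  by rewrite -Dgb dvdpp.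
move=> q; rewrite inE => /predU1P[->|/mapP[i _ ->]].
  (* At [alpha0] the target [eta * hbar] is the square of [hbar(alpha0)], so this factor imposes no
     condition. *)
  exists (hbar.[alpha0])%:P; rewrite dvdp_XsubCl /root.
  by rewrite hornerD hornerN hornerZ horner_exp hornerC subrr.
have /normE[w Ew Dw] := norms i.
(* A square root in [k(alpha i)] is a polynomial in [alpha i] over [k]; that polynomial is a square
   root modulo [g_ i]. *)
have /Fadjoin_polyP[r /polyOver1P[b Db] Dwr] := Ew.
exists b; apply: (irredp_root_dvd (irr_g i) (g_alpha i)); apply/rootP.
rewrite -mul_polyC rmorphB rmorphXn rmorphM /= map_polyC /=.
rewrite hornerD horner_exp hornerN hornerM hornerC -Db -Dwr -Dw.
by rewrite subrr.
Qed.
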